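(* Let $p\in(1,\infty)$ and let $q$ be its Hölder conjugate. For $r>0$, $\theta\in[0,2\pi_q)$ and $w\in\mathbb{R}$, the cut time of the $\ell^p$-Heisenberg group is given by $$t_{\mathrm{cut}}[r,\theta,w]=\frac{2\pi_q}{|w|},$$ where by convention $\frac{2\pi_q}{0}=+\infty$. Furthermore, the cotangent injectivity domain from $e$ is the set $$D:=\{(r,\theta,w)\in T^*_e(\mathbb{H})\mid r>0\text{ and }|w|<2\pi_q\}\subseteq T_e^*(\mathbb{H}).$$ The map $\exp_e:D\to\exp_e(D)$ is a homeomorphism and $\mathbb{H}\setminus\exp_e(D)=\{(x,y,z)\in\mathbb{H}\mid x=y=0\}$ is a negligible set. In particular, the $\ell^p$-Heisenberg group (with the Lebesgue measure) has negligible cut locus.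
   Context: **The $\ell^p$-Heisenberg group.** $\mathbb{H}$ is $\mathbb{R}^3$ with group law $(x,y,z)\cdot(x',y',z')=(x+x',y+y',z+z'+\frac12(xy'-x'y))$, identity $e=0$, and left-invariant vector fields $X=\partial_x-\frac y2\partial_z$, $Y=\partial_y+\frac x2\partial_z$, $Z=\partial_z$. An absolutely continuous curve $\gamma$ on an interval is horizontal if $\dot\gamma=u_1X(\gamma)+u_2Y(\gamma)$ a.e.; its length is $\int(|u_1|^p+|u_2|^p)^{1/p}\,dt$. The distance $d$ is the infimum of lengths of horizontal curves joining two points. The measure is the Lebesgue measure $\mathcal{L}^3$. **$q$-trigonometric functions.** $\mathbb{B}_q$ is the unit ball of $(\mathbb{R}^2,\|\cdot\|_q)$ and $\pi_q$ its area. For $\theta\in[0,2\pi_q)$, $(\cos_q\theta,\sin_q\theta)$ is the unique point $P_\theta$ of the unit sphere of $\|\cdot\|_q$ such that the sector of $\mathbb{B}_q$ swept counterclockwise from the positive $x$-axis to the ray from the origin through $P_\theta$ has area $\theta/2$; extended $2\pi_q$-periodically to $\mathbb{R}$. Write $\cos_p(\theta^\circ)=|\cos_q\theta|^{q-1}\mathrm{sgn}(\cos_q\theta)$, $\sin_p(\theta^\circ)=|\sin_q\theta|^{q-1}\mathrm{sgn}(\sin_q\theta)$. **Exponential map.** $T_e^*(\mathbb{H})\cong\mathbb{R}^3$ is described by $\ell^q$-cylindrical coordinates $(r,\theta,w)\in[0,\infty)\times[0,2\pi_q)\times\mathbb{R}$, where $\lambda\in T_e^*(\mathbb{H})$ has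 $\langle\lambda,X\rangle=r\cos_q\theta$, $\langle\lambda,Y\rangle=r\sin_q\theta$, $\langle\lambda,Z\rangle=w$ ($\theta$ is understood modulo $2\pi_q$). For $t\in\mathbb{R}$, $\exp_e^t(r,\theta,w)=(x(t),y(t),z(t))$ with, for $w\neq0$, $$x(t)=\tfrac rw(\sin_q(wt+\theta)-\sin_q\theta),\quad y(t)=-\tfrac rw(\cos_q(wt+\theta)-\cos_q\theta),$$ $$z(t)=\tfrac{r^2}{2w^2}\big(wt+\cos_q(wt+\theta)\sin_q\theta-\sin_q(wt+\theta)\cos_q\theta\big),$$ and for $w=0$: $x(t)=rt\cos_p(\theta^\circ)$, $y(t)=rt\sin_p(\theta^\circ)$, $z(t)=0$. Set $\exp_e=\exp_e^1$. **Cut time and injectivity domain.** $t_{\mathrm{cut}}[r,\theta,w]=\sup\{T>0\mid [0,T]\ni t\mapsto\exp_e^t(r,\theta,w)\text{ is length minimising}\}$. The cotangent injectivity domain from $e$ is the set of $(r,\theta,w)$, $r>0$, such that the (non-constant) curve $[0,1]\ni t\mapsto\exp_e^t(r,\theta,w)$ is the unique (up to reparametrisation) length minimiser between its endpoints. **Negligible cut locus.** $(X,d,\mathfrak{m})$ has negligible cut locus if for every $x\in X$ there are a negligible set $\mathcal{C}(x)$ and a measurable map $\Phi_x:(X\setminus\mathcal{C}(x))\times[0,1]\to X$ such that $t\mapsto\Phi_x(y,t)$ is the unique (constant speed) minimising geodesic between $x$ and $y$. *)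

(* Defs.v *)
From HB Require Import structures.
From mathcomp Require Import all_boot all_order all_algebra.
From mathcomp Require Import all_classical all_reals all_analysis.

Set Implicit Arguments.
Unset Strict Implicit.
Unset Printing Implicit Defensive.

Import Order.TTheory GRing.Theory Num.Theory.
Import numFieldNormedType.Exports.

Local Open Scope classical_set_scope.
Local Open Scope ring_scope.

(* A point (x, y, z) of the Heisenberg group is the nested pair ((x, y), z), so
   that the topological, normed and Borel structures of R^3 are those inferred
   on products.  Covectors at the identity e = 0 are triples as well: (a, b, c)
   stands for a dx + b dy + c dz. *)
Notation heis R := (R * R * R)%type.

Definition leb2 (R : realType) : set (R * R) -> \bar R :=
  (@lebesgue_measure R \x @lebesgue_measure R)%E.

Definition leb3 (R : realType) : set (heis R) -> \bar R :=
  ((@lebesgue_measure R \x @lebesgue_measure R) \x @lebesgue_measure R)%E.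

(* The fields X = d_x - (y/2) d_z, Y = d_y + (x/2) d_z and Z = d_z, which are
   left-invariant for the law
   (x,y,z).(x',y',z') = (x + x', y + y', z + z' + (x y' - x' y)/2). *)
Definition Xfield (R : realType) (h : heis R) : heis R :=
  ((1, 0), - (h.1.2 / 2)).
Definition Yfield (R : realType) (h : heis R) : heis R :=
  ((0, 1), h.1.1 / 2).
Definition Zfield (R : realType) (h : heis R) : heis R :=
  ((0, 0), 1).

Definition lnorm (R : realType) (s : R) (v : R * R) : R :=
  (`|v.1| `^ s + `|v.2| `^ s) `^ s^-1.

Definition abs_continuous (R : realType) (V : normedModType R) (a b : R)
    (f : R -> V) : Prop :=
  forall e : R, 0 < e -> exists2 d : R, 0 < d &
    forall (n : nat) (s t : 'I_n -> R),
      (forall i, a <= s i /\ s i <= t i /\ t i <= b) ->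
      (forall i j, i != j -> `]s i, t i[ `&` `]s j, t j[ = set0) ->
      \sum_(i < n) (t i - s i) < d ->
      \sum_(i < n) `|f (t i) - f (s i)| < e.

(* The controls u1, u2 are determined by g almost everywhere; taking them Borel
   measurable is no restriction and makes the length integral meaningful. *)
Definition horizontal (R : realType) (a b : R) (g : R -> heis R)
    (u1 u2 : R -> R) : Prop :=
  [/\ a <= b,
      abs_continuous a b g,
      measurable_fun `[a, b] u1,
      measurable_fun `[a, b] u2 &
      {ae @lebesgue_measure R, forall t, t \in `[a, b] ->
         is_derive t 1 g
           (u1 t *: Xfield (g t) + u2 t *: Yfield (g t))}].

Definition hlength (R : realType) (p a b : R) (u1 u2 : R -> R) : \bar R :=
  (\int[@lebesgue_measure R]_(t in `[a, b]) (lnorm p (u1 t, u2 t))%:E)%E.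

Definition hdist (R : realType) (p : R) (x y : heis R) : \bar R :=
  ereal_inf [set L | exists a b g u1 u2,
    [/\ horizontal a b g u1 u2, g a = x, g b = y & L = hlength p a b u1 u2]].

Definition length_minimising (R : realType) (p a b : R) (g : R -> heis R) :
    Prop :=
  exists u1 u2, horizontal a b g u1 u2 /\
    hlength p a b u1 u2 = hdist p (g a) (g b).

(* h, on [a, b], is a reparametrisation of g, on [0, 1]. *)
Definition reparametrisation (R : realType) (g : R -> heis R) (a b : R)
    (h : R -> heis R) : Prop :=
  exists phi : R -> R,
    [/\ {within `[a, b], continuous phi},
        {in `[a, b] &, {homo phi : s t / s <= t}},
        phi a = 0, phi b = 1 &
        {in `[a, b], forall t, h t = g (phi t)}].

Definition unique_length_minimiser (R : realType) (p : R) (g : R -> heis R) :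
    Prop :=
  length_minimising p 0 1 g /\
  forall (a b : R) (h : R -> heis R),
    length_minimising p a b h -> h a = g 0 -> h b = g 1 ->
    reparametrisation g a b h.

Definition qball (R : realType) (q : R) : set (R * R) :=
  [set v | lnorm q v <= 1].

Definition qpi (R : realType) (q : R) : R := fine (leb2 (qball q)).

(* The part of the ball whose Euclidean polar angle lies in [0, phi]. *)
Definition qsector (R : realType) (q phi : R) : set (R * R) :=
  [set v | qball q v /\ exists rho psi : R,
    [/\ 0 <= rho, 0 <= psi, psi <= phi & v = (rho * cos psi, rho * sin psi)]].

Definition is_qpoint (R : realType) (q theta : R) (P : R * R) : Prop :=
  lnorm q P = 1 /\
  exists rho phi : R,
    [/\ 0 < rho, 0 <= phi, phi < 2 * pi,
        P = (rho * cos phi, rho * sin phi) &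
        leb2 (qsector q phi) = (theta / 2)%:E].

(* The representative of theta modulo 2 qpi in [0, 2 qpi). *)
Definition qmod (R : realType) (q theta : R) : R :=
  theta - (Num.floor (theta / (2 * qpi q)))%:~R * (2 * qpi q).

Definition qpoint (R : realType) (q theta : R) : R * R :=
  get [set P | is_qpoint q (qmod q theta) P].

Definition qcos (R : realType) (q theta : R) : R := (qpoint q theta).1.
Definition qsin (R : realType) (q theta : R) : R := (qpoint q theta).2.

(* cos_p(theta^o) and sin_p(theta^o), p being the conjugate exponent of q. *)
Definition qcos_dual (R : realType) (q theta : R) : R :=
  `|qcos q theta| `^ (q - 1) * Num.sg (qcos q theta).
Definition qsin_dual (R : realType) (q theta : R) : R :=
  `|qsin q theta| `^ (q - 1) * Num.sg (qsin q theta).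

Definition exp_curve (R : realType) (q r theta w t : R) : heis R :=
  if w == 0 then
    ((r * t * qcos_dual q theta, r * t * qsin_dual q theta), 0)
  else
    ((r / w * (qsin q (w * t + theta) - qsin q theta),
      - (r / w * (qcos q (w * t + theta) - qcos q theta))),
     r ^+ 2 / (2 * w ^+ 2) *
       (w * t + qcos q (w * t + theta) * qsin q theta
              - qsin q (w * t + theta) * qcos q theta)).

Definition covpair (R : realType) (l v : heis R) : R :=
  l.1.1 * v.1.1 + l.1.2 * v.1.2 + l.2 * v.2.

Definition is_cylindrical (R : realType) (q : R) (l : heis R) (r theta w : R) :
    Prop :=
  let e : heis R := ((0, 0), 0) in
  [/\ 0 <= r, 0 <= theta < 2 * qpi q,
      covpair l (Xfield e) = r * qcos q theta,
      covpair l (Yfield e) = r * qsin q theta &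
      covpair l (Zfield e) = w].

(* exp_e on covectors.  The cylindrical coordinates of l are unique if r > 0;
   if r = 0 the angle is arbitrary, but then the curve is constant. *)
Definition heis_exp (R : realType) (q : R) (l : heis R) : heis R :=
  let c := get [set c : R * R * R | is_cylindrical q l c.1.1 c.1.2 c.2] in
  exp_curve q c.1.1 c.1.2 c.2 1.

Definition cut_time (R : realType) (p q r theta w : R) : \bar R :=
  ereal_sup [set T%:E | T in
    [set T : R | 0 < T /\ length_minimising p 0 T (exp_curve q r theta w)]].

Definition injectivity_domain (R : realType) (p q : R) : set (heis R) :=
  [set l | exists r theta w,
    [/\ is_cylindrical q l r theta w, 0 < r &
        unique_length_minimiser p (exp_curve q r theta w)]].

Definition cut_domain (R : realType) (q : R) : set (heis R) :=
  [set l | exists r theta w,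
    [/\ is_cylindrical q l r theta w, 0 < r & `|w| < 2 * qpi q]].

(* f restricted to A is a homeomorphism onto f(A), both with the subspace
   topology. *)
Definition homeomorphism_on (S T : topologicalType) (A : set S) (f : S -> T) :
    Prop :=
  {within A, continuous f} /\
  exists g : T -> S,
    {in A, cancel f g} /\ {within f @` A, continuous g}.

Definition geodesic (R : realType) (X : Type) (dist : X -> X -> \bar R)
    (x y : X) (g : R -> X) : Prop :=
  [/\ g 0 = x, g 1 = y &
      {in `[0, 1] &, forall s t : R,
        dist (g s) (g t) = (`|t - s|%:E * dist x y)%E}].

(* C is also required to be measurable, because [measurable_fun D f] is vacuous
   when D is not measurable. *)
Definition negligible_cut_locus (R : realType) (disp : measure_display)
    (X : measurableType disp) (dist : X -> X -> \bar R) (m : set X -> \bar R) :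
    Prop :=
  forall x : X, exists (C : set X) (Phi : X * R -> X),
    [/\ measurable C, m.-negligible C,
        measurable_fun ((~` C) `*` `[0%R : R, 1%R]%classic) Phi &
        forall y, ~ C y ->
          geodesic dist x y (fun t => Phi (y, t)) /\
          forall g, geodesic dist x y g ->
            {in `[0, 1], forall t, g t = Phi (y, t)}].

(* Main.v *)
(* Absolutely continuous curves are compared with calibrations: functions Psi on
   the group whose horizontal gradient has dual norm at most rho satisfy
   Psi (g b) - Psi (g a) <= rho * length g.  Linear calibrations give the lines
   (w = 0).  For w <> 0 a curve ending on a circle with |w| <= 2 qpi is
   completed by the rest of the circle to a curve with closed projection, and
   Schmidt's proof of the isoperimetric inequality, in which the two halves of a
   dilated dual ball calibrate the arcs between the extremal abscissae, bounds its
   length from below by that of the full circle.  The equality case, read in both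
   coordinates, identifies the angle and the curvature of any initial circle arc,
   so minimisers are unique before the full circle.  Every point off the vertical
   axis is reached with |w| < 2 qpi by a continuity argument on the chords of the
   unit sphere with a given direction.  The inverse of exp is continuous because
   exp is proper and injective, and the cut locus statement follows as distances
   are realised by translated exponential curves. *)
Require Import Defs.
From HB Require Import structures.
From mathcomp Require Import all_boot all_order all_algebra.
From mathcomp Require Import all_classical all_reals all_analysis.
From mathcomp Require Import measurable_realfun ftc lebesgue_integral lebesgue_integral_differentiation.
From mathcomp Require Import ring lra.

Set Implicit Arguments.
Unset Strict Implicit.
Unset Printing Implicit Defensive.

Import Order.TTheory GRing.Theory Num.Theory.
Import numFieldNormedType.Exports.

Local Open Scope classical_set_scope.
Local Open Scope ring_scope.

(** Horizontal curves are only absolutely continuous, so they enter through their increments against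
    test functions alone; the resulting notion [calibrated] is closed under gluing, translation and
    exchange of the two horizontal coordinates. The calibrations for circles rest on the fact that z
    + x y / 2 integrates x dy along a horizontal curve: subtracting an antiderivative of half a ball
    leaves a horizontal gradient that is a turned point of a q-sphere. One statement,
    [minimiser_through_point], about an exponential arc followed by an arbitrary curve, serves
    injectivity, uniqueness and the loss of minimality after a full turn. The derivatives of the
    q-trigonometric functions are signed powers, which can fail to be differentiable (q < 2) or have
    zero derivative (q > 2) at 0. No inverse function theorem is therefore available: mean values
    give continuity of exp across w = 0, compactness that of its inverse. *)

(** * Growth of absolutely continuous functions *)

Section absolute_continuity.
Context (R : realType).
Notation mu := (@lebesgue_measure R).

(* Up to the abscissa x, the growth of f is paid for by K, by e times the length,
   and by finitely many disjoint intervals charged to the small open set U; the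
   supremum of such x is then shown to be b, as in Cousin's lemma. *)
Let covered (f K : R -> R) (U : set R) (a e x : R) : Prop :=
  exists (n : nat) (s t : nat -> R),
    [/\ (forall i, (i < n)%N -> a <= s i /\ s i <= t i /\ t i <= x),
        (forall i j, (i < j < n)%N -> t i <= s j),
        ((\sum_(i < n) (t i - s i))%:E <= mu (U `&` `]-oo, x[))%E &
        f x - f a <= K x - K a + e * (x - a) + \sum_(i < n) `|f (t i) - f (s i)|].

Let covered_le f K U a e x y : x <= y -> covered f K U a e x ->
  open U ->
  f y - f x <= K y - K x + e * (y - x) -> covered f K U a e y.
Proof.
move=> xy [n [s [t [H1 H2 H3 H4]]]] oU H5; exists n, s, t; split => //.
- by move=> i /H1 [? [? ?]]; split => //; split => //; apply: le_trans xy.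
- apply: (le_trans H3); apply: le_measure; rewrite ?inE.
  + by apply: measurableI; [exact: open_measurable|].
  + by apply: measurableI; [exact: open_measurable|].
  + apply: setIS => z /=; rewrite !in_itv/= => zx; exact: lt_le_trans xy.
- lra.
Qed.

Let covered_U f K U a e x y : x <= y -> a <= x -> covered f K U a e x ->
  open U -> K x <= K y -> 0 <= e ->
  `]x, y[ `<=` U -> covered f K U a e y.
Proof.
move=> xy ax [n [s [t [H1 H2 H3 H4]]]] oU Kxy e0 xyU.
have mU z : measurable (U `&` `]-oo, z[).
  by apply: measurableI => //; exact: open_measurable.
exists n.+1, (fun i => if (i < n)%N then s i else x),
  (fun i => if (i < n)%N then t i else y); split => //.
- move=> i _; case: ifPn => [/H1 [? [? ?]]|_]; last by split.
  by split => //; split => //; apply: le_trans xy.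
- move=> i j /andP[ij jn]; rewrite (_ : (i < n)%N); last first.
    by rewrite (leq_trans ij).
  have [jn'|_] := ltnP j n; first by apply: H2; rewrite ij.
  by have [] := H1 i _; [exact: leq_trans ij _|move=> _ []].
- rewrite big_ord_recr /= ltnn.
  have -> : \sum_(i < n) ((if (i < n)%N then t i else y) -
      (if (i < n)%N then s i else x)) = \sum_(i < n) (t i - s i).
    by apply: eq_bigr => i _; rewrite ltn_ord.
  apply: (@le_trans _ _ (mu ((U `&` `]-oo, x[) `|` `]x, y[))).
    have -> : mu ((U `&` `]-oo, x[) `|` `]x, y[) =
        (mu (U `&` `]-oo, x[) + mu `]x, y[)%E.
      apply: measureU => //; first exact: mU.
      apply/seteqP; split => // z /= [[_]]; rewrite !in_itv/= => zx /andP[xz _].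
      by have := lt_trans zx xz; rewrite ltxx.
    rewrite EFinD leeD// lebesgue_measure_itv/= lte_fin.
    by case: ltP => [_|yx]; rewrite -?EFinD// lee_fin; lra.
  apply: le_measure; rewrite ?inE//.
    by apply: measurableU; first exact: mU.
    exact: mU.
  move=> z [[Uz]|]; rewrite /= !in_itv/=.
    by move=> zx; split => //; exact: lt_le_trans xy.
  move=> /andP[xz zy]; split => //.
  by apply: xyU; rewrite /= in_itv/= xz zy.
- rewrite big_ord_recr /= ltnn.
  have -> : \sum_(i < n) `|f (if (i < n)%N then t i else y) -
      f (if (i < n)%N then s i else x)| = \sum_(i < n) `|f (t i) - f (s i)|.
    by apply: eq_bigr => i _; rewrite ltn_ord.
  have h1 := ler_norm (f y - f x).
  have h2 : e * (x - a) <= e * (y - a) by rewrite ler_wpM2l//; lra.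
  lra.
Qed.

Lemma is_derive_increment (f : R -> R) (t l : R) : is_derive t 1 f l ->
  forall e, 0 < e -> exists2 d, 0 < d & forall u, `|u - t| < d ->
    `|f u - f t - l * (u - t)| <= e * `|u - t|.
Proof.
move=> [df fl] e e0.
move: df => /cvg_ex[l' /= fl'].
have l'E : l' = l by rewrite -fl; apply/esym/cvg_lim.
move: fl'; rewrite l'E => /cvgrPdist_le /(_ _ e0).
rewrite /= near_withinE => /nbhs_ballP[d /= d0 H].
exists d => // u ut.
have [->|ut0] := eqVneq u t; first by rewrite !subrr mulr0 subrr normr0 mulr0.
have ut0' : u - t != 0 by rewrite subr_eq0.
have := H (u - t) _ ut0'; rewrite /ball /= sub0r normrN => /(_ ut).
rewrite -[(u - t)%:A]/((u - t) * 1) mulr1 subrK.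
rewrite -[_^-1 *: _]/(_^-1 * _) => h.
rewrite (_ : f u - f t - l * (u - t) = - (l - (u - t)^-1 * (f u - f t)) * (u - t)); last by field.
by rewrite normrM normrN ler_wpM2r.
Qed.

(** Straddle form: t lies between u and v, and the two one-sided errors add up to e * (v - u). *)
Lemma is_derive_straddle (f : R -> R) (t l : R) : is_derive t 1 f l ->
  forall e, 0 < e -> exists2 d, 0 < d & forall u v, t - d < u -> u <= t ->
    t <= v -> v < t + d -> `|f v - f u - l * (v - u)| <= e * (v - u).
Proof.
move=> /is_derive_increment H e /H[d d0 {}H]; exists d => // u v tu ut tv vt.
have hu : `|u - t| = t - u by rewrite ler0_norm ?opprB// subr_le0.
have hv : `|v - t| = v - t by rewrite ger0_norm // subr_ge0.
have := H v; rewrite hv ler_norml => /(_ ltac:(lra))/andP[a1 a2].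
have := H u; rewrite hu ler_norml => /(_ ltac:(lra))/andP[b1 b2].
by rewrite ler_norml; apply/andP; split; lra.
Qed.

(** The exceptional null set sits in an open [U] of measure below the modulus [d] that absolute
    continuity gives for e / 2. Around a point of [U] short intervals stay in [U]; around any other
    point the two derivatives compare the increments up to the slope [e1]. *)
Lemma abs_continuous_le_nondecreasing (f K : R -> R) (N : set R) (a b : R) :
  a <= b -> abs_continuous a b f -> mu.-negligible N ->
  {in `[a, b] &, {homo K : x y / x <= y}} ->
  (forall t, t \in `[a, b] -> ~ N t -> exists lf lK,
     [/\ is_derive t 1 f lf, is_derive t 1 K lK & lf <= lK]) ->
  f b - f a <= K b - K a.
Proof.
move=> ab acf [M [mM M0 NM]] Kh H.
suff He e : 0 < e -> f b - f a <= K b - K a + e.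
  by apply/ler_addgt0Pr => e e0; have := He e e0; lra.
(* Half of e pays for the intervals charged to [U], half for the slopes; the added 1 allows a =
   b. *)
move=> e0; pose e1 := e / 2 / (b - a + 1).
have e10 : 0 < e1 by rewrite !divr_gt0//; lra.
have [d d0 Hd] := acf (e / 2) ltac:(by rewrite divr_gt0).
have M1 : (mu M < +oo)%E by rewrite M0 ltry.
have [U [oU MU Ud]] := lebesgue_regularity_outer mM M1 d0.
have mU : measurable U by exact: open_measurable.
have muU : (mu U < d%:E)%E.
  rewrite (_ : U = (U `\` M) `|` M); last first.
    apply/seteqP; split => [z Uz|z [[]|/MU]//].
    by have [Mz|Mz] := pselect (M z); [right|left].
  have -> : mu ((U `\` M) `|` M) = (mu (U `\` M) + mu M)%E.
    apply: measureU => //; first exact: measurableD.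
    by rewrite setDE -setIA setICl setI0.
  by rewrite M0 adde0.
have loc t : a <= t <= b -> exists2 d, 0 < d & forall u v, t - d < u -> u <= t ->
    t <= v -> v < t + d -> a <= u -> v <= b ->
    `]u, v[ `<=` U \/ f v - f u <= K v - K u + e1 * (v - u).
  move=> tab; have [Mt|Mt] := pselect (U t).
    have /nbhs_ballP[r /= r0 rU] := open_nbhs_nbhs (conj oU Mt).
    exists r => // u v h1 h2 h3 h4 _ _; left => z /=; rewrite in_itv/= => /andP[uz zv].
    by apply: rU; rewrite /ball/= ltr_norml; apply/andP; split; lra.
  have [|lf [lK [Hf HK lfK]]] := H t tab.
    by move=> /NM /MU.
  have e2 : 0 < e1 / 2 by rewrite divr_gt0.
  have [d1 d10 {}Hf] := is_derive_straddle Hf e2.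
  have [d2 d20 {}HK] := is_derive_straddle HK e2.
  exists (Num.min d1 d2); first by rewrite lt_min d10.
  move=> u v; rewrite ltrBlDr -ltrBlDl lt_min => /andP[h1 h1'] h2 h3.
  rewrite -ltrBlDl lt_min => /andP[h4 h4'] _ _; right.
  have := Hf u v ltac:(lra) h2 h3 ltac:(lra).
  have := HK u v ltac:(lra) h2 h3 ltac:(lra).
  rewrite !ler_norml => /andP[b1 b2] /andP[c1 c2].
  have h5 : lf * (v - u) <= lK * (v - u) by rewrite ler_wpM2r//; lra.
  lra.
pose C := [set x | a <= x <= b /\ covered f K U a e1 x].
have Ca : C a.
  split; first by rewrite lexx.
  exists 0%N, (fun=> 0), (fun=> 0); split => //.
  - by rewrite big_ord0 measure_ge0.
  - by rewrite big_ord0 !subrr mulr0 !addr0.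
have supC : has_sup C.
  by split; [exists a|exists b => x [/andP[]]].
pose c := sup C.
have cC x : C x -> x <= c by move=> Cx; apply: ub_le_sup => //; exact: supC.2.
have cab : a <= c <= b.
  apply/andP; split; first exact: cC.
  by apply: ge_sup; [exists a|move=> x [/andP[]]].
have [dc dc0 Hc] := loc c cab.
have [x Cx xc] := sup_adherent dc0 supC.
have step u v : c - dc < u -> u <= c -> c <= v -> v < c + dc -> v <= b ->
    C u -> C v.
  move=> h1 h2 h3 h4 h5 [/andP[h6 h7] Cu]; split.
    by apply/andP; split; lra.
  have uv : u <= v by lra.
  have [HU|HU] := Hc u v h1 h2 h3 h4 h6 h5.
    apply: (covered_U uv h6 Cu oU _ (ltW e10) HU).
    by apply: Kh => //; rewrite in_itv/=; apply/andP; split; lra.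
  exact: (covered_le uv Cu oU HU).
case/andP: (cab) => ac cb.
have Cc : C c by apply: (step x) => //; [exact: cC|lra].
have cbE : c = b.
  apply/eqP; rewrite eq_le cb /= leNgt; apply/negP => cltb.
  have := cC (Num.min b (c + dc / 2)).
  have h : C (Num.min b (c + dc / 2)).
    apply: (step c) => //; first by lra.
    - by rewrite le_min; apply/andP; split; lra.
    - by rewrite gt_min; apply/orP; right; lra.
    - by rewrite ge_min lexx.
  move=> /(_ h); rewrite ge_min => /orP[]; lra.
move: Cc; rewrite cbE => -[_ [n [s [t [H1 H2 H3 H4]]]]].
have : \sum_(i < n) `|f (t i) - f (s i)| < e / 2.
  apply: Hd; first by move=> i; apply: H1.
  - move=> i j ij; apply/seteqP; split => // z /=.
    rewrite !in_itv/= => -[/andP[h1 h2] /andP[h3 h4]].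
    have [lij|lji|/val_inj eij] := ltngtP i j.
    + have := H2 i j; rewrite lij ltn_ord => /(_ isT); lra.
    + have := H2 j i; rewrite lji ltn_ord => /(_ isT); lra.
    + by rewrite eij eqxx in ij.
  - rewrite -lte_fin; apply: (le_lt_trans H3); apply: le_lt_trans muU.
    by apply: le_measure; rewrite ?inE//; exact: measurableI.
have h5 : e1 * (b - a) <= e / 2.
  have : e1 * (b - a + 1) = e / 2 by rewrite /e1 divfK//; lra.
  lra.
move=> h6; lra.
Qed.

(** [K] is the indefinite integral of k extended by 0: it is nondecreasing as k is nonnegative, and
    by Lebesgue differentiation its derivative is k almost everywhere on [a, b]. If the integral is
    infinite there is nothing to prove. *)
Lemma abs_continuous_le_integral (f k : R -> R) (a b : R) :
  a <= b -> abs_continuous a b f -> measurable_fun `[a, b] k ->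
  (forall t, 0 <= k t) ->
  {ae mu, forall t, t \in `[a, b] -> exists2 l, is_derive t 1 f l & l <= k t} ->
  ((f b - f a)%:E <= \int[mu]_(t in `[a, b]) (k t)%:E)%E.
Proof.
move=> ab acf mk k0 ae1.
have [->|Ik] := eqVneq (\int[mu]_(t in `[a, b]) (k t)%:E)%E +oo%E.
  by rewrite leey.
have ik : mu.-integrable `[a, b] (EFin \o k).
  apply/integrableP; split; first exact/measurable_EFinP.
  rewrite (_ : (\int[mu]_(x in `[a, b]) `|(EFin \o k) x|)%E =
    (\int[mu]_(t in `[a, b]) (k t)%:E)%E) ?ltey//.
  by apply: eq_integral => t _ /=; rewrite ger0_norm.
pose k' : R -> R := k \_ `[a, b].
have k'0 t : 0 <= k' t by rewrite /k' patchE; case: ifP.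
have ik' : mu.-integrable setT (EFin \o k').
  by rewrite /k' -restrict_EFin -integrable_mkcond.
pose K x := (\int[mu]_(t in [set` `]-oo, x]%R]) (k' t))%R.
have ik'S (D : set R) : measurable D -> mu.-integrable D (EFin \o k').
  by move=> mD; apply: integrableS ik'.
have ae2 : {ae mu, forall x, derivable K x 1 /\ derive1 K x = k' x}.
  apply: FTC1Ny; first by move=> y; exact: ik'S.
  exact: integrable_locally_restrict.
have KB x y : x <= y -> K y - K x = (\int[mu]_(t in `]x, y]) k' t)%R.
  by move=> xy; rewrite /K Rintegral_itvB//; exact: ik'S.
have Kab : ((K b - K a)%:E = \int[mu]_(t in `[a, b]) (k t)%:E)%E.
  rewrite KB// Rintegral_itv_obnd_cbnd; last first.
    exact: ik'S.
  rewrite /Rintegral fineK; last first.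
    by apply: integrable_fin_num => //; exact: ik'S.
  apply: eq_integral => x xab; rewrite /k' patchE /=.
  by rewrite xab.
rewrite -Kab lee_fin; clearbody K.
pose P t := t \in `[a, b] -> exists2 l, is_derive t 1 f l & l <= k t.
pose Q t := derivable K t 1 /\ derive1 K t = k' t.
have N0 : mu.-negligible (~` P `|` ~` Q) by exact: (negligibleU ae1 ae2).
apply: (abs_continuous_le_nondecreasing ab acf N0).
- move=> x y _ _ xy; rewrite -subr_ge0 KB//; apply: Rintegral_ge0 => t _.
  exact: k'0.
- move=> t tab /not_orP[/contrapT/(_ tab)[l Hl lk] /contrapT[dK KE]].
  exists l, (k' t); split; first exact: Hl.
    by split; [exact: dK|rewrite -derive1E].
  by rewrite /k' patchE mem_set.
Qed.

End absolute_continuity.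

(** * One-variable derivatives, mean values and intermediate values *)

Notation isd f x l := (@is_derive _ _ _ x 1 f l).

Section real_derivatives.
Context (R : realType).
Implicit Types (f g : R -> R) (x a b : R).

Lemma isd_cst (c x : R) : isd (fun _ : R => c) x 0.
Proof. exact: is_derive_cst. Qed.

Lemma isd_id x : isd (fun y : R => y) x 1.
Proof. exact: is_derive_id. Qed.

Lemma isdD f g x a b : isd f x a -> isd g x b -> isd (fun y => f y + g y) x (a + b).
Proof. by move=> fa gb; exact: is_deriveD. Qed.

Lemma isdN f x a : isd f x a -> isd (fun y => - f y) x (- a).
Proof. by move=> fa; exact: is_deriveN. Qed.

Lemma isdB f g x a b : isd f x a -> isd g x b -> isd (fun y => f y - g y) x (a - b).
Proof. by move=> fa gb; exact: is_deriveB. Qed.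

Lemma isdM f g x a b : isd f x a -> isd g x b ->
  isd (fun y => f y * g y) x (a * g x + f x * b).
Proof.
move=> fa gb; have := is_deriveM fa gb; rewrite addrC.
by rewrite -[_ *: a]/(g x * a) -[_ *: b]/(f x * b) [g x * a]mulrC.
Qed.

Lemma isdZ f x a c : isd f x a -> isd (fun y => c * f y) x (c * a).
Proof.
by move=> fa; have := isdM (isd_cst c x) fa; rewrite mul0r add0r.
Qed.

Lemma isd_comp f g x a b : isd f (g x) a -> isd g x b ->
  isd (fun y => f (g y)) x (a * b).
Proof. by move=> fa gb; exact: is_derive1_comp. Qed.

Lemma isd_eq f x a b : isd f x a -> a = b -> isd f x b.
Proof. by move=> H <-. Qed.

Lemma isd_ext f g x a : isd f x a -> f =1 g -> isd g x a.
Proof. by move=> H /funext <-. Qed.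

Lemma isd_near f g x a : isd f x a -> (\forall y \near x, f y = g y) -> isd g x a.
Proof.
move=> /is_derive1_caratheodory[k [kE ck kx]] fg.
apply/is_derive1_caratheodory.
(* A slope function for g at x in Caratheodory's sense: that of f where f and g agree, hence near x,
   and the plain quotient elsewhere. *)
pose F z := if f z == g z then k z else (g z - g x) / (z - x).
have Fx : F x = k x by rewrite /F (nbhs_singleton fg) eqxx.
exists F; split; last by rewrite Fx.
- move=> z; rewrite /F -(nbhs_singleton fg); case: eqP => [<-//|fgz].
  have [zx|zx] := eqVneq z x; last by rewrite divfK // subr_eq0.
  by move: fgz; rewrite zx (nbhs_singleton fg).
- change (F @ x --> F x); rewrite Fx; apply: cvg_trans ck.
  apply: near_eq_cvg; near=> z; rewrite /F; suff -> : f z = g z by rewrite eqxx.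
  by near: z.
Unshelve. all: by end_near. Qed.

Lemma isd_continuous f x a : isd f x a -> {for x, continuous f}.
Proof.
by move=> [df _]; apply/differentiable_continuous/derivable1_diffP.
Qed.

Lemma isd_unique f x a b : isd f x a -> isd f x b -> a = b.
Proof. by move=> [_ <-] [_ <-]. Qed.

Lemma MVT_continuous f (df : R -> R) a b : a < b -> continuous f ->
  (forall x, a < x < b -> isd f x (df x)) ->
  exists2 c, a < c < b & f b - f a = df c * (b - a).
Proof.
move=> ab cf H.
have H' x : x \in `]a, b[ -> isd f x (df x) by rewrite in_itv/= => /H.
have [c] := MVT ab H' (continuous_subspaceT cf).
by rewrite in_itv/=; exists c.
Qed.

Lemma isd0_cst f a b : a <= b -> continuous f ->
  (forall x, a < x < b -> isd f x 0) -> f b = f a.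
Proof.
rewrite le_eqVlt => /predU1P[->//|ab] cf H.
have [c _] := MVT_continuous ab cf H.
by rewrite mul0r => /eqP; rewrite subr_eq0 => /eqP.
Qed.

Lemma MVT_global f (df : R -> R) a b : a <= b ->
  (forall x, isd f x (df x)) ->
  exists2 c, a <= c <= b & f b - f a = df c * (b - a).
Proof.
rewrite le_eqVlt => /predU1P[->|ab] H.
  by exists b; rewrite ?lexx// !subrr mulr0.
have cf : continuous f by move=> x; exact: isd_continuous (H x).
have [c /andP[ac cb] E] := MVT_continuous ab cf (fun x _ => H x).
by exists c; rewrite ?(ltW ac) ?ltW.
Qed.

Lemma MVT_between f (df : R -> R) a b : (forall x, isd f x (df x)) ->
  exists2 c, `|c - a| <= `|b - a| & f b - f a = df c * (b - a).
Proof.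
move=> H; have [ab|/ltW ba] := leP a b.
  have [c /andP[ac cb] E] := MVT_global ab H; exists c => //.
  by rewrite !ger0_norm ?lerB ?subr_ge0.
have [c /andP[bc ca] E] := MVT_global ba H; exists c.
  by rewrite !ler0_norm ?lerN2 ?lerB ?subr_le0.
by rewrite -opprB E; ring.
Qed.

Lemma isd_lt f (df : R -> R) a b : a < b -> continuous f ->
  (forall x, a < x < b -> isd f x (df x) /\ 0 < df x) -> f a < f b.
Proof.
move=> ab cf H; have [x /H[]//|c /H[_ c0] E] := @MVT_continuous f df _ _ ab cf.
by rewrite -subr_gt0 E mulr_gt0// subr_gt0.
Qed.

Lemma IVT_continuous f a b v : a <= b -> continuous f ->
  f a <= v <= f b -> exists2 c, a <= c <= b & f c = v.
Proof.
move=> ab cf /andP[h1 h2].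
have [|c] := @IVT R f a b v ab (continuous_subspaceT cf).
  by rewrite ge_min le_max h1 h2 orbT.
by rewrite in_itv/=; exists c.
Qed.

End real_derivatives.

(** * Signed powers *)

(** Up to the factor q, the derivative of |x|^q. Applied to both coordinates, it sends a point of
    the q-sphere to its dual vector on the p-sphere. Locked against unfolding by unification. *)
Definition spow (R : realType) : R -> R -> R :=
  locked (fun q x => `|x| `^ (q - 1) * Num.sg x).

Lemma spowE (R : realType) (q x : R) : spow q x = `|x| `^ (q - 1) * Num.sg x.
Proof. by rewrite /spow -lock. Qed.

Section power_functions.
Context (R : realType).
Implicit Types (x y : R).

Lemma powR_continuous (a x : R) : 0 < x -> {for x, continuous (fun y : R => y `^ a)}.
Proof. by move=> x0; exact: (isd_continuous (is_derive1_powR a x0)). Qed.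

Lemma abs_powR_small (a e : R) : 0 < a -> 0 < e -> exists2 d, 0 < d &
  forall x, `|x| < d -> `|x| `^ a < e.
Proof.
move=> a0 e0; exists (e `^ a^-1); first exact: powR_gt0.
move=> x xd; have := gt0_ltr_powR a0 (normr_ge0 x) (powR_ge0 e a^-1) xd.
by rewrite -powRrM mulVf ?gt_eqF// powRr1// ltW.
Qed.

Lemma abs_powR_continuous (a : R) : 0 < a -> continuous (fun x : R => `|x| `^ a).
Proof.
move=> a0 x; have [->|x0] := eqVneq x 0.
  rewrite /continuous_at normr0 powR0 ?gt_eqF//.
  apply/cvgrPdist_lt => e e0; have [d d0 H] := abs_powR_small a0 e0.
  near=> y; rewrite sub0r normrN ger0_norm ?powR_ge0//; apply: H.
  by near: y; apply: cvgr0_norm_lt => //; exact: cvg_id.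
apply: (@continuous_comp _ _ _ (fun x : R => `|x|) (fun y : R => y `^ a)).
  exact: norm_continuous.
by apply: powR_continuous; rewrite normr_gt0.
Unshelve. all: by end_near. Qed.


Lemma spow_pos (q x : R) : 0 < x -> spow q x = x `^ (q - 1).
Proof. by move=> x0; rewrite spowE gtr0_norm// gtr0_sg// mulr1. Qed.

Lemma spow0 (q : R) : spow q 0 = 0 :> R. Proof. by rewrite spowE sgr0 mulr0. Qed.

Lemma spowN (q x : R) : spow q (- x) = - spow q x.
Proof. by rewrite !spowE normrN sgrN mulrN. Qed.

Lemma spowM (q x y : R) : spow q (x * y) = spow q x * spow q y.
Proof. by rewrite !spowE normrM sgrM powRM// mulrACA. Qed.

Lemma norm_spow (q x : R) : x != 0 -> `|spow q x| = `|x| `^ (q - 1).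
Proof.
move=> x0; rewrite spowE normrM (ger0_norm (powR_ge0 _ _)) normr_sg x0.
by rewrite mulr1.
Qed.

Lemma spow_eq0 (q x : R) : (spow q x == 0) = (x == 0).
Proof.
have [->|x0] := eqVneq x 0; first by rewrite spow0 eqxx.
by rewrite -normr_eq0 norm_spow// powR_eq0 normr_eq0 (negbTE x0).
Qed.

Lemma spow_gt0 (q x : R) : (0 < spow q x) = (0 < x).
Proof.
have [x0|x0|->] := ltgtP x 0; last by rewrite spow0 ltxx.
- by rewrite -[x]opprK spowN oppr_gt0 spow_pos ?oppr_gt0// ltNge powR_ge0.
- by rewrite spow_pos// powR_gt0.
Qed.

Lemma mul_spow (q x : R) : 0 < q -> x * spow q x = `|x| `^ q.
Proof.
move=> q0; rewrite -(mulr_powRB1 (normr_ge0 x) q0) spowE.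
by rewrite [X in _ = X * _]normrEsg; ring.
Qed.

Lemma spow_lt (q x y : R) : 1 < q -> x < y -> spow q x < spow q y.
Proof.
move=> q1; have pos u v : 0 < u -> u < v -> spow q u < spow q v.
  move=> u0 uv; rewrite !spow_pos//; last exact: lt_trans uv.
  by apply: gt0_ltr_powR => //; rewrite ?subr_gt0// ?nnegrE ltW//; lra.
move=> xy; have [x0|x0] := ltP 0 x; first exact: pos.
have [y0|y0] := ltP 0 y.
  apply: (@le_lt_trans _ _ 0); last by rewrite spow_gt0.
  by rewrite leNgt spow_gt0 -leNgt.
move: y0; rewrite le_eqVlt => /predU1P[y0|y0]; first rewrite y0 in xy *.
  by rewrite spow0 -oppr_gt0 -spowN spow_gt0 oppr_gt0.
by rewrite -ltrN2 -!spowN; apply: pos; lra.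
Qed.

Lemma spow_continuous (q : R) : 1 < q -> continuous (spow q).
Proof.
move=> q1; have q10 : 0 < q - 1 by rewrite subr_gt0.
have pos x : 0 < x -> {for x, continuous (spow q)}.
  move=> x0; have c := @powR_continuous (q - 1) x x0.
  change (spow q @ x --> spow q x); rewrite (spow_pos q x0); apply: cvg_trans c.
  apply: near_eq_cvg; near=> y; rewrite spow_pos//; near: y.
  exact: lt_nbhsr.
move=> x; have [x0|x0|->] := ltgtP x 0; last 2 first.
- exact: pos.
- change (spow q @ (0 : R) --> spow q 0); rewrite spow0; apply/cvgrPdist_lt => e e0.
  have [d d0 H] := abs_powR_small q10 e0.
  near=> y; rewrite sub0r normrN; have [->|y0] := eqVneq y 0.
    by rewrite spow0 normr0.
  rewrite norm_spow//; apply: H; near: y; apply: cvgr0_norm_lt => //; exact: cvg_id.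
rewrite (_ : spow q = (fun z => - spow q (- z))); last first.
  by apply/funext => z; rewrite spowN opprK.
apply: (@continuousN _ _ _ (fun z => spow q (- z))).
apply: (@continuous_comp _ _ _ (fun z : R => - z) (spow q)).
  exact: opp_continuous.
by apply: pos; rewrite oppr_gt0.
Unshelve. all: by end_near. Qed.

Lemma isd_abs_powR (q x : R) : 1 < q -> isd (fun y : R => `|y| `^ q) x (q * spow q x).
Proof.
move=> q1; have q0 : 0 < q by lra.
have pos y : 0 < y -> isd (fun y : R => `|y| `^ q) y (q * spow q y).
  move=> y0; rewrite spow_pos//; apply: isd_near (is_derive1_powR q y0) _.
  near=> z; rewrite ger0_norm//; apply: ltW; near: z; exact: lt_nbhsr.
have [x0|x0|->] := ltgtP x 0; last 2 first.
- exact: pos.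
(* At 0 the slope function is [spow q] itself, since |z|^q = z * spow q z; it is continuous because
   q > 1. *)
- rewrite spow0 mulr0; apply/is_derive1_caratheodory; exists (spow q); split.
  + by move=> z; rewrite normr0 powR0 ?gt_eqF// !subr0 mulrC mul_spow.
  + exact: spow_continuous.
  + exact: spow0.
have nx : 0 < - x by rewrite oppr_gt0.
have := isd_comp (pos _ nx) (isdN (isd_id x)).
move=> /isd_eq /(_ (_ : _ = q * spow q x)) H.
apply: isd_ext (H _) _; first by rewrite spowN; ring.
by move=> z; rewrite normrN.
Unshelve. all: by end_near. Qed.

End power_functions.

(** * The unit arc of the q-norm and its area function *)

(** The upper half of the unit q-sphere as a graph; the maximum continues it by 0 outside [-1, 1],
    which makes it continuous and integrable on the whole line. *)
Definition qarc (R : realType) : R -> R -> R :=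
  locked (fun q x => (Num.max 0 (1 - `|x| `^ q)) `^ q^-1).

Lemma qarcE (R : realType) (q x : R) :
  qarc q x = (Num.max 0 (1 - `|x| `^ q)) `^ q^-1.
Proof. by rewrite /qarc -lock. Qed.

(** An antiderivative of [qarc]; only its differences carry meaning. *)
Definition qint (R : realType) : R -> R -> R := locked (fun q x =>
  (\int[@lebesgue_measure R]_(t in [set` `]-oo, x]%R]) (qarc q t))%R).

Lemma qintE (R : realType) (q x : R) : qint q x =
  (\int[@lebesgue_measure R]_(t in [set` `]-oo, x]%R]) (qarc q t))%R.
Proof. by rewrite /qint -lock. Qed.

(* [qprim q s] is twice the area of the sector of the q-ball between the
   positive x-axis and the ray through [(qarc q s, s)]. *)
Definition qprim (R : realType) : R -> R -> R := locked (fun q x =>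
  2 * (qint q x - qint q 0) - x * qarc q x).

Lemma qprimE (R : realType) (q x : R) :
  qprim q x = 2 * (qint q x - qint q 0) - x * qarc q x.
Proof. by rewrite /qprim -lock. Qed.

Section quarter_arc.
Context (R : realType) (q : R) (q1 : 1 < q).
Implicit Types (x y : R).

Let q0 : 0 < q. Proof. by rewrite (lt_trans _ q1). Qed.
Let qV0 : 0 < q^-1. Proof. by rewrite invr_gt0. Qed.

Lemma powR_le1 x a : 0 < a -> 0 <= x -> (x `^ a <= 1) = (x <= 1).
Proof.
move=> a0 x0; apply/idP/idP => [|x1]; last first.
  have := ge0_ler_powR (ltW a0) _ _ x1; rewrite powR1; apply => //; rewrite nnegrE//.
apply: contraTT; rewrite -!ltNge => x1.
by have := gt0_ltr_powR a0 _ x0 x1; rewrite powR1; apply; rewrite nnegrE.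
Qed.

Lemma powR_lt1 x a : 0 < a -> 0 <= x -> (x `^ a < 1) = (x < 1).
Proof.
move=> a0 x0; apply/idP/idP => [|x1].
  apply: contraTT; rewrite -!leNgt => x1.
  have := ge0_ler_powR (ltW a0) _ _ x1; rewrite powR1; apply => //; rewrite nnegrE//.
by have := gt0_ltr_powR a0 x0 _ x1; rewrite powR1; apply; rewrite nnegrE.
Qed.

Local Notation qarc := (qarc q).

Lemma qarc_ge0 x : 0 <= qarc x. Proof. by rewrite qarcE powR_ge0. Qed.

Lemma qarcN x : qarc (- x) = qarc x. Proof. by rewrite !qarcE normrN. Qed.

Lemma qarc_ge1 x : 1 <= `|x| -> qarc x = 0.
Proof.
move=> x1; rewrite qarcE max_l ?powR0 ?gt_eqF//.
by rewrite subr_le0 leNgt powR_lt1// -leNgt.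
Qed.

Lemma qarc_powR x : `|x| <= 1 -> qarc x `^ q = 1 - `|x| `^ q.
Proof.
move=> x1; have h : 0 <= 1 - `|x| `^ q by rewrite subr_ge0 powR_le1.
by rewrite qarcE max_r// -powRrM mulVf ?gt_eqF// powRr1.
Qed.

Lemma qarc_gt0 x : `|x| < 1 -> 0 < qarc x.
Proof.
by move=> x1; rewrite qarcE powR_gt0// lt_max subr_gt0 powR_lt1// x1 orbT.
Qed.

Lemma qarc_unique x y : 0 <= y -> `|x| `^ q + y `^ q = 1 -> y = qarc x.
Proof.
move=> y0 xy; have x1 : `|x| <= 1.
  by rewrite -(powR_le1 q0)// -xy lerDl powR_ge0.
apply: (powR_injective q0); rewrite ?nnegrE ?qarc_ge0//.
by rewrite qarc_powR//; lra.
Qed.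

Lemma qarc_le1 x : qarc x <= 1.
Proof.
have [x1|x1] := leP 1 `|x|; first by rewrite qarc_ge1.
rewrite -(powR_le1 q0) ?qarc_ge0// (qarc_powR (ltW x1)).
by have := powR_ge0 `|x| q; lra.
Qed.

Lemma qarc0 : qarc 0 = 1.
Proof.
apply/esym/qarc_unique => //.
by rewrite normr0 powR0 ?gt_eqF// powR1 add0r.
Qed.

Lemma qarc1 : qarc 1 = 0. Proof. by rewrite qarc_ge1// normr1. Qed.

Lemma qarcK x : 0 <= x <= 1 -> qarc (qarc x) = x.
Proof.
move=> /andP[x0 x1]; apply/esym/qarc_unique => //.
by rewrite ger0_norm ?qarc_ge0// qarc_powR ger0_norm// subrK.
Qed.

Lemma qarc_lt1 x : 0 < x -> qarc x < 1.
Proof.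
move=> x0; have [x1|x1] := leP 1 `|x|; first by rewrite qarc_ge1.
rewrite -(powR_lt1 q0) ?qarc_ge0// qarc_powR ?ltW//.
by rewrite gtrBl powR_gt0// normr_gt0 gt_eqF.
Qed.

Lemma qarc_le x y : 0 <= x -> x <= y -> qarc y <= qarc x.
Proof.
move=> x0 xy; have [y1|y1] := leP 1 `|y|; first by rewrite (qarc_ge1 y1) qarc_ge0.
have [ax ay] : `|x| = x /\ `|y| = y.
  by rewrite !ger0_norm//; exact: le_trans xy.
rewrite leNgt; apply/negP => h.
have h1 := gt0_ltr_powR q0 (qarc_ge0 x) (qarc_ge0 y) h.
have x1 : `|x| <= 1 by rewrite ax (le_trans xy)// -ay ltW.
have E1 := qarc_powR x1; have E2 := qarc_powR (ltW y1).
have : 1 - `|x| `^ q < 1 - `|y| `^ q by rewrite -E1 -E2.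
rewrite ltrD2l ltrN2 ax ay; apply/negP; rewrite -leNgt.
by apply: ge0_ler_powR; rewrite ?nnegrE ?(le_trans x0 xy)// ltW.
Qed.

Lemma qarc_continuous : continuous qarc.
Proof.
rewrite (_ : qarc = (fun x => `|Num.max 0 (1 - `|x| `^ q)| `^ q^-1)); last first.
  have h (y : R) : 0 <= Num.max 0 y by case: (leP 0 y).
  by apply/funext => x; rewrite qarcE (ger0_norm (h _)).
move=> x; apply: (@continuous_comp _ _ _ (fun x : R => Num.max 0 (1 - `|x| `^ q))
  (fun y : R => `|y| `^ q^-1)); last exact: abs_powR_continuous.
apply: continuous_max; first exact: cst_continuous.
by apply: continuousB; [exact: cst_continuous|exact: abs_powR_continuous].
Qed.

Lemma isd_qarc x : `|x| < 1 -> isd qarc x (- (spow q x * qarc x `^ (1 - q))).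
Proof.
move=> x1; have h : 0 < 1 - `|x| `^ q by rewrite subr_gt0 powR_lt1.
have H1 : isd (fun y : R => 1 - `|y| `^ q) x (0 - q * spow q x).
  by apply: (isdB (isd_cst 1 x)); exact: isd_abs_powR.
have H := @isd_comp _ (fun z : R => z `^ q^-1) (fun y => 1 - `|y| `^ q) x _ _ (is_derive1_powR q^-1 h) H1.
apply: (@isd_near _ (fun y => (1 - `|y| `^ q) `^ q^-1)).
  apply: isd_eq H _; rewrite -qarc_powR ?ltW// -powRrM.
  rewrite (_ : q * (q^-1 - 1) = 1 - q); last by rewrite mulrBr mulfV ?gt_eqF// mulr1.
  by rewrite sub0r; field; rewrite gt_eqF.
have d0 : 0 < 1 - `|x| by rewrite subr_gt0.
near=> y; rewrite qarcE max_r//; rewrite subr_ge0 powR_le1//; apply: ltW.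
suff : `| `|x| - `|y| | < 1 - `|x| by rewrite ltr_norml => /andP[]; lra.
by near: y; move/cvgrPdist_lt: (@norm_continuous _ R x) => /(_ _ d0).
Unshelve. all: by end_near. Qed.

Notation mu := (@lebesgue_measure R).

Lemma integrable_qarc : mu.-integrable setT (EFin \o qarc).
Proof.
have -> : qarc = qarc \_ `[(-1 : R), 1].
  apply/funext => x; rewrite patchE; case: ifPn => //.
  by rewrite notin_setE /= in_itv/= -ler_norml => /negP; rewrite -ltNge => /ltW/qarc_ge1.
rewrite -restrict_EFin -integrable_mkcond//.
apply: continuous_compact_integrable; first exact: segment_compact.
exact: continuous_subspaceT qarc_continuous.
Qed.

Local Notation qint := (qint q).

Lemma isd_qint x : isd qint x (qarc x).
Proof.
have ii y : mu.-integrable [set` `]-oo, y]%R] (EFin \o qarc).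
  by apply: integrableS integrable_qarc.
have [] := @continuous_FTC1 R qarc -oo%O x (x + 1) _ (ii _) _ (@qarc_continuous x).
- by rewrite ltrDl.
- by rewrite ltNyr.
move=> dF FE; rewrite (_ : qint = fun x => \int[mu]_(t in `]-oo, x]) qarc t)%R.
  by split; [exact: dF|rewrite -derive1E].
by apply/funext => y; rewrite qintE.
Qed.

Lemma qintB x y : x <= y -> qint y - qint x = (\int[mu]_(t in `[x, y]) qarc t)%R.
Proof.
move=> xy; have ii (D : set R) : measurable D -> mu.-integrable D (EFin \o qarc).
  by move=> mD; apply: integrableS integrable_qarc.
rewrite !qintE Rintegral_itvB//; last exact: ii.
by rewrite Rintegral_itv_obnd_cbnd//; exact: ii.
Qed.

Lemma qint_continuous : continuous qint.
Proof. by move=> x; exact: isd_continuous (isd_qint x). Qed.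

Lemma qintN x : qint (- x) - qint 0 = - (qint x - qint 0).
Proof.
suff : qint (- x) + qint x = qint (- 0) + qint 0 by rewrite oppr0; lra.
apply: (@is_derive_0_is_cst R (fun x => qint (- x) + qint x)) => y.
have H := isdD (isd_comp (isd_qint (- y)) (isdN (isd_id y))) (isd_qint y).
by apply: isd_eq H _; rewrite qarcN; ring.
Qed.

Local Notation qprim := (qprim q).

Lemma qprim0 : qprim 0 = 0. Proof. by rewrite !qprimE; ring. Qed.

Lemma qprimN x : qprim (- x) = - qprim x.
Proof. by rewrite !qprimE qintN qarcN; ring. Qed.

Lemma qprim_continuous : continuous qprim.
Proof.
rewrite (_ : qprim = fun x => 2 * (qint x - qint 0) - x * qarc x); last first.
  by apply/funext => y; rewrite qprimE.
move=> x; apply: (@continuousB _ _ _ (fun x => 2 * (qint x - qint 0)) (fun x => x * qarc x)).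
  apply: (@continuousM _ _ (fun=> 2) (fun x => qint x - qint 0)); first exact: cst_continuous.
  apply: (@continuousB _ _ _ qint (fun=> qint 0)); first exact: qint_continuous.
  exact: cst_continuous.
by apply: (@continuousM _ _ id qarc); [exact: cvg_id|exact: qarc_continuous].
Qed.

(** With y = [qarc q x], differentiation gives y - x y' = y^(1-q) (y^q + |x|^q), and the last factor
    is 1 on the sphere. *)
Lemma isd_qprim x : `|x| < 1 -> isd qprim x (qarc x `^ (1 - q)).
Proof.
move=> x1.
have H := isdB (isdZ 2 (isdB (isd_qint x) (isd_cst (qint 0) x)))
  (isdM (isd_id x) (isd_qarc x1)).
apply: isd_ext (_ : isd _ x _) (fun y => esym (qprimE q y)); apply: isd_eq H _.
have a0 := qarc_gt0 x1.
have E : qarc x = qarc x `^ q * qarc x `^ (1 - q).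
  rewrite -powRD; last by rewrite (gt_eqF a0) implybT.
  by rewrite addrC subrK powRr1// ltW.
have := mul_spow x q0; have := qarc_powR (ltW x1) => E1 E2.
rewrite [in X in 2 * (X - _)]E [in X in _ - (X + _)]E E1 -E2; ring.
Qed.

Lemma qprim_lt x y : -1 <= x -> x < y -> y <= 1 -> qprim x < qprim y.
Proof.
move=> x1 xy y1; apply: (@isd_lt _ _ (fun z => qarc z `^ (1 - q))) => //.
  exact: qprim_continuous.
move=> z /andP[xz zy]; have z1 : `|z| < 1 by rewrite ltr_norml; apply/andP; split; lra.
by split; [exact: isd_qprim|rewrite powR_gt0// qarc_gt0].
Qed.

(** Reflection in the diagonal: the sectors below and above the ray through [(qarc q x, x)] fill the
    quarter ball. In the proof, the derivative of the sum vanishes. *)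
Lemma qprim_qarc x : 0 <= x <= 1 -> qprim x + qprim (qarc x) = qprim 1.
Proof.
move=> /andP[x0 x1].
suff : qprim x + qprim (qarc x) = qprim 0 + qprim (qarc 0).
  by rewrite qarc0 qprim0 add0r.
apply: (@isd0_cst _ (fun x => qprim x + qprim (qarc x))) => //.
  move=> z; apply: continuousD; first exact: qprim_continuous.
  apply: (@continuous_comp _ _ _ qarc qprim); first exact: qarc_continuous.
  exact: qprim_continuous.
move=> z /andP[z0 zx]; have z1 : `|z| < 1 by rewrite gtr0_norm//; lra.
have a0 := qarc_gt0 z1.
have a1 : `|qarc z| < 1 by rewrite gtr0_norm// qarc_lt1.
have H := isdD (isd_qprim z1) (isd_comp (isd_qprim a1) (isd_qarc z1)).
apply: isd_eq H _; rewrite qarcK; last by apply/andP; split; lra.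
rewrite spow_pos// mulrN mulrA -powRD; last by rewrite (gt_eqF z0) implybT.
by rewrite (_ : 1 - q + (q - 1) = 0) ?powRr0; ring.
Qed.

End quarter_arc.

(** * Plane measure: quarter turns and undergraphs *)

Section plane_measure.
Context (R : realType).
Notation mu := (@lebesgue_measure R).
Local Notation RR := (measurableTypeR R).

(* The rotation by a right angle, clockwise, so that preimages under [qrot] turn
   counterclockwise. *)
Definition qrot (v : R * R) : R * R := (v.2, - v.1).

Lemma measurable_qrot : measurable_fun (setT : set (RR * RR)) (qrot : RR * RR -> RR * RR).
Proof.
apply/measurable_fun_pairP; split.
  exact: measurable_snd.
apply: (@measurableT_comp _ _ _ _ _ _ (fun x : R => - x) _ fst).
  exact: oppr_measurable.
exact: measurable_fst.
Qed.

(** Uniqueness of the product measure reduces the claim to rectangles, where a quarter turn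
    exchanges the sides and reflects one of them. *)
Lemma leb2_qrot (A : set (RR * RR)) : measurable A -> leb2 (qrot @^-1` A) = leb2 A.
Proof.
move=> mA.
pose m' : {measure set (RR * RR) -> \bar R} :=
  pushforward (mu \x mu)%E (qrot : RR * RR -> RR * RR).
suff H B C : measurable B -> measurable C ->
    m' measurable_qrot (B `*` C) = (mu B * mu C)%E.
  by have E := product_measure_unique H mA; symmetry; exact: E.
move=> mB mC; rewrite /m' /= /pushforward.
have -> : qrot @^-1` (B `*` C) = (-%R @^-1` C : set RR) `*` B.
  by apply/seteqP; split => [[x y] /= []|[x y] /= []].
have mC' : measurable (-%R @^-1` C : set RR).
  by rewrite -[X in measurable X]setTI; exact: oppr_measurable.
rewrite product_measure1E// muleC.
by rewrite  -[in RHS](lebesgue_measureN mC).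
Qed.

Lemma leb2_undergraph (D : set R) (f : R -> R) : measurable D ->
  continuous f -> (forall x, D x -> 0 <= f x) ->
  measurable ([set v | [/\ D v.1, 0 <= v.2 & v.2 <= f v.1]] : set (RR * RR)) /\
  leb2 [set v : R * R | [/\ D v.1, 0 <= v.2 & v.2 <= f v.1]] =
  (\int[mu]_(x in D) (f x)%:E)%E.
Proof.
move=> mD cf f0; set A : set (RR * RR) := [set v | _].
have mA : measurable A.
  have -> : A = (D `*` `[(0:R), +oo[%classic) `&`
      ((fun v : RR * RR => f v.1 - v.2) @^-1` `[(0:R), +oo[).
    apply/seteqP; split => [[x y] [/= h1 h2 h3]|[x y] [[/= h1] + +]].
      by rewrite /= !in_itv/= !andbT subr_ge0.
    by rewrite /= !in_itv/= !andbT subr_ge0.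
  apply: measurableI; first exact: measurableX.
  rewrite -[X in measurable X]setTI.
  suff : measurable_fun setT (fun v : RR * RR => f v.1 - v.2) by apply.
  apply: measurable_funB; last exact: measurable_snd.
  apply: (@measurableT_comp _ _ _ _ _ _ f _ fst); last exact: measurable_fst.
  exact: continuous_measurable_fun.
split => //; rewrite /leb2 /product_measure1 /= [RHS]integral_mkcond/=.
apply: eq_integral => x _; rewrite patchE.
case: ifPn => [/set_mem Dx|Dx].
  rewrite (_ : xsection A x = `[0, f x]%classic).
    rewrite lebesgue_measure_itv/= lte_fin; case: ltP => h.
      by rewrite -EFinD subr0.
    by congr (_%:E); have := f0 x Dx; lra.
  apply/seteqP; split => y; rewrite /xsection /= inE /= in_itv/=.
    by case=> _ -> ->.
  by move=> /andP[].
rewrite (_ : xsection A x = set0) ?measure0//.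
apply/seteqP; split => y //; rewrite /xsection /= inE => -[/= Dx'].
by move: Dx; rewrite notin_setE.
Qed.

Lemma polar_right (x y : R) : 0 < x -> exists rho psi,
  [/\ 0 < rho, - (pi / 2) < psi < pi / 2 & (x, y) = (rho * cos psi, rho * sin psi)].
Proof.
move=> x0; have c0 : 0 < cos (atan (y / x)).
  by apply: cos_gt0_pihalf; rewrite atan_gtNpi2 atan_ltpi2.
exists (x / cos (atan (y / x))), (atan (y / x)); split.
- exact: divr_gt0.
- by rewrite atan_gtNpi2 atan_ltpi2.
- have : sin (atan (y / x)) = y / x * cos (atan (y / x)).
    by rewrite -{2}(atanK (y / x)) /tan divfK// gt_eqF.
  by move=> ->; congr (_, _); field; rewrite !gt_eqF.
Qed.

Lemma sin_ge0_angle (t : R) : - pi < t < pi -> 0 <= sin t -> 0 <= t.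
Proof.
move=> /andP[t1 t2] s0; rewrite leNgt; apply/negP => t0.
have := @sin_gt0_pi _ (- t); rewrite sinN oppr_gt0 => h.
suff : sin t < 0 by rewrite ltNge s0.
suff : 0 < - sin t by lra.
by apply: h; apply/andP; split; lra.
Qed.

Lemma Rintegral_isd (f F : R -> R) (a b : R) : a <= b -> continuous f ->
  (forall x : R, isd F x (f x)) -> (\int[mu]_(x in `[a, b]) f x = F b - F a)%R.
Proof.
rewrite le_eqVlt => /predU1P[->|ab] cf dF.
  by rewrite set_itv1 Rintegral_set1 subrr.
have cF : continuous F by move=> x; exact: isd_continuous (dF x).
rewrite /Rintegral (@continuous_FTC2 _ f F)//.
- exact: continuous_subspaceT.
- split.
  + by move=> x _; have [] := dF x.
  + by apply: cvg_at_right_filter; exact: cF.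
  + by apply: cvg_at_left_filter; exact: cF.
- by move=> x _; have [_ <-] := dF x; rewrite derive1E.
Qed.

End plane_measure.

Arguments qrot {R} v.

(** * Areas of sectors in the first quadrant *)

Section quarter_sector.
Context (R : realType) (q : R) (q1 : 1 < q).
Notation mu := (@lebesgue_measure R).
Local Notation RR := (measurableTypeR R).
Let q0 : 0 < q. Proof. by rewrite (lt_trans _ q1). Qed.

Lemma lnorm_le1 (v : R * R) : (lnorm q v <= 1) = (`|v.1| `^ q + `|v.2| `^ q <= 1).
Proof. by rewrite /lnorm powR_le1 ?invr_gt0// addr_ge0 ?powR_ge0. Qed.

Lemma lnorm_eq1 (v : R * R) : lnorm q v = 1 <-> `|v.1| `^ q + `|v.2| `^ q = 1.
Proof.
rewrite /lnorm; split => [|->]; last by rewrite powR1.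
move=> /eqP; rewrite powR_eq1 invr_eq0 (gt_eqF q0) orbF.
by rewrite ltNge addr_ge0 ?powR_ge0//= orbF => /eqP.
Qed.

Lemma qball_upper (x y : R) : 0 <= y ->
  qball q (x, y) <-> `|x| <= 1 /\ y <= qarc q x.
Proof.
move=> y0; rewrite /qball /= lnorm_le1/= (ger0_norm y0); split => [h|[x1 h]].
  have x1 : `|x| <= 1.
    by rewrite -(powR_le1 q0)//; have := powR_ge0 y q; lra.
  split => //; rewrite leNgt; apply/negP => h1.
  have := gt0_ltr_powR q0 (qarc_ge0 _ x) y0 h1; rewrite qarc_powR//; lra.
have := ge0_ler_powR (ltW q0) y0 (qarc_ge0 q x) h; rewrite qarc_powR//; lra.
Qed.

Lemma qarc_RintegralE (a b : R) : a <= b ->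
  (\int[mu]_(x in `[a, b]) (qarc q x)%:E)%E = (qint q b - qint q a)%:E.
Proof.
move=> ab; rewrite qintB// /Rintegral fineK//.
apply: integrable_fin_num => //.
by apply: integrableS (integrable_qarc q1).
Qed.

(** Half-open: it contains its part of the x-axis but not of the y-axis, so that its four quarter
    turns and the origin partition the ball. *)
Definition qquarter : set (R * R) := [set v | [/\ qball q v, 0 < v.1 & 0 <= v.2]].

Lemma measurable_qquarter : measurable (qquarter : set (RR * RR)) /\
  leb2 qquarter = (qprim q 1 / 2)%:E.
Proof.
have -> : qquarter = [set v : R * R | [/\ `]0, 1]%classic v.1, 0 <= v.2 & v.2 <= qarc q v.1]].
  apply/seteqP; split => [[x y] [/= + x0 y0]|[x y] [/=]].
    move=> /(qball_upper _ y0)[]; rewrite gtr0_norm// => x1 yx.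
    by split => //; rewrite in_itv/= x0.
  rewrite in_itv/= => /andP[x0 x1] y0 yx; split => //.
  by apply/qball_upper => //; rewrite gtr0_norm.
have m01 : measurable (`]0, 1]%classic : set R) by [].
have [|mA ->] := leb2_undergraph m01 (qarc_continuous q1).
  by move=> x _; exact: qarc_ge0.
split => //; rewrite integral_itv_obnd_cbnd; last first.
  by apply: measurable_funTS; apply/measurable_EFinP; apply: continuous_measurable_fun; exact: qarc_continuous.
rewrite qarc_RintegralE ?ler01// qprimE qarc1//; congr (_%:E); by field.
Qed.

(** Within the first quadrant the order of two angles is the sign of sin (phi - psi), which trades
    polar coordinates for a linear inequality. *)
Lemma qsector_quarter (phi : R) : 0 <= phi < pi / 2 ->
  qsector q phi = [set v | [/\ qball q v, 0 <= v.1, 0 <= v.2 &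
                               v.2 * cos phi <= v.1 * sin phi]].
Proof.
move=> /andP[p0 p1]; have pi0 := @pi_gt0 R; apply/seteqP; split => [v|[x y]] /=.
  move=> [vb [rho [psi [r0 s0 sp vE]]]] /=; move: vb; rewrite vE => vb; split; rewrite /=.
  - by [].
  - by rewrite mulr_ge0// cos_ge0_pihalf//; apply/andP; split; lra.
  - by rewrite mulr_ge0// sin_ge0_pi//; apply/andP; split; lra.
  - rewrite -subr_ge0 -!mulrA -mulrBr mulr_ge0//.
    rewrite mulrC [sin psi * _]mulrC -sinB sin_ge0_pi//; apply/andP; split; lra.
move=> [vb x0 y0 h]; split => //.
have c0 : 0 < cos phi by rewrite cos_gt0_pihalf//; apply/andP; split; lra.
move: x0; rewrite le_eqVlt => /predU1P[x0|x0].
  exists 0, 0; split => //; rewrite !mul0r -x0; congr (_, _).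
  by apply/le_anti; rewrite y0 andbT; move: h; rewrite -x0 mul0r pmulr_lle0.
have [rho [psi [r0 /andP[s1 s2] [xE yE]]]] := polar_right y x0.
exists rho, psi; split; rewrite ?xE ?yE ?(ltW r0)//.
  apply: sin_ge0_angle; first by apply/andP; split; lra.
  by move: y0; rewrite yE pmulr_rge0.
rewrite -subr_ge0; apply: sin_ge0_angle; first by apply/andP; split; lra.
rewrite sinB subr_ge0 -(ler_pM2l r0).
by move: h; rewrite xE yE; rewrite -!mulrA [cos psi * sin phi]mulrC [cos phi * sin psi]mulrC.
Qed.

(* The graph of [min(k x, qarc x)] is the upper boundary of the sector; it has
   its corner at the point of the sphere of slope [k]. *)
Lemma leb2_qsector_quarter (c s phi rho : R) : 0 < c -> 0 <= s -> c = qarc q s ->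
  0 < rho -> c = rho * cos phi -> s = rho * sin phi -> 0 <= phi < pi / 2 ->
  measurable (qsector q phi : set (RR * RR)) /\ leb2 (qsector q phi) = (qprim q s / 2)%:E.
Proof.
move=> c0 s0 cs r0 cE sE pphi; pose k := s / c.
have s1 : s <= 1.
  rewrite leNgt; apply/negP => s1; move: c0; rewrite cs qarc_ge1 ?ltxx// ger0_norm// ltW//.
have scE : s = qarc q c by rewrite cs qarcK// s0.
have c1 : c <= 1 by rewrite cs qarc_le1.
have k0 : 0 <= k by rewrite divr_ge0// ltW.
pose f x := Num.min (k * x) (qarc q x).
have kc : k * c = s by rewrite /k divfK// gt_eqF.
have klin : continuous (fun x : R => k * x).
  by move=> x; exact: isd_continuous (isdZ k (isd_id x)).
have cf : continuous f.
  move=> x; apply: (@continuous_min _ _ (fun x => k * x) (qarc q)); first exact: klin.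
  exact: qarc_continuous.
have -> : qsector q phi =
    [set v : R * R | [/\ `[0, 1]%classic v.1, 0 <= v.2 & v.2 <= f v.1]].
  rewrite qsector_quarter//.
  have hE x y : (y * cos phi <= x * sin phi) = (y <= k * x).
    rewrite -(ler_pM2l r0) mulrCA [leRHS]mulrCA -cE -sE /k.
    by rewrite mulrAC ler_pdivlMr// [s * x]mulrC.
  apply/seteqP; split => [[x y] [/= + x0 y0]|[x y] [/=]].
    rewrite hE => /(qball_upper _ y0)[]; rewrite ger0_norm// => x1 yx yk.
    by split; rewrite ?in_itv/= ?x0 ?x1// /f le_min yk yx.
  rewrite in_itv/= => /andP[x0 x1] y0; rewrite /f le_min => /andP[yk yx].
  by split; rewrite ?hE//; apply/qball_upper => //; rewrite ger0_norm.
have m01 : measurable (`[0, 1]%classic : set R) by [].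
have [|mA ->] := leb2_undergraph m01 cf.
  by move=> x; rewrite /= in_itv/= => /andP[x0 _]; rewrite /f le_min qarc_ge0 mulr_ge0.
split => //.
have fi (a b : R) : mu.-integrable `[a, b] (EFin \o f).
  by apply: continuous_compact_integrable; [exact: segment_compact|exact: continuous_subspaceT].
rewrite -[LHS]fineK; last first.
  by apply: integrable_fin_num => //; exact: fi.
congr (_%:E).
have -> : fine (\int[mu]_(x in `[0%R, 1%R]) (f x)%:E) =
    (\int[mu]_(x in `[0%R, c]) f x + \int[mu]_(x in `[c, 1%R]) f x)%R.
  have := @Rintegral_itvB R f (BLeft 0) (BRight 1) c (fi 0 1).
  rewrite !bnd_simp ltW// c1 => /(_ isT isT).
  rewrite [X in _ = X -> _]Rintegral_itv_obnd_cbnd; first by rewrite /Rintegral; lra.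
  by apply: integrableS (fi c 1) => //; exact: subset_itv_oc_cc.
have -> : (\int[mu]_(x in `[0%R, c]) f x = \int[mu]_(x in `[0%R, c]) (k * x))%R.
  apply: eq_Rintegral => x; rewrite inE/= in_itv/= => /andP[x0 xc].
  rewrite /f min_l// (le_trans (_ : _ <= s))//; first by rewrite -kc ler_wpM2l.
  by rewrite scE; exact: qarc_le.
have -> : (\int[mu]_(x in `[c, 1%R]) f x = \int[mu]_(x in `[c, 1%R]) qarc q x)%R.
  apply: eq_Rintegral => x; rewrite inE/= in_itv/= => /andP[xc x1].
  rewrite /f min_r// (le_trans (_ : _ <= s))//; last by rewrite -kc ler_wpM2l.
  by rewrite scE; apply: qarc_le => //; exact: ltW.
rewrite -qintB//.
have dk (x : R) : isd (fun x => k / 2 * x ^+ 2) x (k * x).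
  have H := isdZ (k / 2) (isdM (isd_id x) (isd_id x)).
  apply: isd_ext (isd_eq H _) _; last by move=> y; rewrite expr2.
  by field.
have -> := Rintegral_isd (ltW c0) klin dk.
have := @qprim_qarc R q q1 s; rewrite s0 s1 -cs => /(_ isT).
rewrite [qprim q c]qprimE -scE [qprim q 1]qprimE qarc1// => E.
have : k / 2 * c ^+ 2 = s * c / 2 by rewrite -kc; ring.
lra.
Qed.

End quarter_sector.

(** * Quarter turns of sectors and the area of the ball *)

Section qpoint_spec.
Context (R : realType) (q : R) (q1 : 1 < q).
Local Notation RR := (measurableTypeR R).
Let q0 : 0 < q. Proof. by rewrite (lt_trans _ q1). Qed.

Lemma lnorm_qrot (v : R * R) : lnorm q (qrot v) = lnorm q v.
Proof. by rewrite /lnorm /= normrN addrC. Qed.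

Lemma qball_qrot (v : R * R) : qball q (qrot v) <-> qball q v.
Proof. by rewrite /qball /= lnorm_qrot. Qed.

Lemma qrot_polar (rho psi : R) :
  qrot (rho * cos (psi + pi / 2), rho * sin (psi + pi / 2)) = (rho * cos psi, rho * sin psi).
Proof. by rewrite /qrot /= cosDpihalf sinDpihalf mulrN opprK. Qed.

Lemma qrot4 (v : R * R) : qrot (qrot (qrot (qrot v))) = v.
Proof. by case: v => x y; rewrite /qrot /= !opprK. Qed.

Lemma measurable_preimage_qrot (A : set (RR * RR)) : measurable A ->
  measurable (qrot @^-1` A : set (RR * RR)).
Proof.
by move=> mA; rewrite -[X in measurable X]setTI; exact: measurable_qrot.
Qed.

Lemma qsectorS (phi : R) : 0 <= phi < 3 * pi / 2 ->
  qsector q (phi + pi / 2) = qquarter q `|` qrot @^-1` (qsector q phi).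
Proof.
move=> /andP[p0 p1]; have pi0 := @pi_gt0 R; apply/seteqP; split => v.
  move=> [vb [rho [psi [r0 s0 sp vE]]]].
  have [s1|s1] := ltP psi (pi / 2).
    move: r0; rewrite le_eqVlt => /predU1P[r0|r0]; last first.
      left; split => //; rewrite vE /= ?mulr_gt0 ?mulr_ge0 ?(ltW r0)//.
        by apply: cos_gt0_pihalf; apply/andP; split; lra.
      by apply: sin_ge0_pi; apply/andP; split; lra.
    (* The origin lies outside the half-open quarter and goes to the turned sector. *)
    right; split; first exact/qball_qrot.
    by exists 0, 0; split => //; rewrite vE -r0 /qrot /= !mul0r oppr0.
  right; split; first exact/qball_qrot.
  exists rho, (psi - pi / 2); split => //; [lra|lra|].
  by rewrite vE -(qrot_polar rho (psi - pi / 2)) subrK.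
case=> [[vb x0 y0]|[vb [rho [psi [r0 s0 sp vE]]]]].
  split => //; have [rho [psi [r0 /andP[s0 s1] E]]] := polar_right v.2 x0.
  exists rho, psi; split; rewrite ?(ltW r0)//; first last.
  - by rewrite -E; case: (v).
  - lra.
  - apply: sin_ge0_angle; first by apply/andP; split; lra.
    by move: y0; rewrite -[v.2]/((v.1, v.2).2) E /= pmulr_rge0.
split; first exact/qball_qrot.
exists rho, (psi + pi / 2); split => //; [lra|lra|].
by rewrite -[LHS]qrot4 vE -[in LHS]qrot_polar -[in RHS](qrot4 (_, _)).
Qed.

Lemma qquarter_disjoint (phi : R) : 0 <= phi < 3 * pi / 2 ->
  qquarter q `&` qrot @^-1` (qsector q phi) = set0.
Proof.
move=> /andP[p0 p1]; have pi0 := @pi_gt0 R; apply/seteqP; split => // v.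
move=> [[_ x0 y0] [_ [rho [psi [r0 s0 sp]]]]] [yE xE].
have rp : 0 < rho.
  by rewrite lt_neqAle r0 andbT; apply/eqP => r00; move: xE; rewrite -r00 mul0r; lra.
have c0 : 0 <= cos psi by rewrite -(pmulr_rge0 _ rp) -yE.
have s1 : sin psi < 0 by rewrite -(pmulr_rlt0 _ rp) -xE; lra.
have [h|h] := leP psi pi.
  by have := @sin_ge0_pi _ psi; rewrite s0 h => /(_ isT); lra.
have : 0 < cos (psi - pi).
  by apply: cos_gt0_pihalf; apply/andP; split; lra.
have : cos psi = - cos (psi - pi) by rewrite -{1}(subrK pi psi) cosDpi.
lra.
Qed.

Lemma leb2_qsectorS (phi t : R) : 0 <= phi < 3 * pi / 2 ->
  measurable (qsector q phi : set (RR * RR)) -> leb2 (qsector q phi) = t%:E ->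
  measurable (qsector q (phi + pi / 2) : set (RR * RR)) /\
  leb2 (qsector q (phi + pi / 2)) = (qprim q 1 / 2 + t)%:E.
Proof.
move=> pphi mS S; have [mQ Q] := measurable_qquarter q1.
have mS' := measurable_preimage_qrot mS.
rewrite qsectorS//; split; first exact: measurableU.
rewrite [LHS](measureU (@lebesgue_measure R \x @lebesgue_measure R)%E)//; last exact: qquarter_disjoint.
by rewrite EFinD -S -Q -(leb2_qrot mS).
Qed.

Lemma leb2_qball : leb2 (qball q) = (2 * qprim q 1)%:E.
Proof.
have [mQ Q] := measurable_qquarter q1.
pose r1 := @qrot R; pose Q1 := r1 @^-1` qquarter q.
pose Q2 := r1 @^-1` Q1; pose Q3 := r1 @^-1` Q2.
have mQ1 : measurable (Q1 : set (RR * RR)) by exact: measurable_preimage_qrot.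
have mQ2 : measurable (Q2 : set (RR * RR)) by exact: measurable_preimage_qrot.
have mQ3 : measurable (Q3 : set (RR * RR)) by exact: measurable_preimage_qrot.
have E1 : leb2 Q1 = (qprim q 1 / 2)%:E by rewrite leb2_qrot.
have E2 : leb2 Q2 = (qprim q 1 / 2)%:E by rewrite leb2_qrot.
have E3 : leb2 Q3 = (qprim q 1 / 2)%:E by rewrite leb2_qrot.
pose O := [set (0 : R)] `*` [set (0 : R)].
have mO : measurable (O : set (RR * RR)) by apply: measurableX.
have E0 : leb2 O = 0%E.
  by rewrite /leb2 product_measure1E//= lebesgue_measure_set1 mule0.
have -> : qball q = (qquarter q `|` Q1) `|` (Q2 `|` Q3) `|` O.
  apply/seteqP; split => v; last first.
    case=> [[[[]//|[/qball_qrot]//]|[[/qball_qrot/qball_qrot]//|[/qball_qrot/qball_qrot/qball_qrot]//]]|].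
    case: v => x y [/= -> ->]; rewrite /qball /= lnorm_le1//= normr0 powR0 ?gt_eqF//.
  move=> vb; have vb1 : qball q (r1 v) by apply/qball_qrot.
  have vb2 : qball q (r1 (r1 v)) by apply/qball_qrot.
  have vb3 : qball q (r1 (r1 (r1 v))) by apply/qball_qrot.
  have [x0|x0|x0] := ltgtP v.1 0.
  - have [y0|y0] := leP v.2 0; left.
      right; left; split; [exact: vb2|by rewrite /= oppr_gt0|by rewrite /= oppr_ge0].
    left; right; split; [exact: vb1|exact: y0|by rewrite /= oppr_ge0 ltW].
  - left; have [y0|y0] := ltP v.2 0.
      right; right; split; [exact: vb3|by rewrite /= oppr_gt0|by rewrite /= opprK ltW].
    by left; left; split; [exact: vb|exact: x0|exact: y0].
  - have [y0|y0|y0] := ltgtP v.2 0.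
    + left; right; right; split; [exact: vb3|by rewrite /= oppr_gt0|by rewrite /= opprK x0].
    + left; left; right; split; [exact: vb1|exact: y0|by rewrite /= x0 oppr0].
    + by right; split.
have mU (A B : set (RR * RR)) : measurable A -> measurable B -> A `&` B = set0 ->
    leb2 (A `|` B) = (leb2 A + leb2 B)%E.
  by move=> mA mB AB; exact: (measureU (@lebesgue_measure R \x @lebesgue_measure R)%E).
rewrite mU; first last.
- apply/seteqP; split => // v [] + [/= vx vy].
  by case=> [] [] [_ /= h1 h2]; clear mU E0 E1 E2 E3 Q; lra.
- by [].
- by apply: measurableU; exact: measurableU.
rewrite mU; first last.
- apply/seteqP; split => // v [].
  by case=> [] [_] /= h1 h2 [] [_] /=; clear mU E0 E1 E2 E3 Q; lra.
- exact: measurableU.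
- exact: measurableU.
rewrite E0 adde0 mU//; last first.
  by apply/seteqP; split => // v [] [_] /= h1 h2 [_] /=; clear mU E0 E1 E2 E3 Q; lra.
rewrite mU//; last first.
  by apply/seteqP; split => // v [] [_] /= h1 h2 [_] /=; clear mU E0 E1 E2 E3 Q; lra.
have Q' : leb2 (qquarter q) = (qprim q 1 / 2)%:E := Q.
by rewrite Q' E1 E2 E3 -!EFinD; congr (_%:E); field.
Qed.

(** [qprim q 1] is twice the area of a quarter ball, that is, the angle of a quarter turn. It is
    written H below: 2 H is pi_q and 4 H is the period 2 pi_q. *)
Lemma qpiE : qpi q = 2 * qprim q 1.
Proof. by rewrite /qpi leb2_qball. Qed.

End qpoint_spec.

(** * The q-trigonometric functions and their derivatives *)

Section qpoint.
Context (R : realType) (q : R) (q1 : 1 < q).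
Local Notation H := (qprim q 1).

Lemma qprim1_gt0 : 0 < H.
Proof. by rewrite -(qprim0 q); apply: qprim_lt => //; lra. Qed.

(** Turns points counterclockwise; its inverse [qrot] turns sets in the same sense, by preimage. *)
Definition qrotc (v : R * R) : R * R := (- v.2, v.1).

Lemma qrotK : cancel (@qrot R) qrotc.
Proof. by case=> x y; rewrite /qrot /qrotc /= opprK. Qed.

Lemma qrotc_polar (rho psi : R) :
  qrotc (rho * cos psi, rho * sin psi) =
  (rho * cos (psi + pi / 2), rho * sin (psi + pi / 2)).
Proof. by rewrite -qrot_polar qrotK. Qed.

Lemma iter_qrotc_polar k (rho psi : R) :
  iter k qrotc (rho * cos psi, rho * sin psi) =
  (rho * cos (psi + k%:R * (pi / 2)), rho * sin (psi + k%:R * (pi / 2))).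
Proof.
elim: k => [|k IH]; first by rewrite mul0r addr0.
have E : psi + k.+1%:R * (pi / 2) = psi + k%:R * (pi / 2) + pi / 2.
  by rewrite -natr1; ring.
by rewrite iterS IH qrotc_polar E.
Qed.

Lemma lnorm_qrotc v : lnorm q (qrotc v) = lnorm q v.
Proof. by case: v => x y; rewrite /lnorm /= normrN addrC. Qed.

Lemma lnorm_iter_qrotc k v : lnorm q (iter k qrotc v) = lnorm q v.
Proof.
elim: k => [|k IH]; first by [].
by rewrite iterS; exact: etrans (lnorm_qrotc _) IH.
Qed.

Lemma lnorm_qarc s : `|s| <= 1 -> lnorm q (qarc q s, s) = 1.
Proof.
by move=> s1; apply/(lnorm_eq1 q1) => /=; rewrite ger0_norm ?qarc_ge0// qarc_powR// subrK.
Qed.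

Lemma qprim_ge0 s : 0 <= s < 1 -> 0 <= qprim q s < H.
Proof.
move=> /andP[s0 s1]; apply/andP; split; last by apply: qprim_lt => //; lra.
move: s0; rewrite le_eqVlt => /predU1P[<-|s0]; first by rewrite qprim0.
by rewrite -(qprim0 q); apply/ltW/qprim_lt => //; lra.
Qed.

Lemma leb2_qsector_polar k (s rho psi : R) : 0 <= s < 1 -> 0 < rho ->
  0 <= psi < pi / 2 -> (qarc q s, s) = (rho * cos psi, rho * sin psi) -> (k < 4)%N ->
  measurable (qsector q (psi + k%:R * (pi / 2)) :
    set (measurableTypeR R * measurableTypeR R)) /\
  leb2 (qsector q (psi + k%:R * (pi / 2))) = ((k%:R * H + qprim q s) / 2)%:E.
Proof.
move=> /andP[s0 s1] r0 psi1 [cE sE].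
have c0 : 0 < qarc q s by rewrite qarc_gt0// ger0_norm.
have pi0 := @pi_gt0 R.
elim: k => [_|k IH k4].
  by rewrite !mul0r addr0 add0r; exact: leb2_qsector_quarter c0 s0 erefl r0 cE sE psi1.
have [mk lk] := IH (ltnW k4).
have h : 0 <= psi + k%:R * (pi / 2) < 3 * pi / 2.
  have k3 : k%:R <= 2 :> R by rewrite ler_nat -ltnS -ltnS.
  have k0 : 0 <= k%:R :> R by [].
  case/andP: psi1 => p0 p1; apply/andP; split; first by rewrite addr_ge0// mulr_ge0//; lra.
  have : k%:R * (pi / 2) <= 2 * (pi / 2) :> R by rewrite ler_wpM2r//; lra.
  lra.
have [mS lS] := leb2_qsectorS q1 h mk lk.
rewrite -natr1 [X in qsector q (psi + X)]mulrDl mul1r addrA; split => //.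
by rewrite lS; congr (_%:E); field.
Qed.

(** Areas are left behind here: every point of the sphere is a quarter turn, repeated at most three
    times, of a point with positive abscissa and ordinate in [0, 1[, and each quarter turn adds H to
    the angle. *)
Lemma is_qpointP theta P : is_qpoint q theta P <->
  exists k s, [/\ (k < 4)%N, 0 <= s < 1, theta = k%:R * H + qprim q s &
                  P = iter k qrotc (qarc q s, s)].
Proof.
have pi0 := @pi_gt0 R; split.
  move=> [P1 [rho [phi [r0 p0 p1 PE lE]]]].
  have [k [psi [k4 psi1 phiE]]] : exists k psi,
      [/\ (k < 4)%N, 0 <= psi < pi / 2 & phi = psi + k%:R * (pi / 2)].
    have [h1|h1] := ltP phi (pi / 2).
      by exists 0%N, phi; split; rewrite ?p0// mul0r addr0.
    have [h2|h2] := ltP phi pi.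
      by exists 1%N, (phi - pi / 2); split => //; [apply/andP; split; lra|lra].
    have [h3|h3] := ltP phi (3 * pi / 2).
      by exists 2%N, (phi - pi); split => //; [apply/andP; split; lra|lra].
    by exists 3%N, (phi - 3 * pi / 2); split => //; [apply/andP; split; lra|lra].
  pose c := rho * cos psi; pose s := rho * sin psi.
  have PcE : P = iter k qrotc (c, s) by rewrite PE phiE iter_qrotc_polar.
  have c0 : 0 < c.
    by rewrite mulr_gt0// cos_gt0_pihalf//; apply/andP; split; lra.
  have s0 : 0 <= s.
    by rewrite mulr_ge0 ?(ltW r0)// sin_ge0_pi//; apply/andP; split; lra.
  have cs1 : `|c| `^ q + `|s| `^ q = 1.
    by apply/(lnorm_eq1 q1 (c, s)); rewrite -P1 PcE lnorm_iter_qrotc.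
  have cE : c = qarc q s.
    by apply: qarc_unique => //; [exact: ltW|rewrite addrC -[c in c `^ q]gtr0_norm].
  have s1 : s < 1.
    rewrite ltNge; apply/negP => s1; move: c0.
    by rewrite cE qarc_ge1 ?ltxx// ger0_norm.
  have s01 : 0 <= s < 1 by rewrite s0.
  have E : (qarc q s, s) = (rho * cos psi, rho * sin psi) by rewrite -cE.
  have [_] := leb2_qsector_polar s01 r0 psi1 E k4.
  rewrite -phiE lE => -[F]; exists k, s; split => //; first by lra.
  by rewrite PcE cE.
move=> [k [s [k4 s01 -> ->]]]; case/andP: (s01) => s0 s1.
have c0 : 0 < qarc q s by rewrite qarc_gt0// ger0_norm.
split; first by rewrite lnorm_iter_qrotc lnorm_qarc// ger0_norm// ltW.
have [rho [psi [r0 /andP[p1 p2] E]]] := polar_right s c0.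
have p0 : 0 <= psi.
  apply: sin_ge0_angle; first by apply/andP; split; lra.
  by case: E => _ sE; move: s0; rewrite sE pmulr_rge0.
have k3 : k%:R <= 3 :> R by rewrite ler_nat -ltnS.
have k0 : 0 <= k%:R :> R by [].
exists rho, (psi + k%:R * (pi / 2)); split => //.
- by rewrite addr_ge0// mulr_ge0//; lra.
- have : k%:R * (pi / 2) <= 3 * (pi / 2) :> R by rewrite ler_wpM2r//; lra.
  lra.
- by rewrite E iter_qrotc_polar.
- have p02 : 0 <= psi < pi / 2 by rewrite p0.
  by have [] := leb2_qsector_polar s01 r0 p02 E k4.
Qed.

Lemma qprim_nat_inj k k' s s' : 0 <= s < 1 -> 0 <= s' < 1 ->
  k%:R * H + qprim q s = k'%:R * H + qprim q s' -> k = k' /\ s = s'.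
Proof.
move=> s1 s1' E; have H0 := qprim1_gt0.
have /andP[a0 a1] := qprim_ge0 s1; have /andP[b0 b1] := qprim_ge0 s1'.
have le m n t t' : 0 <= t < H -> 0 <= t' < H ->
    m%:R * H + t = n%:R * H + t' -> (m <= n)%N.
  move=> /andP[t0 t1] /andP[t0' t1'] F; rewrite leqNgt; apply/negP => nm.
  have : n.+1%:R * H <= m%:R * H by apply: ler_wpM2r; [exact: ltW|rewrite ler_nat].
  rewrite -natr1 mulrDl mul1r; lra.
have kk : k = k'.
  apply/eqP; rewrite eqn_leq; apply/andP; split.
    by apply: (le _ _ _ _ _ _ E); apply/andP.
  by apply: (le _ _ _ _ _ _ (esym E)); apply/andP.
split => //; move: E; rewrite kk => /addrI E.
case/andP: s1 => s0 s1; case/andP: s1' => s0' s1'.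
have [h|h|//] := ltgtP s s'.
- have := @qprim_lt _ q q1 s s'; rewrite E ltxx => F.
  by suff : false by []; apply: F; lra.
- have := @qprim_lt _ q q1 s' s; rewrite E ltxx => F.
  by suff : false by []; apply: F; lra.
Qed.

Lemma qprim_surj t : 0 <= t < H -> exists2 s, 0 <= s < 1 & qprim q s = t.
Proof.
move=> /andP[t0 t1].
have [|s /andP[s0 s1] sE] := @IVT_continuous _ (qprim q) 0 1 t ler01 (qprim_continuous q1).
  by rewrite qprim0 t0 ltW.
exists s => //; rewrite s0/= lt_neqAle s1 andbT; apply/eqP => s1E.
by move: t1; rewrite -sE s1E ltxx.
Qed.

Lemma nat_decomposition theta : 0 <= theta < 4 * H -> exists k t,
  [/\ (k < 4)%N, 0 <= t < H & theta = k%:R * H + t].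
Proof.
move=> /andP[h0 h4]; have H0 := qprim1_gt0.
have [h1|h1] := ltP theta H.
  by exists 0%N, theta; split => //; [rewrite h0|lra].
have [h2|h2] := ltP theta (2 * H).
  by exists 1%N, (theta - H); split => //; [apply/andP; split; lra|lra].
have [h3|h3] := ltP theta (3 * H).
  by exists 2%N, (theta - 2 * H); split => //; [apply/andP; split; lra|lra].
by exists 3%N, (theta - 3 * H); split => //; [apply/andP; split; lra|lra].
Qed.

Lemma qmodE theta (n : int) : 0 <= theta < 4 * H ->
  qmod q (theta + n%:~R * (4 * H)) = theta.
Proof.
move=> /andP[t0 t4]; have H0 := qprim1_gt0.
rewrite /qmod qpiE// (_ : 2 * (2 * H) = 4 * H); last by ring.
have -> : Num.floor ((theta + n%:~R * (4 * H)) / (4 * H)) = n.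
  apply: Num.Theory.floor_def; apply/andP; split.
    by rewrite ler_pdivlMr ?mulr_gt0//; lra.
  by rewrite ltr_pdivrMr ?mulr_gt0// intrD mulrDl; lra.
lra.
Qed.

Lemma qmod_decomposition t : exists theta (n : int),
  0 <= theta < 4 * H /\ t = theta + n%:~R * (4 * H).
Proof.
have H0 := qprim1_gt0; pose n := Num.floor (t / (4 * H)).
exists (t - n%:~R * (4 * H)), n; split; last by ring.
have h1 := Num.Theory.floor_le (t / (4 * H)); have h2 := Num.Theory.floorD1_gt (t / (4 * H)).
move: h1 h2; rewrite -/n ler_pdivlMr ?mulr_gt0// ltr_pdivrMr ?mulr_gt0//.
by rewrite intrD mulrDl => h1 h2; apply/andP; split; lra.
Qed.

Lemma qpointE (k : nat) (s : R) (n : int) : (k < 4)%N -> 0 <= s < 1 ->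
  qpoint q (k%:R * H + qprim q s + n%:~R * (4 * H)) = iter k qrotc (qarc q s, s).
Proof.
move=> k4 s1; have H0 := qprim1_gt0; have /andP[a0 a1] := qprim_ge0 s1.
have k3 : k%:R <= 3 :> R by rewrite ler_nat -ltnS.
rewrite /qpoint qmodE; last first.
  apply/andP; split; first by rewrite addr_ge0// mulr_ge0// ltW.
  have : k%:R * H <= 3 * H by rewrite ler_wpM2r// ltW.
  lra.
have ex : is_qpoint q (k%:R * H + qprim q s) (iter k qrotc (qarc q s, s)).
  by apply/is_qpointP; exists k, s.
have : is_qpoint q (k%:R * H + qprim q s)
    (get [set P | is_qpoint q (k%:R * H + qprim q s) P]).
  exact: (@getI _ [set P | is_qpoint q (k%:R * H + qprim q s) P] _ ex).
move=> /is_qpointP[k' [s' [k4' s1' E ->]]].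
by have [-> ->] := qprim_nat_inj s1 s1' E.
Qed.

Lemma qpoint_decomposition t : exists (k : nat) s (n : int),
  [/\ (k < 4)%N, 0 <= s < 1, t = k%:R * H + qprim q s + n%:~R * (4 * H) &
      qpoint q t = iter k qrotc (qarc q s, s)].
Proof.
have [theta [n [/nat_decomposition[k [u [k4 /qprim_surj[s s1 sE] ->]]] ->]]] :=
  qmod_decomposition t.
by exists k, s, n; split; rewrite ?sE// -sE qpointE.
Qed.

Lemma qpointD t : qpoint q (t + H) = qrotc (qpoint q t).
Proof.
have [k [s [n [k4 s1 -> ->]]]] := qpoint_decomposition t.
have [k3|k3] := ltnP k 3.
  rewrite -iterS -(@qpointE k.+1 s n)//; congr (qpoint q _).
  by rewrite -natr1; ring.
(* The fourth quarter turn brings the index back to 0 and adds one period. *)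
have -> : k = 3%N by apply/eqP; rewrite eqn_leq k3 -ltnS k4.
rewrite /= /qrotc /= !opprK -[RHS](@qpointE 0 s (n + 1))//; congr (qpoint q _).
by rewrite intrD; ring.
Qed.

Lemma qcosD t : qcos q (t + H) = - qsin q t.
Proof. by rewrite /qcos qpointD. Qed.

Lemma qsinD t : qsin q (t + H) = qcos q t.
Proof. by rewrite /qsin qpointD. Qed.

(** The right half of the sphere as an open chart. It joins two quarters at the angle 0, so that
    derivatives can be taken there as well, and on it the sine inverts [qprim]. *)
Lemma qpoint_chart t : `|t| < H -> exists s,
  [/\ `|s| < 1, qprim q s = t, qsin q t = s & qcos q t = qarc q s].
Proof.
have pos u : 0 <= u < H -> exists s,
    [/\ 0 <= s < 1, qprim q s = u, qsin q u = s & qcos q u = qarc q s].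
  move=> /qprim_surj[s s1 sE]; exists s.
  have := @qpointE 0 s 0 isT s1; rewrite mul0r add0r mul0r addr0 sE => E.
  by split; rewrite // /qsin /qcos E.
rewrite ltr_norml => /andP[t1 t2]; have [t0|t0] := leP 0 t.
  have [|s [/andP[s0 s1] sE sS sC]] := pos t; first by rewrite t0.
  by exists s; split => //; rewrite ger0_norm.
have [|s [/andP[s0 s1] sE sS sC]] := pos (t + H); first by apply/andP; split; lra.
have s0' : 0 < s.
  rewrite lt_neqAle s0 andbT; apply/eqP => s00.
  by move: sE; rewrite -s00 qprim0; lra.
exists (- qarc q s); split.
- by rewrite normrN ger0_norm ?qarc_ge0// qarc_lt1.
- have := @qprim_qarc _ q q1 s; rewrite s0 ltW// => /(_ isT).
  rewrite qprimN//; lra.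
- by rewrite -sC qcosD opprK.
- by rewrite qarcN// qarcK ?s0 ?ltW// -sS qsinD.
Qed.

Lemma qsin_qprim s : `|s| < 1 -> qsin q (qprim q s) = s.
Proof.
move=> s1; have := s1; rewrite ltr_norml => /andP[h1 h2].
have [|s' [s1' E -> _]] := @qpoint_chart (qprim q s).
  rewrite ltr_norml -qprimN//; apply/andP; split; apply: qprim_lt => //; lra.
move: s1'; rewrite ltr_norml => /andP[h1' h2'].
have [h|h|//] := ltgtP s' s.
- by have := @qprim_lt _ q q1 s' s; rewrite E ltxx => F; suff : false by []; apply: F; lra.
- by have := @qprim_lt _ q q1 s s'; rewrite E ltxx => F; suff : false by []; apply: F; lra.
Qed.

(** On the chart the sine is the inverse function of [qprim], and the cosine is [qarc] of the sine.
    Quarter turns carry the formulas to all nonnegative angles, the period 4 H to the negative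
    ones. *)
Lemma isd_qtrig (t : R) : isd (qsin q) t (spow q (qcos q t)) /\
  isd (qcos q) t (- spow q (qsin q t)).
Proof.
have H0 := qprim1_gt0.
have chart (u : R) : `|u| < H -> isd (qsin q) u (spow q (qcos q u)) /\
    isd (qcos q) u (- spow q (qsin q u)).
  move=> u1; have [s [s1 sE sS sC]] := qpoint_chart u1.
  have c0 : 0 < qarc q s by rewrite qarc_gt0.
  have near1 (v : R) : `|v| < 1 -> \forall y \near v, `|y| < 1.
    move=> v1; have d0 : 0 < 1 - `|v| by rewrite subr_gt0.
    near=> y; suff : `| `|v| - `|y| | < 1 - `|v| by rewrite ltr_norml => /andP[]; lra.
    by near: y; move/cvgrPdist_lt: (@norm_continuous _ R v) => /(_ _ d0).
  have nearH : \forall y \near u, `|y| < H.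
    have d0 : 0 < H - `|u| by rewrite subr_gt0.
    near=> y; suff : `| `|u| - `|y| | < H - `|u| by rewrite ltr_norml => /andP[]; lra.
    by near: y; move/cvgrPdist_lt: (@norm_continuous _ R u) => /(_ _ d0).
  have dS : isd (qsin q) u (spow q (qcos q u)).
    rewrite sC spow_pos// -sE.
    have -> : qarc q s `^ (q - 1) = (qarc q s `^ (1 - q))^-1.
      by rewrite -powRN opprB.
    apply: (@is_derive_inverse _ (qprim q) (qsin q) _ s).
    - by near=> v; apply: qsin_qprim; near: v; exact: near1.
    - by near=> v; exact: qprim_continuous.
    - exact: isd_qprim.
    - by rewrite gt_eqF// powR_gt0.
  split => //.
  apply: (@isd_near _ (fun v => qarc q (qsin q v))).
    have S1 : `|qsin q u| < 1 by rewrite sS.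
    apply: isd_eq (isd_comp (isd_qarc q1 S1) dS) _.
    rewrite sS sC (spow_pos _ c0) mulNr -mulrA -powRD; last by rewrite (gt_eqF c0) implybT.
    by rewrite (_ : 1 - q + (q - 1) = 0) ?powRr0 ?mulr1//; ring.
  near=> v; have [|w [_ _ -> ->//]] := @qpoint_chart v.
  by near: v.
have step (u : R) : isd (qsin q) u (spow q (qcos q u)) /\
    isd (qcos q) u (- spow q (qsin q u)) ->
    isd (qsin q) (u + H) (spow q (qcos q (u + H))) /\
    isd (qcos q) (u + H) (- spow q (qsin q (u + H))).
  move=> [dS dC]; have sh : isd (fun v : R => v - H) (u + H) 1.
    by apply: isd_eq (isdB (isd_id (u + H)) (isd_cst H (u + H))) _; rewrite subr0.
  have dS' : isd (qsin q) (u + H - H) (spow q (qcos q u)) by rewrite addrK.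
  have dC' : isd (qcos q) (u + H - H) (- spow q (qsin q u)) by rewrite addrK.
  rewrite qcosD qsinD; split.
    apply: isd_ext (isd_eq (@isd_comp _ (qcos q) (fun v => v - H) _ _ _ dC' sh) _) _.
      by rewrite mulr1 spowN.
    by move=> v; rewrite -qsinD subrK.
  apply: isd_ext (isd_eq (isdN (@isd_comp _ (qsin q) (fun v => v - H) _ _ _ dS' sh)) _) _.
    by rewrite mulr1.
  by move=> v; rewrite -qcosD subrK.
have stepn n (u : R) : isd (qsin q) u (spow q (qcos q u)) /\
    isd (qcos q) u (- spow q (qsin q u)) ->
    isd (qsin q) (u + n%:R * H) (spow q (qcos q (u + n%:R * H))) /\
    isd (qcos q) (u + n%:R * H) (- spow q (qsin q (u + n%:R * H))).
  elim: n => [|n IH] Hu; first by rewrite mul0r addr0.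
  by rewrite -natr1 mulrDl mul1r addrA; exact/step/IH.
have per4 (u : R) : isd (qsin q) (u + 4 * H) (spow q (qcos q (u + 4 * H))) /\
    isd (qcos q) (u + 4 * H) (- spow q (qsin q (u + 4 * H))) ->
    isd (qsin q) u (spow q (qcos q u)) /\ isd (qcos q) u (- spow q (qsin q u)).
  have p4 v : qsin q (v + 4 * H) = qsin q v /\ qcos q (v + 4 * H) = qcos q v.
    have -> : v + 4 * H = v + H + H + H + H by ring.
    by rewrite !(qsinD, qcosD) !opprK.
  have [-> ->] := p4 u; move=> [dS dC].
  have sh : isd (fun v : R => v + 4 * H) u 1.
    by apply: isd_eq (isdD (isd_id u) (isd_cst (4 * H) u)) _; rewrite addr0.
  split.
    apply: isd_ext (isd_eq (@isd_comp _ (qsin q) (fun v => v + 4 * H) _ _ _ dS sh) _) _; first by rewrite mulr1.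
    by move=> v /=; have [] := p4 v.
  apply: isd_ext (isd_eq (@isd_comp _ (qcos q) (fun v => v + 4 * H) _ _ _ dC sh) _) _; first by rewrite mulr1.
  by move=> v /=; have [] := p4 v.
have all_nonneg (u : R) : 0 <= u -> isd (qsin q) u (spow q (qcos q u)) /\
    isd (qcos q) u (- spow q (qsin q u)).
  move=> u0; have [k [s [n [k4 s1 uE _]]]] := qpoint_decomposition u.
  have /andP[a0 a1] := qprim_ge0 s1.
  have cs : isd (qsin q) (qprim q s) (spow q (qcos q (qprim q s))) /\
    isd (qcos q) (qprim q s) (- spow q (qsin q (qprim q s))).
    by apply: chart; rewrite ger0_norm.
  case: n uE => n uE.
    have := stepn (k + 4 * n)%N _ cs.
    by rewrite (_ : qprim q s + (k + 4 * n)%N%:R * H = u)// uE natrD natrM; ring.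
  exfalso; move: u0; rewrite uE NegzE mulrNz mulNr.
  have k3 : k%:R <= 3 :> R by rewrite ler_nat -ltnS.
  have : k%:R * H <= 3 * H by rewrite ler_wpM2r// ltW.
  have : 1 * (4 * H) <= n.+1%:R * (4 * H).
    by apply: ler_wpM2r; [rewrite mulr_ge0// ltW|rewrite ler1n].
  rewrite -[n.+1%:~R]/(n.+1%:R); lra.
have all_shift n (u : R) : 0 <= u + n%:R * (4 * H) -> isd (qsin q) u (spow q (qcos q u)) /\
    isd (qcos q) u (- spow q (qsin q u)).
  elim: n u => [|n IH] u; first by rewrite mul0r addr0 => /all_nonneg.
  rewrite -natr1 mulrDl mul1r => h; apply/per4/IH; lra.
have [n n1] : exists n : nat, - t / (4 * H) < n%:R.
  by eexists; exact: Num.Theory.truncnS_gt.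
apply: (all_shift n); have := n1; rewrite ltr_pdivrMr ?mulr_gt0//; lra.
Unshelve. all: by end_near. Qed.

End qpoint.

(** * Duality and strict convexity of the q-sphere *)

Section qtrigonometry.
Context (R : realType) (p q : R) (p1 : 1 < p) (pq : p^-1 + q^-1 = 1).

Lemma conjugate_gt1 : 1 < q.
Proof.
have p0 : 0 < p := lt_trans ltr01 p1.
have h1 : p^-1 < 1 by rewrite invf_lt1.
have h2 : 0 < p^-1 by rewrite invr_gt0.
have h : q^-1 = 1 - p^-1 by rewrite -pq [p^-1 + _]addrC addrK.
have q0 : 0 < q by rewrite -invr_gt0 h subr_gt0.
by rewrite -invf_lt1// h ltrBlDr ltrDl.
Qed.

Let q1 : 1 < q := conjugate_gt1.
Let q0 : 0 < q. Proof. by rewrite (lt_trans _ q1). Qed.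
Let p0 : 0 < p. Proof. by rewrite (lt_trans _ p1). Qed.
Local Notation H := (qprim q 1).
Let H0 : 0 < H. Proof. exact: qprim1_gt0. Qed.
Local Notation C := (qcos q).
Local Notation S := (qsin q).

Lemma conjugate_mul : p * (q - 1) = q.
Proof.
have -> : q - 1 = q * p^-1.
  have -> : p^-1 = 1 - q^-1 by rewrite -pq addrK.
  by field; rewrite gt_eqF.
by field; rewrite gt_eqF.
Qed.

Lemma qtrig_sphere t : `|C t| `^ q + `|S t| `^ q = 1.
Proof.
have [k [s [n [_ /andP[s0 s1] _ E]]]] := qpoint_decomposition q1 t.
apply/(lnorm_eq1 q1 (C t, S t)).
rewrite /qcos /qsin -surjective_pairing E lnorm_iter_qrotc lnorm_qarc//.
by rewrite ger0_norm// ltW.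
Qed.

Lemma qtrig_le1 t : `|C t| <= 1 /\ `|S t| <= 1.
Proof.
have h1 := powR_ge0 `|C t| q; have h2 := powR_ge0 `|S t| q.
by split; rewrite -(powR_le1 q0)//; have := qtrig_sphere t; lra.
Qed.

Lemma qtrig_dual t : C t * spow q (C t) + S t * spow q (S t) = 1.
Proof. by rewrite !mul_spow// qtrig_sphere. Qed.

Lemma isd_qsin (t : R) : isd S t (spow q (C t)).
Proof. by have [] := isd_qtrig q1 t. Qed.

Lemma isd_qcos (t : R) : isd C t (- spow q (S t)).
Proof. by have [] := isd_qtrig q1 t. Qed.

Lemma qsin_continuous : continuous S.
Proof. by move=> t; exact: isd_continuous (isd_qsin t). Qed.

Lemma qcos_continuous : continuous C.
Proof. by move=> t; exact: isd_continuous (isd_qcos t). Qed.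

Lemma spow_qcos_continuous : continuous (fun t => spow q (C t)).
Proof.
move=> t; apply: (@continuous_comp _ _ _ C (spow q)); first exact: qcos_continuous.
exact: spow_continuous.
Qed.

Lemma spow_qsin_continuous : continuous (fun t => spow q (S t)).
Proof.
move=> t; apply: (@continuous_comp _ _ _ S (spow q)); first exact: qsin_continuous.
exact: spow_continuous.
Qed.

Lemma qtrigD2 t : C (t + 2 * H) = - C t /\ S (t + 2 * H) = - S t.
Proof.
by rewrite (_ : t + 2 * H = t + H + H); [rewrite !(qcosD,qsinD)|ring].
Qed.

Lemma qpoint_periodic t (n : int) : qpoint q (t + n%:~R * (4 * H)) = qpoint q t.
Proof.
have [k [s [m [k4 s1 -> ->]]]] := qpoint_decomposition q1 t.
rewrite -addrA -mulrDl -intrD; exact: qpointE.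
Qed.

Lemma qtrig_periodic t : C (t + 4 * H) = C t /\ S (t + 4 * H) = S t.
Proof.
by have := qpoint_periodic t 1; rewrite mul1r /qcos /qsin => ->.
Qed.

Lemma quadrant (v : R * R) : v != 0 -> exists k c s,
  [/\ (k < 4)%N, 0 < c, 0 <= s & v = iter k (@qrotc R) (c, s)].
Proof.
case: v => x y xy0.
have [x0|x0|x0] := ltgtP x 0.
- have [y0|y0] := leP y 0.
    exists 2%N, (- x), (- y); split => //; first by lra.
      by lra.
    by rewrite /= /qrotc /= !opprK.
  exists 1%N, y, (- x); split => //; first by lra.
  by rewrite /= /qrotc /= !opprK.
- have [y0|y0] := leP 0 y; first by exists 0%N, x, y.
  exists 3%N, (- y), x; split => //; [by lra|exact: ltW|].
  by rewrite /= /qrotc /= !opprK.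
- have [y0|y0|y0] := ltgtP y 0.
  + exists 3%N, (- y), x; split => //; [by lra|by rewrite x0|].
    by rewrite /= /qrotc /= !opprK.
  + exists 1%N, y, (- x); split => //; first by rewrite x0 oppr0.
    by rewrite /= /qrotc /= !opprK.
  + by move: xy0; rewrite x0 y0 eqxx.
Qed.

Lemma qpoint_surj x y : `|x| `^ q + `|y| `^ q = 1 ->
  exists2 t, 0 <= t < 4 * H & C t = x /\ S t = y.
Proof.
move=> xy; have [|k [c [s [k4 c0 s0 E]]]] := @quadrant (x, y).
  apply/eqP => -[x0 y0]; move: xy; rewrite x0 y0 normr0 powR0 ?gt_eqF// addr0.
  by move/eqP; rewrite eq_sym oner_eq0.
have cs : `|c| `^ q + `|s| `^ q = 1.
  apply/(lnorm_eq1 q1 (c, s)); rewrite -(lnorm_iter_qrotc q k) -E.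
  exact/(lnorm_eq1 q1 (x, y)).
have cE : c = qarc q s.
  by apply: qarc_unique => //; [exact: ltW|rewrite addrC -[c in c `^ q]gtr0_norm].
have s1 : s < 1.
  by rewrite ltNge; apply/negP => s1; move: c0; rewrite cE qarc_ge1 ?ltxx// ger0_norm.
have s01 : 0 <= s < 1 by rewrite s0.
have /andP[a0 a1] := qprim_ge0 q1 s01.
exists (k%:R * H + qprim q s).
  apply/andP; split; first by rewrite addr_ge0// mulr_ge0// ltW.
  have : k%:R * H <= 3 * H by apply: ler_wpM2r; [exact: ltW|rewrite ler_nat -ltnS].
  lra.
have := @qpointE _ q q1 k s 0 k4 s01; rewrite mul0r addr0 /qcos /qsin => ->.
by rewrite -cE -E.
Qed.

Lemma iter_qrotc_inj k k' c s c' s' : (k < 4)%N -> (k' < 4)%N -> 0 < c -> 0 <= s ->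
  0 < c' -> 0 <= s' -> iter k (@qrotc R) (c, s) = iter k' (@qrotc R) (c', s') ->
  k = k' /\ s = s'.
Proof.
move=> + + c0 s0 c0' s0'.
case: k => [|[|[|[|//]]]] _; case: k' => [|[|[|[|//]]]] _;
  rewrite /= /qrotc /= => -[h1 h2];
  ((split; [by []|lra]) || (exfalso; lra)).
Qed.

Lemma qpoint_inj a b : C a = C b -> S a = S b -> `|a - b| < 4 * H -> a = b.
Proof.
move=> Cab Sab.
have [k [s [n [k4 s1 aE E]]]] := qpoint_decomposition q1 a.
have [k' [s' [n' [k4' s1' bE E']]]] := qpoint_decomposition q1 b.
have Eab : qpoint q a = qpoint q b.
  by rewrite [LHS]surjective_pairing [RHS]surjective_pairing -/(C a) -/(S a) Cab Sab.
move: Eab; rewrite E E' aE bE => /iter_qrotc_inj; case/andP: (s1) => s0 s2; case/andP: (s1') => s0' s2'.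
have c0 : 0 < qarc q s by rewrite qarc_gt0// ger0_norm.
have c0' : 0 < qarc q s' by rewrite qarc_gt0// ger0_norm.
move=> /(_ k4 k4' c0 s0 c0' s0')[<- <-].
rewrite opprD addrACA subrr add0r -mulrBl -intrB normrM (gtr0_norm (mulr_gt0 _ H0))//.
rewrite -ltr_pdivlMr ?mulr_gt0// divff ?gt_eqF ?mulr_gt0//.
rewrite -intr_norm -[1]/(1%:~R) ltr_int => nn.
suff -> : n = n' by [].
by apply/eqP; rewrite -subr_eq0 -normr_le0 -ltzD1 add0r.
Qed.

(** Provides the representative of the angle in the window around a on which [qdot_lt1] applies. *)
Lemma qpoint_near a x y : `|x| `^ q + `|y| `^ q = 1 ->
  exists2 b, a - 2 * H <= b < a + 2 * H & C b = x /\ S b = y.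
Proof.
move=> /qpoint_surj[t _ [<- <-]].
have [u [n [/andP[u0 u4] tE]]] := qmod_decomposition q1 (t - (a - 2 * H)).
exists (a - 2 * H + u); first by apply/andP; split; lra.
have : qpoint q (a - 2 * H + u) = qpoint q t.
  rewrite -(qpoint_periodic _ n); congr (qpoint q _); lra.
by rewrite /qcos /qsin => ->.
Qed.

Lemma sphere_proportional x y x' y' : `|x| `^ q + `|y| `^ q = 1 ->
  `|x'| `^ q + `|y'| `^ q = 1 -> x * y' = y * x' ->
  (x' = x /\ y' = y) \/ (x' = - x /\ y' = - y).
Proof.
move=> E E' F.
have G : `|x| `^ q * `|y'| `^ q = `|y| `^ q * `|x'| `^ q.
  by rewrite -!powRM// -!normrM F.
have X : `|x| `^ q = `|x'| `^ q.
  have : `|x| `^ q * (1 - `|x'| `^ q) = (1 - `|x| `^ q) * `|x'| `^ q.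
    have -> : 1 - `|x'| `^ q = `|y'| `^ q by lra.
    by have -> : 1 - `|x| `^ q = `|y| `^ q by lra.
  lra.
have Y : `|y| `^ q = `|y'| `^ q by lra.
have nx : `|x| = `|x'| by apply: (powR_injective q0); rewrite ?nnegrE.
have ny : `|y| = `|y'| by apply: (powR_injective q0); rewrite ?nnegrE.
have /orP[/eqP hx|/eqP hx] : (x == x') || (x == - x') by rewrite -eqr_norm2 nx.
  have /orP[/eqP hy|/eqP hy] : (y == y') || (y == - y') by rewrite -eqr_norm2 ny.
    by left.
  have : x' * y' = 0 by move: F; rewrite hx hy; lra.
  move=> /eqP; rewrite mulf_eq0 => /orP[/eqP z|/eqP z]; [right|left].
    by rewrite hx hy z; split; lra.
  by rewrite hx hy z; split; lra.
have /orP[/eqP hy|/eqP hy] : (y == y') || (y == - y') by rewrite -eqr_norm2 ny.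
  have : x' * y' = 0 by move: F; rewrite hx hy; lra.
  move=> /eqP; rewrite mulf_eq0 => /orP[/eqP z|/eqP z]; [left|right].
    by rewrite hx hy z; split; lra.
  by rewrite hx hy z; split; lra.
by right; rewrite hx hy; split; lra.
Qed.

Definition qcross a b := C a * S b - S a * C b.

(** Intermediate values: the cross product vanishes only at parallel points, which are equal or
    opposite on the sphere, and a quarter turn after a it is a sum of squares. *)
Lemma qcross_gt0 a b : a < b -> b < a + 2 * H -> 0 < qcross a b.
Proof.
have nz t : a < t -> t < a + 2 * H -> qcross a t != 0.
  move=> t0 t2; apply/eqP => /eqP; rewrite /qcross subr_eq0 => /eqP E.
  case: (sphere_proportional (qtrig_sphere a) (qtrig_sphere t) E) => -[h1 h2].
    have : t = a by apply: qpoint_inj => //; rewrite ltr_norml; apply/andP; split; lra.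
    lra.
  have [c2 s2] := qtrigD2 a.
  have : t = a + 2 * H.
    by apply: qpoint_inj; rewrite ?c2 ?s2// ltr_norml; apply/andP; split; lra.
  lra.
have posH : 0 < qcross a (a + H).
  rewrite /qcross qcosD// qsinD// mulrN opprK -!expr2.
  rewrite lt_neqAle addr_ge0 ?sqr_ge0// andbT eq_sym paddr_eq0 ?sqr_ge0//.
  rewrite !sqrf_eq0; apply/negP => /andP[/eqP h1 /eqP h2].
  have := qtrig_sphere a; rewrite h1 h2 normr0 powR0 ?gt_eqF// addr0.
  by move/eqP; rewrite eq_sym oner_eq0.
have cf : continuous (qcross a).
  move=> t; apply: (@continuousB _ _ _ (fun t => C a * S t) (fun t => S a * C t)).
    by apply: (@continuousM _ _ (fun=> C a) S); [exact: cst_continuous|exact: qsin_continuous].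
  by apply: (@continuousM _ _ (fun=> S a) C); [exact: cst_continuous|exact: qcos_continuous].
have cfN : continuous (fun t => - qcross a t).
  by move=> t; apply: (@continuousN _ _ _ (qcross a)); exact: cf.
move=> ab b2; rewrite ltNge; apply/negP => h.
have [bH|Hb] := leP b (a + H).
  have [|t /andP[t1 t2] tE] := @IVT_continuous _ (qcross a) b (a + H) 0 bH cf.
    by rewrite h ltW.
  have := nz t; rewrite tE eqxx => F; suff : false by []; apply: F; lra.
have [|t /andP[t1 t2] tE] := @IVT_continuous _ (fun t => - qcross a t) (a + H) b 0 (ltW Hb) cfN.
  by rewrite oppr_le0 oppr_ge0 h ltW.
have := nz t; have -> : qcross a t = 0 by lra.
rewrite eqxx => F; suff : false by []; apply: F; lra.
Qed.

(** Dual vectors turn in the same sense as points, because [spow] is multiplicative and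
    increasing. *)
Lemma spow_qcross_gt0 a b : a < b -> b < a + 2 * H ->
  0 < spow q (C a) * spow q (S b) - spow q (S a) * spow q (C b).
Proof.
move=> ab b2; have := qcross_gt0 ab b2; rewrite /qcross !subr_gt0 -!spowM.
exact: spow_lt.
Qed.

Lemma isd_qdot (x y : R) (t : R) :
  isd (fun t => x * C t + y * S t) t (y * spow q (C t) - x * spow q (S t)).
Proof.
have E := isdD (isdZ x (isd_qcos t)) (isdZ y (isd_qsin t)).
by apply: isd_eq E _; ring.
Qed.

Lemma qdot_continuous (x y : R) : continuous (fun t => x * C t + y * S t).
Proof. by move=> t; exact: isd_continuous (isd_qdot x y t). Qed.

(** Strict convexity: the functional dual to the point at angle a increases up to a and decreases
    after it, over half a turn on each side. *)
Lemma qdot_lt1 a b : a - 2 * H <= b < a + 2 * H -> b != a ->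
  spow q (C a) * C b + spow q (S a) * S b < 1.
Proof.
move=> /andP[b1 b2] ba; rewrite -(qtrig_dual a) [C a * _]mulrC [S a * _]mulrC.
pose f t := spow q (C a) * C t + spow q (S a) * S t.
have [ltba|ltab|E] := ltgtP b a; last by rewrite E eqxx in ba.
  apply: (@isd_lt _ f (fun t => spow q (S a) * spow q (C t) - spow q (C a) * spow q (S t)) b a ltba).
    exact: qdot_continuous.
  move=> t /andP[t1 t2]; split; first exact: isd_qdot.
  have := @spow_qcross_gt0 t a t2; rewrite [spow q (C t) * _]mulrC [spow q (S t) * _]mulrC.
  by apply; lra.
rewrite -ltrN2.
apply: (@isd_lt _ (fun t => - f t) (fun t => - (spow q (S a) * spow q (C t) - spow q (C a) * spow q (S t))) a b ltab).
  by move=> t; apply: (@continuousN _ _ _ f); exact: qdot_continuous.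
move=> t /andP[t1 t2]; split; first by apply: isdN; exact: isd_qdot.
rewrite opprB; apply: spow_qcross_gt0 => //; lra.
Qed.

Lemma lnormZ (s r : R) (v : R * R) : 0 < s -> 0 <= r ->
  lnorm s (r * v.1, r * v.2) = r * lnorm s v.
Proof.
move=> s0 r0; rewrite /lnorm /= !normrM !powRM// -mulrDr powRM ?powR_ge0 ?addr_ge0 ?powR_ge0//.
by rewrite -powRrM divff ?gt_eqF// powRr1// ger0_norm.
Qed.

Lemma lnorm_qpoint t : lnorm q (C t, S t) = 1.
Proof. by apply/(lnorm_eq1 q1 (C t, S t)); exact: qtrig_sphere. Qed.

Lemma abs_spow x : `|spow q x| `^ p = `|x| `^ q.
Proof.
have [->|x0] := eqVneq x 0; first by rewrite spow0 normr0 !powR0// gt_eqF.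
by rewrite norm_spow// -powRrM mulrC conjugate_mul.
Qed.

Lemma lnorm_dual t : lnorm p (spow q (C t), spow q (S t)) = 1.
Proof. by rewrite /lnorm /= !abs_spow qtrig_sphere powR1. Qed.

Lemma dual_le1 t : `|spow q (C t)| <= 1 /\ `|spow q (S t)| <= 1.
Proof.
have [c1 s1] := qtrig_le1 t.
by split; rewrite -(powR_le1 p0)// abs_spow powR_le1.
Qed.

Lemma hoelder_lnorm (u v : R * R) : u.1 * v.1 + u.2 * v.2 <= lnorm p u * lnorm q v.
Proof.
apply: (@le_trans _ _ (`|u.1| * `|v.1| + `|u.2| * `|v.2|)).
  by rewrite -!normrM lerD// ler_norm.
exact: hoelder2.
Qed.

Lemma lnorm_polar (a b : R) : (a, b) != 0 -> exists r t,
  [/\ 0 < r, 0 <= t < 4 * H, a = r * C t & b = r * S t].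
Proof.
move=> ab0; pose r := lnorm q (a, b).
have E0 : `|a| `^ q + `|b| `^ q != 0.
  rewrite paddr_eq0 ?powR_ge0//; apply: contra ab0 => /andP[].
  by rewrite !powR_eq0 !normr_eq0 => /andP[/eqP-> _] /andP[/eqP-> _].
have r0 : 0 < r by rewrite powR_gt0// lt_neqAle eq_sym E0 addr_ge0 ?powR_ge0.
have [|t t1 [Ct St]] := @qpoint_surj (r^-1 * a) (r^-1 * b).
  apply/(lnorm_eq1 q1 (r^-1 * a, r^-1 * b)).
  rewrite (lnormZ (a, b) q0) ?invr_ge0 ?(ltW r0)// -/r mulVf// gt_eqF//.
by exists r, t; split => //; rewrite ?Ct ?St; field; rewrite gt_eqF.
Qed.

(** Equality case of Hoelder's inequality: the vector is r times a point of the sphere at which the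
    functional dual to t takes the value 1, and t is the only such angle modulo the period. *)
Lemma hoelder_dual_eq (r x y t : R) : 0 < r -> lnorm q (x, y) <= r ->
  spow q (C t) * x + spow q (S t) * y = r -> x = r * C t /\ y = r * S t.
Proof.
move=> r0 xyr E.
have nr : lnorm q (x, y) = r.
  apply/le_anti; rewrite xyr /= -E.
  have := hoelder_lnorm (spow q (C t), spow q (S t)) (x, y).
  by rewrite lnorm_dual mul1r.
have [|b b1 [Cb Sb]] := @qpoint_near t (r^-1 * x) (r^-1 * y).
  apply/(lnorm_eq1 q1 (r^-1 * x, r^-1 * y)).
  rewrite (lnormZ (x, y) q0) ?invr_ge0 ?(ltW r0)// nr mulVf// gt_eqF//.
have bt : b = t.
  apply/eqP; case: (eqVneq b t) => // bt; have := qdot_lt1 b1 bt.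
  rewrite Cb Sb (_ : _ + _ = r^-1 * (spow q (C t) * x + spow q (S t) * y)); last by ring.
  by rewrite E mulVf ?ltxx// gt_eqF.
by rewrite -bt Cb Sb; split; field; rewrite gt_eqF.
Qed.

(* Twice the area between the arc from the angle [a] to [a + w] and its chord. *)
Definition qsegment a w := w - qcross a (a + w).

Lemma isd_qsegment (a w : R) : isd (qsegment a) w
  (1 - (C a * spow q (C (a + w)) + S a * spow q (S (a + w)))).
Proof.
have sh : isd (fun v : R => a + v) w 1.
  by apply: isd_eq (isdD (isd_cst a w) (isd_id w)) _; rewrite add0r.
have E := isdB (isd_id w) (isdB (isdZ (C a) (isd_comp (isd_qsin (a + w)) sh))
  (isdZ (S a) (isd_comp (isd_qcos (a + w)) sh))).
by apply: isd_eq E _; ring.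
Qed.

(* The dual vectors at nearby angles are nearly parallel, which makes the second
   order term of the area vanish. *)
Lemma qsegment_small t e : 0 < e -> exists2 d, 0 < d &
  forall a w, `|a - t| < d -> `|w| < d -> `|qsegment a w| <= e * w ^+ 2.
Proof.
move=> e0; have e40 : 0 < e / 4 by rewrite divr_gt0.
have /cvgrPdist_lt/(_ _ e40)/nbhs_ballP[d1 /= d10 H1] := @spow_qcos_continuous t.
have /cvgrPdist_lt/(_ _ e40)/nbhs_ballP[d2 /= d20 H2] := @spow_qsin_continuous t.
pose d := Num.min d1 d2; have d0 : 0 < d by rewrite lt_min d10.
have Hd u : `|u - t| < d -> `|spow q (C t) - spow q (C u)| < e / 4 /\
    `|spow q (S t) - spow q (S u)| < e / 4.
  rewrite lt_min distrC => /andP[u1 u2]; split; [exact: H1|exact: H2].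
exists (d / 4); first by rewrite divr_gt0.
move=> a w ad wd.
have [s sw sE] := MVT_between 0 w (isd_qsegment a).
rewrite !subr0 in sw; have q00 : qsegment a 0 = 0.
  by rewrite /qsegment /qcross addr0; ring.
rewrite q00 !subr0 in sE.
set b := a + s in sE.
(* A second mean value: the functional dual to b equals 1 at b, and its variation from b to a is the
   derivative of the area found above. *)
have [c cb cE] := MVT_between b a (isd_qdot (spow q (C b)) (spow q (S b))).
have ba : a - b = - s by rewrite /b opprD addrA subrr add0r.
rewrite ba normrN in cb.
have bt : `|b - t| < 2 * (d / 4).
  rewrite (_ : b - t = (a - t) + s) ?/b; last by ring.
  by rewrite (le_lt_trans (ler_normD _ _))//; lra.
have ct : `|c - t| < d.
  rewrite (_ : c - t = (c - b) + (b - t)); last by ring.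
  by rewrite (le_lt_trans (ler_normD _ _))//; lra.
have bt' : `|b - t| < d by lra.
have [c1 c2] := Hd c ct; have [b1 b2] := Hd b bt'.
have cross_small : `|spow q (S b) * spow q (C c) - spow q (C b) * spow q (S c)| <= e.
  have [t1 t2] := dual_le1 t; have [b3 b4] := dual_le1 b.
  move: c1 c2 b1 b2 t1 t2 b3 b4.
  set Cc := spow q (C c); set Sc := spow q (S c); set Cb := spow q (C b).
  set Sb := spow q (S b); set Ct := spow q (C t); set St := spow q (S t).
  move=> c1 c2 b1 b2 t1 t2 b3 b4.
  (* The cross product vanishes when both vectors are the dual vector at t; replacing them one entry
     at a time costs four differences with coefficients of absolute value at most 1. *)
  rewrite (_ : _ - _ = - Sb * (Ct - Cc) + Cb * (St - Sc) - Ct * (St - Sb)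
     + St * (Ct - Cb)); last by ring.
  have bnd (u v : R) : `|u| <= 1 -> `|v| < e / 4 -> `|u * v| <= e / 4.
    by move=> u1 v1; rewrite normrM; rewrite -[leRHS]mul1r ler_pM// ltW.
  apply: (le_trans (ler_normD _ _)); have h4 := bnd _ _ t2 b1.
  suff : `|- Sb * (Ct - Cc) + Cb * (St - Sc) - Ct * (St - Sb)| <= 3 * (e / 4) by lra.
  apply: (le_trans (ler_normB _ _)); have h3 := bnd _ _ t1 b2.
  suff : `|- Sb * (Ct - Cc) + Cb * (St - Sc)| <= 2 * (e / 4) by lra.
  apply: (le_trans (ler_normD _ _)); have h2 := bnd _ _ b3 c2.
  rewrite mulNr normrN; have h1 := bnd _ _ b4 c1; lra.
have dual1 := qtrig_dual b.
have sE' : 1 - (C a * spow q (C b) + S a * spow q (S b)) =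
    (spow q (S b) * spow q (C c) - spow q (C b) * spow q (S c)) * s.
  by move: cE; rewrite /= ba; lra.
rewrite sE sE' -mulrA normrM; apply: ler_pM => //.
by rewrite normrM expr2 -[leRHS]ger0_norm ?sqr_ge0// normrM ler_wpM2r.
Qed.

End qtrigonometry.

(** * Derivatives of curves in the group *)

Section product_derivatives.
Context (R : realType).

Lemma is_derive_cvg (U : normedModType R) (g : R -> U) (t : R) (v : U) :
  is_derive t 1 g v <->
  (fun h => h^-1 *: (g (h + t) - g t)) @ 0^' --> v.
Proof.
have -> : (fun h => h^-1 *: (g (h + t) - g t)) =
    (fun h => h^-1 *: ((g \o shift t) (h *: (1 : R)) - g t)).
  by apply/funext => h; rewrite /= -[h *: 1]/(h * 1) mulr1.
split; first by move=> [dg <-]; exact: dg.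
move=> gv; split; first by apply/cvg_ex; exists v.
by apply: cvg_lim => //; exact: norm_hausdorff.
Qed.

Lemma is_derive_pair (U W : normedModType R) (g : R -> U * W) (t : R) (v : U * W) :
  is_derive t 1 g v <->
  is_derive t 1 (fun s => (g s).1) v.1 /\ is_derive t 1 (fun s => (g s).2) v.2.
Proof.
rewrite !is_derive_cvg; split => [H|[H1 H2]].
  split.
    exact: (cvg_comp _ _ H (@cvg_fst _ _ (nbhs v.1) (nbhs v.2) _)).
  exact: (cvg_comp _ _ H (@cvg_snd _ _ (nbhs v.1) (nbhs v.2) _)).
rewrite [v]surjective_pairing.
rewrite (_ : (fun h : R => _) = (fun h => (h^-1 *: ((g (h + t)).1 - (g t).1),
  h^-1 *: ((g (h + t)).2 - (g t).2)))); first exact: cvg_pair.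
by apply/funext => h; rewrite [LHS]surjective_pairing.
Qed.

Lemma is_derive_heis (g : R -> heis R) (t : R) (v : heis R) :
  is_derive t 1 g v <->
  [/\ isd (fun s => (g s).1.1) t v.1.1, isd (fun s => (g s).1.2) t v.1.2 &
      isd (fun s => (g s).2) t v.2].
Proof.
split => [/is_derive_pair[/is_derive_pair[]]//|[h1 h2 h3]].
by apply/is_derive_pair; split => //; apply/is_derive_pair.
Qed.

Lemma horizontal_field (u1 u2 : R) (h : heis R) :
  u1 *: Xfield h + u2 *: Yfield h = ((u1, u2), (h.1.1 * u2 - h.1.2 * u1) / 2).
Proof.
rewrite /Xfield /Yfield; congr ((_, _), _) => /=.
- by rewrite -[u1 *: 1]/(u1 * 1) -[u2 *: 0]/(u2 * 0); ring.
- by rewrite -[u1 *: 0]/(u1 * 0) -[u2 *: 1]/(u2 * 1); ring.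
- by rewrite -[u1 *: _]/(u1 * _) -[u2 *: (_ / 2)]/(u2 * _); ring.
Qed.

Definition hvelocity (g : R -> heis R) (t u1 u2 : R) : Prop :=
  is_derive t 1 g (u1 *: Xfield (g t) + u2 *: Yfield (g t)).

Lemma hvelocityP g t u1 u2 : hvelocity g t u1 u2 <->
  [/\ isd (fun s => (g s).1.1) t u1, isd (fun s => (g s).1.2) t u2 &
      isd (fun s => (g s).2) t (((g t).1.1 * u2 - (g t).1.2 * u1) / 2)].
Proof. by rewrite /hvelocity is_derive_heis horizontal_field. Qed.

Lemma heis_norm (h : heis R) : `|h| = Num.max (Num.max `|h.1.1| `|h.1.2|) `|h.2|.
Proof. by []. Qed.

Lemma heis_norm_le (h : heis R) (M : R) :
  (`|h| <= M) = [&& `|h.1.1| <= M, `|h.1.2| <= M & `|h.2| <= M].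
Proof. by rewrite heis_norm !ge_max andbA. Qed.

End product_derivatives.

(** * Calibrations and calibrated curves *)

Section calibrations.
Context (R : realType).
Notation mu := (@lebesgue_measure R).

(** Curves are bounded, so a constant on each ball suffices for the composite with a curve to be
    absolutely continuous; the quadratic term of [iso_calibration] admits no global constant. *)
Definition loc_lipschitz (V : normedModType R) (Psi : heis R -> V) := forall M : R,
  exists2 L : R, 0 <= L & forall h k : heis R, `|h| <= M -> `|k| <= M ->
    `|Psi h - Psi k| <= L * `|h - k|.

(* [pX] and [pY] are the derivatives of [Psi] along the fields X and Y. *)
Definition calibration (Psi pX pY : heis R -> R) : Prop :=
  loc_lipschitz Psi /\
  forall g (t u1 u2 : R), hvelocity g t u1 u2 ->
    isd (fun s => Psi (g s)) t (u1 * pX (g t) + u2 * pY (g t)).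

(** What Schmidt's argument takes from the continuity of a coordinate; for glued curves it follows
    by comparing the extrema of the two pieces. *)
Definition has_extrema (a b : R) (f : R -> R) :=
  (exists2 t, a <= t <= b & forall s, a <= s <= b -> f s <= f t) /\
  (exists2 t, a <= t <= b & forall s, a <= s <= b -> f t <= f s).

(* Horizontal curves satisfy this with [l] the arc length; unlike absolute
   continuity it is obviously stable under concatenation. *)
Definition calibrated (q a b : R) (g : R -> heis R) (l : R -> R) : Prop :=
  [/\ a <= b, has_extrema a b (fun t => (g t).1.1),
      has_extrema a b (fun t => (g t).1.2) &
      forall Psi pX pY rho s t, calibration Psi pX pY ->
        a <= s -> s <= t -> t <= b ->
        (forall x, s <= x <= t -> lnorm q (pX (g x), pY (g x)) <= rho) ->
        Psi (g t) - Psi (g s) <= rho * (l t - l s)].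

Lemma abs_continuousS (V : normedModType R) (a b s t : R) (f : R -> V) :
  a <= s -> t <= b -> abs_continuous a b f -> abs_continuous s t f.
Proof.
move=> a_s tb H e e0; have [d d0 Hd] := H e e0; exists d => // n u v uv dis sm.
apply: Hd => // i; have [h1 [h2 h3]] := uv i; split; [lra|split => //; lra].
Qed.

Lemma abs_continuous_within (V : normedModType R) (a b : R) (f : R -> V) :
  abs_continuous a b f -> {within `[a, b], continuous f}.
Proof.
move=> H; apply/subspace_continuousP => x; rewrite /= in_itv/= => /andP[ax xb].
apply/cvgrPdist_lt => e e0; have [d d0 Hd] := H e e0.
have h s t : a <= s -> s <= t -> t <= b -> t - s < d -> `|f t - f s| < e.
  move=> a_s st tb std; have := Hd 1%N (fun=> s) (fun=> t).
  rewrite !big_ord1; apply => //.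
  by move=> i j; rewrite !ord1 eqxx.
rewrite near_withinE; near=> y; rewrite /= in_itv/= => /andP[ay yb].
have yx : `|x - y| < d by near: y; apply: cvgr_dist_lt => //; exact: cvg_id.
move: yx; rewrite ltr_norml => /andP[y1 y2].
have [xy|/ltW yx] := leP x y; last by apply: h => //; lra.
by rewrite distrC; apply: h => //; lra.
Unshelve. all: by end_near. Qed.

Lemma abs_continuous_bounded (a b : R) (g : R -> heis R) : abs_continuous a b g ->
  exists M, forall t, a <= t <= b -> `|g t| <= M.
Proof.
move=> /abs_continuous_within cg.
have /compact_bounded[M [_ HM]] := continuous_compact cg (@segment_compact _ a b).
exists (M + 1) => t tab; apply: HM; first by rewrite ltrDl.
by exists t => //; rewrite /= in_itv.
Qed.

Lemma abs_continuous_comp (V : normedModType R) (a b : R) (g : R -> heis R)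
    (Psi : heis R -> V) :
  loc_lipschitz Psi -> abs_continuous a b g -> abs_continuous a b (Psi \o g).
Proof.
move=> LPsi acg; have [M HM] := abs_continuous_bounded acg.
have [L L0 HL] := LPsi M => e e0.
have e1 : 0 < e / (L + 1) by rewrite divr_gt0//; lra.
have [d d0 Hd] := acg _ e1; exists d => // n s t st dis sm.
have h := Hd n s t st dis sm.
apply: (@le_lt_trans _ _ ((L + 1) * \sum_(i < n) `|g (t i) - g (s i)|)); last first.
  by rewrite mulrC -ltr_pdivlMr//; lra.
rewrite mulr_sumr; apply: ler_sum => i _ /=.
have [h1 [h2 h3]] := st i.
apply: (le_trans (HL _ _ _ _)); rewrite ?HM//; try by apply/andP; split; lra.
by rewrite ler_wpM2r//; lra.
Qed.

Lemma within_has_extrema (a b : R) (f : R -> R) : a <= b ->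
  {within `[a, b], continuous f} -> has_extrema a b f.
Proof.
move=> ab cf; split.
  have [t tab H] := EVT_max ab cf; exists t; first by rewrite in_itv in tab.
  by move=> s sab; apply: H; rewrite in_itv.
have [t tab H] := EVT_min ab cf; exists t; first by rewrite in_itv in tab.
by move=> s sab; apply: H; rewrite in_itv.
Qed.

Lemma loc_lipschitz_fst : loc_lipschitz (fun h : heis R => h.1.1).
Proof.
move=> M; exists 1 => // h k _ _; rewrite mul1r.
by have := lexx `|h - k|; rewrite heis_norm_le => /and3P[].
Qed.

Lemma loc_lipschitz_snd : loc_lipschitz (fun h : heis R => h.1.2).
Proof.
move=> M; exists 1 => // h k _ _; rewrite mul1r.
by have := lexx `|h - k|; rewrite heis_norm_le => /and3P[].
Qed.

Lemma measurable_lnorm (p a b : R) (u1 u2 : R -> R) :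
  measurable_fun `[a, b] u1 -> measurable_fun `[a, b] u2 ->
  measurable_fun `[a, b] (fun t => lnorm p (u1 t, u2 t)).
Proof.
move=> m1 m2; rewrite /lnorm /=.
have pw r (u : R -> R) : measurable_fun `[a, b] u ->
    measurable_fun `[a, b] (fun t => u t `^ r).
  by move=> mu_; apply: (measurableT_comp (measurable_powR r)).
apply: (pw); apply: measurable_funD; apply: (pw).
  exact: measurableT_comp.
exact: measurableT_comp.
Qed.

Definition arclength (p a : R) (u1 u2 : R -> R) (t : R) : R :=
  (\int[mu]_(x in `[a, t]) lnorm p (u1 x, u2 x))%R.

Lemma arclengthB (p a b : R) (u1 u2 : R -> R) (s t : R) :
  measurable_fun `[a, b] u1 -> measurable_fun `[a, b] u2 ->
  (hlength p a b u1 u2 < +oo)%E -> a <= s -> s <= t -> t <= b ->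
  ((arclength p a u1 u2 t - arclength p a u1 u2 s)%:E =
   \int[mu]_(x in `[s, t]) (lnorm p (u1 x, u2 x))%:E)%E.
Proof.
move=> m1 m2 fin a_s st tb.
have mk := measurable_lnorm p m1 m2.
have ik : mu.-integrable `[a, b] (EFin \o (fun x => lnorm p (u1 x, u2 x))).
  apply/integrableP; split; first exact/measurable_EFinP.
  rewrite (_ : (\int[mu]_(x in `[a, b]) `|(EFin \o _) x|)%E = hlength p a b u1 u2)//.
  by apply: eq_integral => x _ /=; rewrite ger0_norm// powR_ge0.
have ikS c d : a <= c -> d <= b ->
    mu.-integrable `[c, d] (EFin \o (fun x => lnorm p (u1 x, u2 x))).
  move=> ac db; apply: integrableS ik => // x; rewrite /= !in_itv/= => /andP[h1 h2].
  by apply/andP; split; lra.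
rewrite /arclength Rintegral_itvB ?bnd_simp//; last exact: ikS.
rewrite Rintegral_itv_obnd_cbnd; last first.
  apply: integrableS (ikS s t a_s tb) => //; exact: subset_itv_oc_cc.
rewrite /Rintegral fineK//; apply: integrable_fin_num => //; exact: ikS.
Qed.

(** By Hoelder's inequality the derivative of [Psi] along the curve is almost everywhere at most rho
    times the speed, and [abs_continuous_le_integral] integrates this bound. *)
Lemma horizontal_calibrated (p q a b : R) (g : R -> heis R) (u1 u2 : R -> R) :
  1 < p -> p^-1 + q^-1 = 1 -> horizontal a b g u1 u2 ->
  (hlength p a b u1 u2 < +oo)%E -> calibrated q a b g (arclength p a u1 u2).
Proof.
move=> p1 pq [ab acg m1 m2 ae1] fin.
split => //.
- apply: within_has_extrema => //; apply: abs_continuous_within.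
  exact: (abs_continuous_comp loc_lipschitz_fst acg).
- apply: within_has_extrema => //; apply: abs_continuous_within.
  exact: (abs_continuous_comp loc_lipschitz_snd acg).
move=> Psi pX pY rho s t [LPsi dPsi] a_s st tb Hrho.
have rho0 : 0 <= rho.
  by apply: le_trans (Hrho s _); [exact: powR_ge0|rewrite lexx].
have sub : `[s, t]%classic `<=` `[a, b]%classic.
  by move=> x; rewrite /= !in_itv/= => /andP[h1 h2]; apply/andP; split; lra.
have m1' : measurable_fun `[s, t] u1 by exact: measurable_funS m1.
have m2' : measurable_fun `[s, t] u2 by exact: measurable_funS m2.
have mk := measurable_lnorm p m1' m2'.
have acPsi : abs_continuous s t (Psi \o g).
  exact: abs_continuousS (abs_continuous_comp LPsi acg).
have mk' : measurable_fun `[s, t] (fun x => rho * lnorm p (u1 x, u2 x)).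
  exact: measurable_funM.
have k0 x : 0 <= rho * lnorm p (u1 x, u2 x) by rewrite mulr_ge0// powR_ge0.
have := abs_continuous_le_integral st acPsi mk' k0.
have ae2 : {ae mu, forall x, x \in `[s, t] ->
    exists2 l, is_derive x 1 (Psi \o g) l & l <= rho * lnorm p (u1 x, u2 x)}.
  apply: filterS ae1; first exact: (ae_filter_ringOfSetsType mu).
  move=> x Hx; rewrite in_itv/= => /andP[sx xt].
  have xab : x \in `[a, b] by rewrite in_itv/=; apply/andP; split; lra.
  exists (u1 x * pX (g x) + u2 x * pY (g x)); first exact: dPsi (Hx xab).
  apply: (le_trans (hoelder_lnorm p1 pq (u1 x, u2 x) (pX (g x), pY (g x)))).
  by rewrite mulrC ler_wpM2r ?powR_ge0// Hrho// sx.
move=> /(_ ae2) /=.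
rewrite (_ : (\int[mu]_(x in `[s, t]) (rho * lnorm p (u1 x, u2 x))%:E)%E =
    (rho%:E * \int[mu]_(x in `[s, t]) (lnorm p (u1 x, u2 x))%:E)%E).
  by rewrite -(arclengthB m1 m2 fin a_s st tb) -EFinM lee_fin.
rewrite -ge0_integralZl_EFin//.
- by move=> x _; rewrite lee_fin powR_ge0.
- exact/measurable_EFinP.
Qed.

(** The zero function is a calibration, and its gradient has norm at most rho = 1. *)
Lemma calibrated_nondecreasing q a b g l s t : calibrated q a b g l ->
  1 < q -> a <= s -> s <= t -> t <= b -> l s <= l t.
Proof.
move=> [_ _ _ H] q1 a_s st tb.
have c0 : calibration (fun=> 0) (fun=> 0) (fun=> 0).
  split => [M|g' t' u1 u2 _].
    by exists 0 => // h k _ _; rewrite subrr normr0 mul0r.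
  by apply: isd_eq (isd_cst 0 t') _; ring.
have := H _ _ _ 1 s t c0 a_s st tb; rewrite subrr mul1r subr_ge0; apply.
move=> x _; rewrite /lnorm /= normr0 powR0 ?gt_eqF//; last by lra.
by rewrite addr0 powR0 ?gt_eqF ?ler01// invr_gt0; lra.
Qed.

Definition glue (T : Type) (b : R) (f g : R -> T) (t : R) : T :=
  if t <= b then f t else g t.

Lemma glue_has_extrema a b c f1 f2 : a <= b -> b <= c -> f1 b = f2 b ->
  has_extrema a b f1 -> has_extrema b c f2 -> has_extrema a c (glue b f1 f2).
Proof.
move=> ab bc E [[t1 /andP[t1a t1b] M1] [s1 /andP[s1a s1b] m1]]
  [[t2 /andP[t2b t2c] M2] [s2 /andP[s2b s2c] m2]].
have g1 t : t <= b -> glue b f1 f2 t = f1 t by rewrite /glue => ->.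
have g2 t : b <= t -> glue b f1 f2 t = f2 t.
  rewrite /glue => bt; case: ifPn => // tb.
  by have -> : t = b by apply/le_anti; rewrite tb.
split.
- have [h|h] := leP (f1 t1) (f2 t2).
    exists t2; first by apply/andP; split; lra.
    move=> s /andP[sa sc]; rewrite (g2 t2 t2b); have [sb|/ltW sb] := leP s b.
      by rewrite (g1 s sb); apply: le_trans h; apply: M1; rewrite sa.
    by rewrite (g2 s sb); apply: M2; rewrite sb.
  exists t1; first by apply/andP; split; lra.
  move=> s /andP[sa sc]; rewrite (g1 t1 t1b); have [sb|/ltW sb] := leP s b.
    by rewrite (g1 s sb); apply: M1; rewrite sa.
  by rewrite (g2 s sb); apply: le_trans (ltW h); apply: M2; rewrite sb.
- have [h|h] := leP (f1 s1) (f2 s2).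
    exists s1; first by apply/andP; split; lra.
    move=> s /andP[sa sc]; rewrite (g1 s1 s1b); have [sb|/ltW sb] := leP s b.
      by rewrite (g1 s sb); apply: m1; rewrite sa.
    by rewrite (g2 s sb); apply: le_trans h _; apply: m2; rewrite sb.
  exists s2; first by apply/andP; split; lra.
  move=> s /andP[sa sc]; rewrite (g2 s2 s2b); have [sb|/ltW sb] := leP s b.
    by rewrite (g1 s sb); apply: le_trans (ltW h) _; apply: m1; rewrite sa.
  by rewrite (g2 s sb); apply: m2; rewrite sb.
Qed.

Lemma glue_calibrated q a b c g1 g2 l1 l2 : calibrated q a b g1 l1 ->
  calibrated q b c g2 l2 -> g1 b = g2 b ->
  calibrated q a c (glue b g1 g2) (glue b l1 (fun t => l2 t - l2 b + l1 b)).
Proof.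
move=> [ab x1 y1 H1] [bc x2 y2 H2] E.
have gcomp (f : heis R -> R) : (fun t => f (glue b g1 g2 t)) =
    glue b (fun t => f (g1 t)) (fun t => f (g2 t)).
  by apply/funext => t; rewrite /glue; case: ifP.
split; first exact: le_trans bc.
- by rewrite (gcomp (fun h => h.1.1)); apply: glue_has_extrema => //; rewrite E.
- by rewrite (gcomp (fun h => h.1.2)); apply: glue_has_extrema => //; rewrite E.
have e1 (T : Type) (f g : R -> T) t : t <= b -> glue b f g t = f t.
  by rewrite /glue => ->.
have e2 (T : Type) (f g : R -> T) t : f b = g b -> b <= t -> glue b f g t = g t.
  rewrite /glue => fg bt; case: ifPn => // tb.
  by have -> : t = b by apply/le_anti; rewrite tb.
have El : l1 b = l2 b - l2 b + l1 b by ring.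
move=> Psi pX pY rho s t cal a_s st tc Hrho.
have [tb|/ltW tb] := leP t b.
  rewrite !(e1 _ _ _ t tb) !(e1 _ _ _ s (le_trans st tb)).
  apply: (H1 Psi pX pY rho s t cal a_s st tb) => x /andP[sx xt].
  by have := Hrho x; rewrite (e1 _ _ _ x (le_trans xt tb)); apply; rewrite sx.
have [sb|/ltW sb] := leP b s.
  rewrite !(e2 _ _ _ t _ tb)// !(e2 _ _ _ s _ sb)//.
  have := H2 Psi pX pY rho s t cal sb st tc.
  rewrite (_ : l2 t - l2 b + l1 b - (l2 s - l2 b + l1 b) = l2 t - l2 s); last by ring.
  apply=> x /andP[sx xt].
  by have := Hrho x; rewrite (e2 _ _ _ x E (le_trans sb sx)); apply; rewrite sx.
rewrite (e2 _ _ _ t E tb) (e1 _ _ _ s sb) (e2 _ _ _ t El tb) (e1 _ _ _ s sb).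
have i1 : Psi (g1 b) - Psi (g1 s) <= rho * (l1 b - l1 s).
  apply: (H1 Psi pX pY rho s b cal a_s sb (lexx b)) => x /andP[sx xb].
  by have := Hrho x; rewrite (e1 _ _ _ x xb) sx (le_trans xb tb); apply.
have i2 : Psi (g2 t) - Psi (g2 b) <= rho * (l2 t - l2 b).
  apply: (H2 Psi pX pY rho b t cal (lexx b) tb tc) => x /andP[bx xt].
  by have := Hrho x; rewrite (e2 _ _ _ x E bx) xt (le_trans sb bx); apply.
rewrite E in i1; lra.
Qed.

(** Isometries act on calibrated curves by pulling calibrations back without changing the norm of
    the gradient. *)
Lemma calibrated_comp q a b g l (F : heis R -> heis R) :
  has_extrema a b (fun t => (F (g t)).1.1) -> has_extrema a b (fun t => (F (g t)).1.2) ->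
  (forall Psi pX pY, calibration Psi pX pY -> exists pX' pY',
     calibration (Psi \o F) pX' pY' /\
     forall h, lnorm q (pX' h, pY' h) = lnorm q (pX (F h), pY (F h))) ->
  calibrated q a b g l -> calibrated q a b (F \o g) l.
Proof.
move=> ex ey HF [ab _ _ H]; split; [exact: ab|exact: ex|exact: ey|].
move=> Psi pX pY rho s t /HF[pX' [pY' [cal E]]] a_s st tb Hrho.
apply: (H (Psi \o F) pX' pY' rho s t cal a_s st tb) => x xst.
by rewrite E; exact: Hrho.
Qed.

(** The sign of the third coordinate makes this an automorphism of the group; it carries statements
    about the abscissa over to the ordinate, with the orientation reversed. *)
Definition hswap (h : heis R) : heis R := ((h.1.2, h.1.1), - h.2).

Lemma loc_lipschitz_comp (F : heis R -> heis R) (Psi : heis R -> R) :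
  loc_lipschitz F -> loc_lipschitz Psi -> loc_lipschitz (Psi \o F).
Proof.
move=> LF LPsi M; have [L1 L10 H1] := LF M.
have [M' HM'] : exists M', forall h, `|h| <= M -> `|F h| <= M'.
  exists (`|F 0| + L1 * `|M|) => h hM.
  have M0 : 0 <= M by exact: le_trans hM.
  have := H1 h 0 hM; rewrite normr0 => /(_ M0); rewrite subr0 => h1.
  rewrite -[F h](subrK (F 0)) (le_trans (ler_normD _ _))// addrC lerD2l (le_trans h1)//.
  by rewrite ler_wpM2l// (le_trans hM)// ler_norm.
have [L2 L20 H2] := LPsi M'; exists (L2 * L1); first exact: mulr_ge0.
move=> h k hM kM; rewrite (le_trans (H2 _ _ (HM' _ hM) (HM' _ kM)))//.
by rewrite -mulrA ler_wpM2l// H1.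
Qed.

Lemma hswap_lipschitz : loc_lipschitz hswap.
Proof.
move=> M; exists 1 => // h k _ _; rewrite mul1r.
have := lexx `|h - k|; rewrite heis_norm_le => /and3P[h1 h2 h3].
rewrite heis_norm_le /=; apply/and3P; split => //.
by rewrite opprK addrC distrC.
Qed.

Lemma calibrated_swap q a b g l : calibrated q a b g l ->
  calibrated q a b (hswap \o g) l.
Proof.
move=> cal; case: (cal) => ab ex ey _; apply: calibrated_comp cal => //.
move=> Psi pX pY [LPsi dPsi]; exists (pY \o hswap), (pX \o hswap); split; last first.
  by move=> h; rewrite /lnorm /= addrC.
split; first exact: loc_lipschitz_comp hswap_lipschitz LPsi.
move=> g' t u1 u2 /hvelocityP[d1 d2 d3] /=.
rewrite [u1 * _ + _]addrC; apply: (dPsi (hswap \o g')).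
apply/hvelocityP; split => //=.
by apply: isd_eq (isdN d3) _; field.
Qed.

Definition hmul (a h : heis R) : heis R :=
  ((a.1.1 + h.1.1, a.1.2 + h.1.2),
   a.2 + h.2 + (a.1.1 * h.1.2 - h.1.1 * a.1.2) / 2).

Lemma hmul_lipschitz a : loc_lipschitz (hmul a).
Proof.
move=> M; exists (1 + `|a.1.1| + `|a.1.2|); first by rewrite !addr_ge0.
move=> h k _ _; set D := `|h - k|.
have := lexx D; rewrite {1}/D heis_norm_le /= => /and3P[h1 h2 h3].
have D0 : 0 <= D by exact: normr_ge0.
have b1 : 0 <= `|a.1.1| * D by rewrite mulr_ge0.
have b2 : 0 <= `|a.1.2| * D by rewrite mulr_ge0.
rewrite heis_norm_le /=; apply/and3P; split.
- rewrite (_ : a.1.1 + h.1.1 - _ = h.1.1 - k.1.1); last by ring.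
  by rewrite (le_trans h1)//; lra.
- rewrite (_ : a.1.2 + h.1.2 - _ = h.1.2 - k.1.2); last by ring.
  by rewrite (le_trans h2)//; lra.
- rewrite (_ : _ - _ = (h.2 - k.2) + (a.1.1 / 2) * (h.1.2 - k.1.2)
      - (a.1.2 / 2) * (h.1.1 - k.1.1)); last by field.
  rewrite (le_trans (ler_normB _ _))//.
  have n1 : `|(h.2 - k.2) + (a.1.1 / 2) * (h.1.2 - k.1.2)| <=
      D + `|a.1.1| * D.
    rewrite (le_trans (ler_normD _ _))// lerD// normrM normrM.
    rewrite (ger0_norm (_ : 0 <= 2^-1))// -mulrA.
    rewrite ler_wpM2l//; have := normr_ge0 (h.1.2 - k.1.2); lra.
  have n2 : `|(a.1.2 / 2) * (h.1.1 - k.1.1)| <= `|a.1.2| * D.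
    rewrite normrM normrM (ger0_norm (_ : 0 <= 2^-1))// -mulrA.
    rewrite ler_wpM2l//; have := normr_ge0 (h.1.1 - k.1.1); lra.
  lra.
Qed.

Lemma hvelocity_hmul a g t u1 u2 : hvelocity g t u1 u2 ->
  hvelocity (hmul a \o g) t u1 u2.
Proof.
move=> /hvelocityP[d1 d2 d3]; apply/hvelocityP; split => /=.
- by apply: isd_eq (isdD (isd_cst a.1.1 t) d1) _; rewrite add0r.
- by apply: isd_eq (isdD (isd_cst a.1.2 t) d2) _; rewrite add0r.
- have E := isdD (isdD (isd_cst a.2 t) d3)
    (isdZ 2^-1 (isdB (isdZ a.1.1 d2) (isdM d1 (isd_cst a.1.2 t)))).
  apply: isd_ext (isd_eq E _) _; last by move=> s /=; ring.
  by field.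
Qed.

Lemma has_extremaD a b f c : has_extrema a b f -> has_extrema a b (fun t => c + f t).
Proof.
move=> [[t1 h1 H1] [t2 h2 H2]]; split; [exists t1|exists t2] => // s sab.
  by rewrite lerD2l H1.
by rewrite lerD2l H2.
Qed.

Lemma calibrated_hmul q a b g l x : calibrated q a b g l ->
  calibrated q a b (hmul x \o g) l.
Proof.
move=> cal; case: (cal) => ab ex ey _; apply: calibrated_comp cal.
- exact: has_extremaD.
- exact: has_extremaD.
move=> Psi pX pY [LPsi dPsi]; exists (pX \o hmul x), (pY \o hmul x); split => //.
split; first exact: loc_lipschitz_comp (hmul_lipschitz x) LPsi.
by move=> g' t u1 u2 /(hvelocity_hmul x)/dPsi.
Qed.

End calibrations.

(** * Isoperimetric calibrations and Schmidt's inequality *)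

Section isoperimetric_calibrations.
Context (R : realType) (q : R) (q1 : 1 < q).
Let q0 : 0 < q. Proof. by rewrite (lt_trans _ q1). Qed.

Definition qarc_scaled (r x : R) : R := r * qarc q (x / r).
Definition qint_scaled (r x : R) : R := r ^+ 2 * qint q (x / r).

Lemma isd_qint_scaled (r x : R) : isd (qint_scaled r) x (qarc_scaled r x).
Proof.
have [->|r0] := eqVneq r 0.
  rewrite /qarc_scaled mul0r.
  apply: isd_ext (isd_cst 0 x) _ => y.
  by rewrite /qint_scaled expr2 !mul0r.
have d : isd (fun y : R => y / r) x r^-1.
  by apply: isd_eq (isdM (isd_id x) (isd_cst r^-1 x)) _; rewrite mul1r mulr0 addr0.
have H := isdZ (r ^+ 2) (@isd_comp _ (qint q) (fun y => y / r) x _ _ (isd_qint q1 (x / r)) d).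
apply: isd_ext (isd_eq H _) _; last by [].
by rewrite /qarc_scaled; field.
Qed.

(** The area of half a ball of radius r, that is, half of [qpi q * r ^+ 2]. *)
Lemma qint_scaledN (r : R) : 0 <= r ->
  qint_scaled r r - qint_scaled r (- r) = qprim q 1 * r ^+ 2.
Proof.
rewrite le_eqVlt => /predU1P[<-|r0]; first by rewrite /qint_scaled expr2; ring.
rewrite /qint_scaled mulNr divff ?gt_eqF// qprimE qarc1//.
have -> : qint q (-1) = 2 * qint q 0 - qint q 1 by have := qintN q1 1; lra.
by ring.
Qed.

(** Up to signs, the vector is the point of the q-sphere of radius r with one coordinate equal to
    x. *)
Lemma lnorm_qarc_scaled (r x s e : R) : `|x| <= r -> `|s| = 1 -> `|e| = 1 ->
  lnorm q (- (s * qarc_scaled r x), e * x) <= r.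
Proof.
move=> xr s1 e1.
have -> : lnorm q (- (s * qarc_scaled r x), e * x) = lnorm q (qarc_scaled r x, x).
  by rewrite /lnorm /= normrN !normrM s1 e1 !mul1r.
have r0 : 0 <= r by exact: le_trans xr.
move: r0; rewrite le_eqVlt => /predU1P[r0|r0].
  have -> : x = 0 by apply/eqP; rewrite -normr_le0 r0.
  rewrite /qarc_scaled -r0 mul0r /lnorm /= normr0 powR0 ?gt_eqF// addr0 powR0//.
  by rewrite gt_eqF// invr_gt0.
have -> : (qarc_scaled r x, x) = (r * (qarc q (x / r), x / r).1, r * (qarc q (x / r), x / r).2).
  by rewrite /qarc_scaled /= mulrCA divff ?gt_eqF// mulr1.
rewrite lnormZ ?(ltW r0)// lnorm_qarc ?mulr1//.
by rewrite normrM normfV (gtr0_norm r0) ler_pdivrMr// mul1r.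
Qed.

(* The derivative of [iso_calibration e s r x0] along a horizontal curve is
   [e (x - x0) u2 - s qarc_scaled r (x - x0) u1], a covector of norm at most r as
   long as the curve stays in the strip. *)
Definition iso_calibration (e s r x0 : R) (h : heis R) : R :=
  e * (h.2 + h.1.1 * h.1.2 / 2 - x0 * h.1.2) - s * qint_scaled r (h.1.1 - x0).

Definition iso_X (s r x0 : R) (h : heis R) : R := - (s * qarc_scaled r (h.1.1 - x0)).
Definition iso_Y (e x0 : R) (h : heis R) : R := e * (h.1.1 - x0).

Lemma qint_scaled_lipschitz (r x y : R) : 0 <= r ->
  `|qint_scaled r x - qint_scaled r y| <= r * `|x - y|.
Proof.
move=> r0; have [c _ ->] := MVT_between y x (isd_qint_scaled r).
rewrite normrM ler_wpM2r// /qarc_scaled normrM (ger0_norm r0).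
by rewrite -[leRHS]mulr1 ler_wpM2l// ger0_norm ?qarc_ge0// qarc_le1.
Qed.

Lemma iso_calibrationP (e s r x0 : R) : 0 <= r -> `|s| = 1 -> `|e| = 1 ->
  calibration (iso_calibration e s r x0) (iso_X s r x0) (iso_Y e x0).
Proof.
move=> r0 s1 e1; split; last first.
  move=> g t u1 u2 /hvelocityP[d1 d2 d3].
  have dx : isd (fun t => (g t).1.1 - x0) t u1.
    by apply: isd_eq (isdB d1 (isd_cst x0 t)) _; rewrite subr0.
  have E := isdB (isdZ e (isdB (isdD d3 (isdZ 2^-1 (isdM d1 d2))) (isdZ x0 d2)))
    (isdZ s (isd_comp (isd_qint_scaled r _) dx)).
  apply: isd_ext (isd_eq E _) _; last first.
    by move=> y; rewrite /iso_calibration; field.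
  by rewrite /iso_X /iso_Y; field.
move=> M; exists (1 + `|M| + `|x0| + r).
  by rewrite !addr_ge0.
move=> h k hM kM; set D := `|h - k|.
have D0 : 0 <= D by exact: normr_ge0.
have := lexx D; rewrite {1}/D heis_norm_le /= => /and3P[h1 h2 h3].
have MM : M <= `|M| by exact: ler_norm.
have := hM; have := kM; rewrite !heis_norm_le => /and3P[k4 k5 k6] /and3P[h4 h5 h6].
rewrite (_ : _ - _ = e * ((h.2 - k.2) + 2^-1 * (h.1.1 * (h.1.2 - k.1.2))
    + 2^-1 * (k.1.2 * (h.1.1 - k.1.1)) - x0 * (h.1.2 - k.1.2))
    - s * (qint_scaled r (h.1.1 - x0) - qint_scaled r (k.1.1 - x0))); last first.
  by rewrite /iso_calibration; field.
apply: (le_trans (ler_normB _ _)); rewrite !normrM e1 s1 !mul1r.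
have b1 : `|qint_scaled r (h.1.1 - x0) - qint_scaled r (k.1.1 - x0)| <= r * D.
  apply: (le_trans (qint_scaled_lipschitz _ _ r0)).
  by rewrite ler_wpM2l// opprB addrA subrK.
have n1 : `|2^-1 * (h.1.1 * (h.1.2 - k.1.2))| <= 2^-1 * (`|M| * D).
  rewrite normrM ger0_norm// ler_wpM2l// normrM ler_pM//; exact: le_trans MM.
have n2 : `|2^-1 * (k.1.2 * (h.1.1 - k.1.1))| <= 2^-1 * (`|M| * D).
  rewrite normrM ger0_norm// ler_wpM2l// normrM ler_pM//; exact: le_trans MM.
have n3 : `|x0 * (h.1.2 - k.1.2)| <= `|x0| * D.
  by rewrite normrM ler_wpM2l.
have t1 := ler_normB (h.2 - k.2 + 2^-1 * (h.1.1 * (h.1.2 - k.1.2))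
  + 2^-1 * (k.1.2 * (h.1.1 - k.1.1))) (x0 * (h.1.2 - k.1.2)).
have t2 := ler_normD (h.2 - k.2 + 2^-1 * (h.1.1 * (h.1.2 - k.1.2)))
  (2^-1 * (k.1.2 * (h.1.1 - k.1.1))).
have t3 := ler_normD (h.2 - k.2) (2^-1 * (h.1.1 * (h.1.2 - k.1.2))).
rewrite mulrDl mulrDl mulrDl mul1r; lra.
Qed.

Lemma iso_increment (a b e s r x0 : R) g l (t1 t2 : R) :
  calibrated q a b g l -> `|s| = 1 -> `|e| = 1 ->
  (forall t, a <= t <= b -> `|(g t).1.1 - x0| <= r) ->
  a <= t1 -> t1 <= t2 -> t2 <= b ->
  iso_calibration e s r x0 (g t2) - iso_calibration e s r x0 (g t1) <= r * (l t2 - l t1).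
Proof.
move=> [ab _ _ H] s1 e1 strip at1 t12 t2b.
have r0 : 0 <= r by apply: le_trans (strip a _); rewrite ?normr_ge0// lexx.
apply: (H _ _ _ r t1 t2 (iso_calibrationP x0 r0 s1 e1) at1 t12 t2b) => x /andP[h1 h2].
apply: lnorm_qarc_scaled => //; apply: strip; apply/andP; split; lra.
Qed.

Definition iso_equality (g : R -> heis R) l (e s r x0 t1 t2 : R) : Prop :=
  forall u v, t1 <= u -> u <= v -> v <= t2 ->
  iso_calibration e s r x0 (g v) - iso_calibration e s r x0 (g u) = r * (l v - l u).

(* Schmidt's argument: the curve is compared with the isoperimetric ball of the
   same width, whose two halves calibrate the two arcs between the extremal
   abscissae. *)
Lemma schmidt_inequality (a b e : R) g l : calibrated q a b g l -> `|e| = 1 ->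
  (g a).1 = (g b).1 ->
  exists r x0, [/\ 0 <= r, forall t, a <= t <= b -> `|(g t).1.1 - x0| <= r, e * ((g b).2 - (g a).2) + 2 * qprim q 1 * r ^+ 2 <= r * (l b - l a)
    & e * ((g b).2 - (g a).2) + 2 * qprim q 1 * r ^+ 2 = r * (l b - l a) ->
      forall c d, a <= c -> c < d -> d <= b -> exists s c' d',
        [/\ `|s| = 1, c <= c', c' < d', d' <= d & iso_equality g l e s r x0 c' d']].
Proof.
move=> cal e1 gab; case: (cal) => ab [[tM Mab HM] [tm mab Hm]] _ _.
(* Half the width of the curve and the abscissa of its middle. *)
pose r := ((g tM).1.1 - (g tm).1.1) / 2; pose x0 := ((g tM).1.1 + (g tm).1.1) / 2.
have strip t : a <= t <= b -> `|(g t).1.1 - x0| <= r.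
  move=> tab; have := HM t tab; have := Hm t tab => h1 h2.
  by rewrite ler_norml /r /x0; apply/andP; split; lra.
have r0 : 0 <= r.
  by apply: le_trans (strip a _); rewrite ?normr_ge0// lexx.
have [F1 F2] : (g tM).1.1 - x0 = r /\ (g tm).1.1 - x0 = - r.
  by rewrite /r /x0; split; lra.
have Fr := qint_scaledN r0.
have xab : (g a).1.1 = (g b).1.1 by rewrite gab.
have yab : (g a).1.2 = (g b).1.2 by rewrite gab.
exists r, x0.
pose t1 := Num.min tm tM; pose t2 := Num.max tm tM.
(* The curve crosses the strip between [t1] and [t2] and returns outside, through the common
   endpoint of its projection. With opposite signs on the two passes, each of them gains the area of
   a half ball. *)
pose s : R := if tm <= tM then 1 else -1.
have s1 : `|s| = 1 by rewrite /s; case: ifP => _; rewrite ?normrN normr1.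
have sN1 : `|- s| = 1 by rewrite normrN.
have at1 : a <= t1.
  by rewrite le_min; case/andP: Mab => -> _; case/andP: mab => -> _.
have t2b : t2 <= b.
  by rewrite ge_max; case/andP: Mab => _ ->; case/andP: mab => _ ->.
have t12 : t1 <= t2 by rewrite ge_min le_max lexx.
have Fs : s * (qint_scaled r ((g t2).1.1 - x0) - qint_scaled r ((g t1).1.1 - x0)) =
    qprim q 1 * r ^+ 2.
  rewrite /s /t1 /t2; case: (leP tm tM) => h; rewrite F1 F2; lra.
have inc sg u v : `|sg| = 1 -> a <= u -> u <= v -> v <= b ->
    iso_calibration e sg r x0 (g v) - iso_calibration e sg r x0 (g u) <= r * (l v - l u).
  by move=> sg1 au uv vb; exact: (iso_increment cal sg1 e1 strip au uv vb).
have t1b : t1 <= b by exact: le_trans t2b.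
have at2 : a <= t2 by exact: le_trans t12.
have i1 := inc s a t1 s1 (lexx a) at1 t1b.
have i2 := inc (- s) t1 t2 sN1 at1 t12 t2b.
have i3 := inc s t2 b s1 at2 t2b (lexx b).
(* The projection is closed, so the terms at a and b cancel; beside the height there remain two half
   balls of radius r. *)
have total : (iso_calibration e s r x0 (g t1) - iso_calibration e s r x0 (g a)) +
    (iso_calibration e (- s) r x0 (g t2) - iso_calibration e (- s) r x0 (g t1)) +
    (iso_calibration e s r x0 (g b) - iso_calibration e s r x0 (g t2)) =
    e * ((g b).2 - (g a).2) + 2 * qprim q 1 * r ^+ 2.
  have -> : 2 * qprim q 1 * r ^+ 2 = 2 * (qprim q 1 * r ^+ 2) by ring.
  by rewrite -Fs /iso_calibration xab yab; ring.
split; [exact: r0|exact: strip|by rewrite -total; lra|rewrite -total => eq].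
(* Inequalities that add up to an equality are equalities, so equality passes to every subinterval
   of a piece. *)
have sub sg u v : `|sg| = 1 -> a <= u -> u <= v -> v <= b ->
    iso_calibration e sg r x0 (g v) - iso_calibration e sg r x0 (g u) = r * (l v - l u) ->
    iso_equality g l e sg r x0 u v.
  move=> sg1 au uv vb E u' v' uu' uv' vv'.
  have au' := le_trans au uu'; have v'b := le_trans vv' vb.
  have j1 := inc sg u u' sg1 au uu' (le_trans uv' v'b).
  have j2 := inc sg u' v' sg1 au' uv' v'b.
  have j3 := inc sg v' v sg1 (le_trans au' uv') vv' vb.
  lra.
have e1' : iso_equality g l e s r x0 a t1 by apply: sub => //; lra.
have e2' : iso_equality g l e (- s) r x0 t1 t2 by apply: sub => //; lra.
have e3' : iso_equality g l e s r x0 t2 b by apply: sub => //; lra.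
(* Every nondegenerate interval meets one of the three pieces in a nondegenerate interval, on which
   a single half of the ball calibrates. *)
move=> c d ac cd db.
have mono sg u v c' d' : u <= c' -> d' <= v ->
    iso_equality g l e sg r x0 u v -> iso_equality g l e sg r x0 c' d'.
  by move=> h1 h2 E u' v' h3 h4 h5; apply: E => //; [exact: le_trans h3|exact: le_trans h2].
have [ct1|t1c] := ltP c t1.
  exists s, c, (Num.min d t1); split => //; first by rewrite lt_min cd ct1.
    by rewrite ge_min lexx.
  by apply: mono e1' => //; rewrite ge_min lexx orbT.
have [ct2|t2c] := ltP c t2.
  exists (- s), c, (Num.min d t2); split => //; first by rewrite lt_min cd ct2.
    by rewrite ge_min lexx.
  by apply: mono e2' => //; rewrite ge_min lexx orbT.
exists s, c, d; split => //; apply: mono e3' => //.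
Qed.

End isoperimetric_calibrations.

(** * Exponential curves: velocity, length and period *)

Section exponential_curves.
Context (R : realType) (p q : R) (p1 : 1 < p) (pq : p^-1 + q^-1 = 1).
Let q1 : 1 < q := conjugate_gt1 p1 pq.
Local Notation H := (qprim q 1).
Let H0 : 0 < H. Proof. exact: qprim1_gt0. Qed.
Local Notation C := (qcos q).
Local Notation S := (qsin q).

Lemma qcos_dualE t : qcos_dual q t = spow q (C t).
Proof. by rewrite spowE. Qed.

Lemma qsin_dualE t : qsin_dual q t = spow q (S t).
Proof. by rewrite spowE. Qed.

Lemma exp_curve_line r th t : exp_curve q r th 0 t =
  ((r * t * spow q (C th), r * t * spow q (S th)), 0).
Proof. by rewrite /exp_curve eqxx qcos_dualE qsin_dualE. Qed.

Lemma exp_curve_circle r th w t : w != 0 -> exp_curve q r th w t =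
  ((r / w * (S (w * t + th) - S th), - (r / w * (C (w * t + th) - C th))),
   r ^+ 2 / (2 * w ^+ 2) * (w * t + C (w * t + th) * S th - S (w * t + th) * C th)).
Proof. by rewrite /exp_curve => /negbTE ->. Qed.

Lemma exp_curve0 r th w : exp_curve q r th w 0 = ((0, 0), 0).
Proof.
have [->|w0] := eqVneq w 0; first by rewrite exp_curve_line mulr0 !mul0r.
rewrite exp_curve_circle// mulr0 !add0r !subrr mulr0 oppr0.
by congr (_, _); ring.
Qed.

Lemma exp_curve_scale r th w t : exp_curve q r th w t = exp_curve q (r * t) th (w * t) 1.
Proof.
have [->|t0] := eqVneq t 0.
  by rewrite exp_curve0 !mulr0 exp_curve_line !mul0r.
have [->|w0] := eqVneq w 0; first by rewrite mul0r !exp_curve_line mulr1.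
have wt0 : w * t != 0 by rewrite mulf_neq0.
rewrite !exp_curve_circle// mulr1.
have -> : r * t / (w * t) = r / w by field; rewrite t0 w0.
by congr (_, _); congr (_ * _); field; rewrite t0 w0.
Qed.

Lemma exp_curve_r0 th w t : exp_curve q 0 th w t = ((0, 0), 0).
Proof.
rewrite exp_curve_scale mul0r; have [->|w0] := eqVneq (w * t) 0.
  by rewrite exp_curve_line !mul0r.
by rewrite exp_curve_circle//; congr ((_, _), _); ring.
Qed.

(** The controls are r times the dual vector at the running angle, of p-norm 1, whence the constant
    speed r. The shift [c] lets the arc start where another curve ends. *)
Lemma exp_curve_hvelocity (r th w c t : R) :
  hvelocity (fun t => exp_curve q r th w (t - c)) t
    (r * spow q (C (w * (t - c) + th))) (r * spow q (S (w * (t - c) + th))).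
Proof.
have sh : isd (fun t : R => t - c) t 1.
  by apply: isd_eq (isdB (isd_id t) (isd_cst c t)) _; rewrite subr0.
apply/hvelocityP; have [->|w0] := eqVneq w 0.
  rewrite exp_curve_line /= mul0r add0r; split.
  - apply: isd_ext (isd_eq (isdZ (r * spow q (C th)) sh) _) _; first by rewrite mulr1.
    by move=> s /=; rewrite exp_curve_line /=; ring.
  - apply: isd_ext (isd_eq (isdZ (r * spow q (S th)) sh) _) _; first by rewrite mulr1.
    by move=> s /=; rewrite exp_curve_line /=; ring.
  - apply: isd_ext (isd_eq (isd_cst 0 t) _) _; first by ring.
    by move=> s /=; rewrite exp_curve_line.
have b : isd (fun t : R => w * (t - c) + th) t w.
  by apply: isd_eq (isdD (isdZ w sh) (isd_cst th t)) _; rewrite mulr1 addr0.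
have dS := @isd_comp _ S (fun t => w * (t - c) + th) t _ _ (isd_qsin p1 pq _) b.
have dC := @isd_comp _ C (fun t => w * (t - c) + th) t _ _ (isd_qcos p1 pq _) b.
split.
- apply: isd_ext (isd_eq (isdZ (r / w) (isdB dS (isd_cst (S th) t))) _) _.
    by field.
  by move=> s /=; rewrite exp_curve_circle.
- apply: isd_ext (isd_eq (isdN (isdZ (r / w) (isdB dC (isd_cst (C th) t)))) _) _.
    by field.
  by move=> s /=; rewrite exp_curve_circle.
- have E := isdZ (r ^+ 2 / (2 * w ^+ 2)) (isdB (isdD (isdZ w sh)
    (isdM dC (isd_cst (S th) t))) (isdM dS (isd_cst (C th) t))).
  apply: isd_ext (isd_eq E _) _; last first.
    by move=> s /=; rewrite exp_curve_circle.
  rewrite exp_curve_circle//=.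
  have := qtrig_dual p1 pq (w * (t - c) + th).
  set c' := C (w * (t - c) + th); set s' := S (w * (t - c) + th) => E1.
  have -> : r / w * (s' - S th) * (r * spow q s') - - (r / w * (c' - C th)) * (r * spow q c')
     = r ^+ 2 / w * ((c' * spow q c' + s' * spow q s') - S th * spow q s' - C th * spow q c').
    by field.
  by rewrite E1; field.
Qed.

Lemma exp_control_continuous (r th w c : R) :
  continuous (fun t : R => r * spow q (C (w * (t - c) + th))) /\
  continuous (fun t : R => r * spow q (S (w * (t - c) + th))).
Proof.
have b : continuous (fun t : R => w * (t - c) + th).
  move=> t; have sh : isd (fun t : R => t - c) t (1 - 0) := isdB (isd_id t) (isd_cst c t).
  exact: isd_continuous (isdD (isdZ w sh) (isd_cst th t)).
split=> t.
  apply: (@continuousM _ _ (fun=> r) (fun t => spow q (C (w * (t - c) + th)))).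
    exact: cst_continuous.
  apply: (@continuous_comp _ _ _ (fun t : R => w * (t - c) + th) (fun t => spow q (C t))).
    exact: b.
  exact: (spow_qcos_continuous p1 pq).
apply: (@continuousM _ _ (fun=> r) (fun t => spow q (S (w * (t - c) + th)))).
  exact: cst_continuous.
apply: (@continuous_comp _ _ _ (fun t : R => w * (t - c) + th) (fun t => spow q (S t))).
  exact: b.
exact: (spow_qsin_continuous p1 pq).
Qed.

Lemma C1_lipschitz (f df : R -> R) (a b : R) : (forall t : R, isd f t (df t)) ->
  continuous df -> exists2 L, 0 <= L & forall s t, a <= s -> s <= t -> t <= b ->
    `|f t - f s| <= L * (t - s).
Proof.
move=> fd cdf.
have /compact_bounded[M [_ HM]] :=
  continuous_compact (continuous_subspaceT cdf) (@segment_compact _ a b).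
exists (`|M| + 1); first by rewrite addr_ge0.
move=> s t a_s st tb; have [c /andP[sc ct] ->] := MVT_global st fd.
rewrite normrM (ger0_norm (_ : 0 <= t - s)) ?subr_ge0// ler_wpM2r ?subr_ge0//.
apply: HM; first by rewrite (le_lt_trans (ler_norm _))// ltrDl.
by exists c => //; rewrite /= in_itv/=; apply/andP; split; lra.
Qed.

Lemma C1_abs_continuous (g : R -> heis R) (d1 d2 d3 : R -> R) (a b : R) :
  (forall t : R, [/\ isd (fun s => (g s).1.1) t (d1 t), isd (fun s => (g s).1.2) t (d2 t) &
     isd (fun s => (g s).2) t (d3 t)]) ->
  continuous d1 -> continuous d2 -> continuous d3 -> abs_continuous a b g.
Proof.
move=> gd c1 c2 c3.
have g1 (t : R) : isd (fun s => (g s).1.1) t (d1 t) by case: (gd t).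
have g2 (t : R) : isd (fun s => (g s).1.2) t (d2 t) by case: (gd t).
have g3 (t : R) : isd (fun s => (g s).2) t (d3 t) by case: (gd t).
have [L1 L10 H1] := C1_lipschitz a b g1 c1.
have [L2 L20 H2] := C1_lipschitz a b g2 c2.
have [L3 L30 H3] := C1_lipschitz a b g3 c3.
pose L := L1 + L2 + L3 + 1; have L0 : 0 < L by rewrite /L; lra.
move=> e e0; exists (e / L); first exact: divr_gt0.
move=> n s t st _ sm; apply: (@le_lt_trans _ _ (L * \sum_(i < n) (t i - s i))); last first.
  by rewrite mulrC -ltr_pdivlMr.
rewrite mulr_sumr; apply: ler_sum => i _; have [h1 [h2 h3]] := st i.
have ts : 0 <= t i - s i by rewrite subr_ge0.
have m1 : 0 <= L1 * (t i - s i) by exact: mulr_ge0.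
have m2 : 0 <= L2 * (t i - s i) by exact: mulr_ge0.
have m3 : 0 <= L3 * (t i - s i) by exact: mulr_ge0.
have k1 := H1 _ _ h1 h2 h3; have k2 := H2 _ _ h1 h2 h3; have k3 := H3 _ _ h1 h2 h3.
rewrite heis_norm_le /= /L !mulrDl mul1r; apply/and3P; split; lra.
Qed.

Lemma exp_horizontal (r th w c a b : R) : a <= b -> 0 <= r ->
  let u1 t := r * spow q (C (w * (t - c) + th)) in
  let u2 t := r * spow q (S (w * (t - c) + th)) in
  horizontal a b (fun t => exp_curve q r th w (t - c)) u1 u2 /\
  forall t, lnorm p (u1 t, u2 t) = r.
Proof.
move=> ab r0 u1 u2; have [c1 c2] := exp_control_continuous r th w c.
split; last first.
  move=> t; have := lnormZ (spow q (C (w * (t - c) + th)), spow q (S (w * (t - c) + th)))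
     (lt_trans ltr01 p1) r0.
  by rewrite (lnorm_dual p1 pq) mulr1.
have hv t := exp_curve_hvelocity r th w c t.
split => //.
- have cont1 : continuous (fun t => (exp_curve q r th w (t - c)).1.1).
    by move=> t; have /hvelocityP[d _ _] := hv t; exact: isd_continuous d.
  have cont2 : continuous (fun t => (exp_curve q r th w (t - c)).1.2).
    by move=> t; have /hvelocityP[_ d _] := hv t; exact: isd_continuous d.
  apply: (@C1_abs_continuous _ u1 u2 (fun t => ((exp_curve q r th w (t - c)).1.1 * u2 t -
      (exp_curve q r th w (t - c)).1.2 * u1 t) / 2)) => //.
    by move=> t; exact/hvelocityP/hv.
  move=> t; apply: (@continuousM _ _ (fun t => (exp_curve q r th w (t - c)).1.1 * u2 t -
      (exp_curve q r th w (t - c)).1.2 * u1 t) (fun=> 2^-1)); last exact: cst_continuous.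
  apply: (@continuousB _ _ _ (fun t => (exp_curve q r th w (t - c)).1.1 * u2 t)
     (fun t => (exp_curve q r th w (t - c)).1.2 * u1 t)).
    by apply: (@continuousM _ _ _ u2); [exact: cont1|exact: c2].
  by apply: (@continuousM _ _ _ u1); [exact: cont2|exact: c1].
- by apply: measurable_funTS; exact: continuous_measurable_fun.
- by apply: measurable_funTS; exact: continuous_measurable_fun.
- by apply/nearW => t _; exact: hv.
Qed.

Lemma exp_hlength (r th w c a b : R) : a <= b -> 0 <= r ->
  hlength p a b (fun t => r * spow q (C (w * (t - c) + th)))
    (fun t => r * spow q (S (w * (t - c) + th))) = (r * (b - a))%:E.
Proof.
move=> ab r0; have [_ Hl] := exp_horizontal th w c ab r0.
rewrite /hlength (eq_integral (cst r%:E)); last first.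
  by move=> t _; rewrite Hl.
rewrite integral_cst//= lebesgue_measure_itv/= lte_fin; case: ltP => h.
  by rewrite -EFinD -EFinM.
have -> : b - a = 0 by lra.
by rewrite mule0 mulr0.
Qed.

Lemma exp_calibrated (r th w c a b : R) : a <= b -> 0 <= r ->
  calibrated q a b (fun t => exp_curve q r th w (t - c)) (fun t => r * (t - a)).
Proof.
move=> ab r0; have [hor Hl] := exp_horizontal th w c ab r0.
pose u1 t := r * spow q (C (w * (t - c) + th)).
pose u2 t := r * spow q (S (w * (t - c) + th)).
have fin : (hlength p a b u1 u2 < +oo)%E by rewrite exp_hlength// ltry.
have [_ ex ey Hc] := horizontal_calibrated p1 pq hor fin.
split; [exact: ab|exact: ex|exact: ey|].
move=> Psi pX pY rho s t cal a_s st tb Hrho.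
have := Hc Psi pX pY rho s t cal a_s st tb Hrho.
have arc x : a <= x -> arclength p a u1 u2 x = r * (x - a).
  move=> ax; rewrite /arclength /Rintegral.
  by have := @exp_hlength r th w c a x ax r0; rewrite /hlength => ->.
by rewrite !arc//; exact: (le_trans a_s st).
Qed.

(** After a full turn the projection closes up, and the height is the signed area
    [qpi q * (r / |w|) ^+ 2] enclosed by the circle. *)
Lemma exp_curve_periodic (r th w : R) : w != 0 ->
  exp_curve q r th w (4 * H / `|w|) =
  ((0, 0), Num.sg w * (2 * H * (r / `|w|) ^+ 2)).
Proof.
move=> w0; rewrite exp_curve_circle//.
have nw0 : `|w| != 0 by rewrite normr_eq0.
have -> : w * (4 * H / `|w|) = Num.sg w * (4 * H).
  by rewrite {1}[w]numEsg; field.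
have [cE sE] : C (Num.sg w * (4 * H) + th) = C th /\ S (Num.sg w * (4 * H) + th) = S th.
  have [ltw|gtw|eqw] := ltgtP w 0; last by rewrite eqw eqxx in w0.
    rewrite ltr0_sg// mulN1r; have := qtrig_periodic p1 pq (- (4 * H) + th).
    by rewrite addrAC addNr add0r => -[-> ->].
  rewrite gtr0_sg// mul1r addrC; exact: (qtrig_periodic p1 pq).
rewrite cE sE !subrr !mulr0 oppr0; congr (_, _).
have -> : w ^+ 2 = `|w| ^+ 2 by rewrite real_normK// num_real.
by field.
Qed.

End exponential_curves.

(** * Minimality of exponential arcs and the equality case *)

Section minimality.
Context (R : realType) (p q : R) (p1 : 1 < p) (pq : p^-1 + q^-1 = 1).
Let q1 : 1 < q := conjugate_gt1 p1 pq.
Let q0 : 0 < q. Proof. by rewrite (lt_trans _ q1). Qed.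
Local Notation H := (qprim q 1).
Let H0 : 0 < H. Proof. exact: qprim1_gt0. Qed.
Local Notation C := (qcos q).
Local Notation S := (qsin q).
Local Notation ex := (exp_curve q).

Lemma linear_calibration (th : R) :
  calibration (fun h : heis R => C th * h.1.1 + S th * h.1.2) (fun=> C th) (fun=> S th).
Proof.
split.
  move=> M; exists (`|C th| + `|S th|); first by rewrite addr_ge0.
  move=> h k _ _; set D := `|h - k|.
  have := lexx D; rewrite {1}/D heis_norm_le /= => /and3P[h1 h2 h3].
  rewrite (_ : _ - _ = C th * (h.1.1 - k.1.1) + S th * (h.1.2 - k.1.2)); last by ring.
  apply: (le_trans (ler_normD _ _)); rewrite !normrM mulrDl.
  by apply: lerD; rewrite ler_wpM2l.
move=> g t u1 u2 /hvelocityP[d1 d2 _].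
by apply: isd_eq (isdD (isdZ (C th) d1) (isdZ (S th) d2)) _; ring.
Qed.

Lemma linear_increment a b g l th s t : calibrated q a b g l -> a <= s -> s <= t -> t <= b ->
  C th * (g t).1.1 + S th * (g t).1.2 - (C th * (g s).1.1 + S th * (g s).1.2) <= l t - l s.
Proof.
move=> [_ _ _ Hc] a_s st tb; rewrite -[leRHS]mul1r.
apply: (Hc _ _ _ 1 s t (linear_calibration th) a_s st tb) => x _.
by rewrite (lnorm_qpoint p1 pq).
Qed.

(* Runs along the circle past its time 1, which is shifted to b. *)
Definition completion (r th w b : R) (t : R) : heis R := ex r th w (t - (b - 1)).

Lemma completion_calibrated (r th w a b : R) g l : calibrated q a b g l ->
  g b = ex r th w 1 -> 0 < r -> w != 0 -> `|w| <= 4 * H ->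
  calibrated q a (b + (4 * H / `|w| - 1)) (glue b g (completion r th w b))
    (glue b l (fun t => r * (t - b) - r * (b - b) + l b)).
Proof.
move=> cal gb r0 w0 w4; apply: glue_calibrated cal _ _.
  apply: (exp_calibrated p1 pq th w (b - 1)); last exact: ltW.
  have : 1 <= 4 * H / `|w| by rewrite ler_pdivlMr ?mul1r// normr_gt0.
  lra.
by rewrite gb /completion; congr (exp_curve q r th w); lra.
Qed.

(** Completing the square: with m = r / |w|, m^2 + rho^2 = 2 m rho + (m - rho)^2. The product term
    is the length of the circle of radius m, and the square will force rho = m in the equality case.
    The enclosed area excludes rho = 0. *)
Lemma schmidt_circle (A B r w rho : R) : 0 < r -> w != 0 -> 0 <= rho ->
  Num.sg w * (Num.sg w * (2 * H * (r / `|w|) ^+ 2)) + 2 * H * rho ^+ 2 <= rho * (B - A) ->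
  0 < rho /\ r * (4 * H / `|w|) + 2 * H * (r / `|w| - rho) ^+ 2 / rho <= B - A.
Proof.
move=> r0 w0; have nw : 0 < `|w| by rewrite normr_gt0.
rewrite mulrA -expr2 sqr_sg w0 mul1r.
set m := r / `|w|; have m0 : 0 < m by exact: divr_gt0.
have mH : 0 < 2 * H * m ^+ 2.
  by apply: mulr_gt0; [apply: mulr_gt0; [by []|exact: H0]|exact: exprn_gt0].
rewrite le_eqVlt => /predU1P[<-|rho0] h.
  exfalso; suff : 2 * H * m ^+ 2 <= 0 by rewrite leNgt mH.
  by move: h; rewrite mul0r expr0n mulr0 addr0.
split => //; rewrite -(ler_pM2l rho0); apply: le_trans h.
rewrite le_eqVlt; apply/orP; left; apply/eqP.
by rewrite /m; field; rewrite !gt_eqF.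
Qed.

Lemma minimal_length (a b r th w : R) g l : calibrated q a b g l ->
  g a = ((0, 0), 0) -> g b = ex r th w 1 -> 0 < r -> `|w| <= 4 * H -> r <= l b - l a.
Proof.
move=> cal ga gb r0 w4; case: (cal) => ab _ _ _.
have [w0|w0] := eqVneq w 0.
  have := linear_increment th cal (lexx a) ab (lexx b).
  rewrite ga gb w0 exp_curve_line /= !mulr0 addr0 subr0 mulr1.
  have := qtrig_dual p1 pq th => E h; apply: le_trans h.
  rewrite (_ : C th * (r * spow q (C th)) + S th * (r * spow q (S th)) =
    r * (C th * spow q (C th) + S th * spow q (S th))); last by ring.
  by rewrite E mulr1.
have cal' := completion_calibrated cal gb r0 w0 w4.
(* The time of a full turn: the completion lasts T - 1 and adds the length r (T - 1). *)
set T := 4 * H / `|w| in cal'.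
have T1 : 1 <= T by rewrite ler_pdivlMr ?mul1r// normr_gt0.
have e1 : `|Num.sg w| = 1 by rewrite normr_sg w0.
have ga' : glue b g (completion r th w b) a = ((0, 0), 0) by rewrite /glue ab.
have gb' : glue b g (completion r th w b) (b + (T - 1)) =
    ((0, 0), Num.sg w * (2 * H * (r / `|w|) ^+ 2)).
  (* For |w| = 4 H the completion is empty, and the glued curve ends with g itself. *)
  rewrite /glue; case: ifPn => h.
    have E : T = 1 by lra.
    rewrite (_ : b + (T - 1) = b); last by lra.
    have := exp_curve_periodic p1 pq r th w0; rewrite -/T E => <-; exact: gb.
  rewrite /completion (_ : b + (T - 1) - (b - 1) = T); last by ring.
  exact: (exp_curve_periodic p1 pq).
have [|rho [x0 [rho0 _ + _]]] := schmidt_inequality q1 cal' e1.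
  by rewrite ga' gb'.
rewrite ga' gb' /= subr0 => /(schmidt_circle r0 w0 rho0)[rho1].
have la : glue b l (fun t => r * (t - b) - r * (b - b) + l b) a = l a.
  by rewrite /glue ab.
have lb : glue b l (fun t => r * (t - b) - r * (b - b) + l b) (b + (T - 1)) =
    r * (T - 1) + l b.
  rewrite /glue; case: ifPn => h; last by ring.
  have -> : T = 1 by lra.
  by rewrite subrr addr0 mulr0 add0r.
rewrite la lb -/T => h.
have : 0 <= 2 * H * (r / `|w| - rho) ^+ 2 / rho.
  by rewrite divr_ge0 ?(ltW rho1)// mulr_ge0 ?sqr_ge0// mulr_ge0// ltW.
lra.
Qed.

(** Differentiating the equality at t yields equality in Hoelder's inequality between the velocity
    and the gradient of the calibration; [hoelder_dual_eq] then gives the gradient, whose second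
    component is the conclusion. The curve [c] stands for g where a derivative is needed. *)
Lemma iso_equality_piece (g c : R -> heis R) (l : R -> R) (e s rho x0 c1 d1 r : R) (t tau : R) :
  `|e| = 1 -> `|s| = 1 -> 0 < rho -> 0 < r ->
  iso_equality q g l e s rho x0 c1 d1 ->
  (forall u, c1 <= u <= d1 -> g u = c u) ->
  (forall u v, c1 <= u -> u <= v -> v <= d1 -> l v - l u = r * (v - u)) ->
  c1 < t < d1 -> hvelocity c t (r * spow q (C tau)) (r * spow q (S tau)) ->
  `|(c t).1.1 - x0| <= rho ->
  e * ((c t).1.1 - x0) = rho * S tau.
Proof.
move=> e1 s1 rho0 r0 eqP_ gc lr /andP[ct td] hv strip.
have [_ dcal] := iso_calibrationP q1 x0 (ltW rho0) s1 e1.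
have D1 := dcal _ _ _ _ hv.
have D2 : isd (fun u => iso_calibration q e s rho x0 (c u)) t (rho * r).
  apply: (@isd_near _ (fun u => rho * r * (u - c1) + iso_calibration q e s rho x0 (c c1))).
    by apply: isd_eq (isdD (isdZ (rho * r) (isdB (isd_id t) (isd_cst c1 t))) (isd_cst _ t)) _; ring.
  near=> u.
  have cu : c1 <= u by apply: ltW; near: u; exact: lt_nbhsr.
  have ud : u <= d1 by apply: ltW; near: u; exact: lt_nbhsl.
  have := eqP_ c1 u (lexx _) cu ud; rewrite (lr c1 u)// !gc ?lexx ?cu ?(le_trans cu ud)//.
  by move=> E; rewrite -mulrA -E; ring.
have := isd_unique D1 D2; rewrite /iso_X /iso_Y => E.
have [] := @hoelder_dual_eq R p q p1 pq rho (- (s * qarc_scaled q rho ((c t).1.1 - x0)))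
  (e * ((c t).1.1 - x0)) tau rho0.
- exact: lnorm_qarc_scaled.
- by apply: (mulfI (lt0r_neq0 r0)); lra.
- by [].
Unshelve. all: by end_near. Qed.

(** On an interval of zeros the derivative would vanish too, hence also the sine, which the sphere
    forbids. *)
Lemma qcos_not_flat (w th c d : R) : w != 0 -> c < d ->
  exists2 t, c < t < d & C (w * t + th) != 0.
Proof.
move=> w0 cd; apply: contrapT => /forall2NP F.
have Z t : c < t < d -> C (w * t + th) = 0.
  by move=> tcd; have [//|/negP/negPn/eqP] := F t.
pose t := (c + d) / 2; have tcd : c < t < d by apply/andP; rewrite /t; split; lra.
have b : isd (fun t : R => w * t + th) t w.
  by apply: isd_eq (isdD (isdZ w (isd_id t)) (isd_cst th t)) _; rewrite mulr1 addr0.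
have D1 := @isd_comp _ C (fun t => w * t + th) t _ _ (isd_qcos p1 pq _) b.
have D2 : isd (fun t => C (w * t + th)) t 0.
  case/andP: tcd => h1 h2.
  apply: isd_near (isd_cst 0 t) _; near=> u; apply/esym/Z.
  apply/andP; split; near: u; [exact: lt_nbhsr|exact: lt_nbhsl].
have := isd_unique D1 D2 => /eqP; rewrite mulf_eq0 (negbTE w0) orbF oppr_eq0 spow_eq0 => /eqP S0.
have := qtrig_sphere p1 pq (w * t + th); rewrite S0 (Z t tcd) normr0 powR0 ?gt_eqF// addr0.
by move/eqP; rewrite eq_sym oner_eq0.
Unshelve. all: by end_near. Qed.

Lemma qsin_not_flat (w th c d : R) : w != 0 -> c < d ->
  exists2 t, c < t < d & S (w * t + th) != 0.
Proof.
move=> w0 cd; have [t tcd] := qcos_not_flat (th + H) w0 cd.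
by rewrite addrA qcosD// oppr_eq0 => h; exists t.
Qed.

Lemma swap_hvelocity g (t u1 u2 : R) : hvelocity g t u1 u2 ->
  hvelocity (@hswap R \o g) t u2 u1.
Proof.
move=> /hvelocityP[d1 d2 d3]; apply/hvelocityP; split => //=.
by apply: isd_eq (isdN d3) _; field.
Qed.

Lemma qpoint_swap t : exists t', C t' = S t /\ S t' = C t.
Proof.
have [|t' _ [h1 h2]] := @qpoint_surj _ p q p1 pq (S t) (C t).
  by rewrite addrC; exact: (qtrig_sphere p1 pq).
by exists t'.
Qed.

(* The conclusion of the isoperimetric equality case read on one coordinate: [K]
   is the sine for the first coordinate and the cosine for the second. *)
Lemma circle_matching (K dK : R -> R) (r0 w0 th0 r w th e x0 rho c d c' d' k0 s0 : R) :
  (forall t : R, isd K t (dK t)) ->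
  (forall v th c d, v != 0 -> c < d -> exists2 t, c < t < d & dK (v * t + th) != 0) ->
  0 < r -> w != 0 -> rho = r / `|w| -> `|e| = 1 -> e * w = `|w| ->
  c < d -> c' < d' -> 0 < r0 ->
  (forall t, c < t < d -> w0 != 0 ->
    e * (r0 / w0 * (K (w0 * (t - k0) + th0) - K th0)) - x0 = rho * K (w0 * (t - k0) + th0)) ->
  (forall t, c' < t < d' ->
    e * (r / w * (K (w * (t - s0) + th) - K th)) - x0 = rho * K (w * (t - s0) + th)) ->
  w0 != 0 -> w0 * r = w * r0 /\ K th0 = K th.
Proof.
move=> dK_ nf r_gt0 w_neq0 rhoE e1 ew cd cd' r0_gt0 P1 P2 w00.
have nw : 0 < `|w| by rewrite normr_gt0.
have e2 : e * e = 1.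
  have : `|e| ^+ 2 = 1 by rewrite e1 expr1n.
  by rewrite real_normK ?num_real// expr2.
have erw : e * (r / w) = rho.
  have -> : w = e * `|w| by rewrite -ew mulrA e2 mul1r.
  have e0 : e != 0 by rewrite -normr_eq0 e1 oner_eq0.
  by rewrite rhoE; field; rewrite e0 gt_eqF.
(* The final arc lies on the given circle and locates its centre. *)
have x0E : x0 = - rho * K th.
  pose t := (c' + d') / 2; have tcd : c' < t < d' by apply/andP; rewrite /t; split; lra.
  have := P2 t tcd; rewrite mulrA erw; lra.
(* If the radii differed, the equation [P1] would make [K] constant on an interval. *)
have kap : e * (r0 / w0) = rho.
  apply: contrapT => ne.
  have w0' : w0 != 0 := w00.
  have [t tcd nz] := nf w0 (th0 - w0 * k0) c d w0' cd.
  have b : isd (fun t : R => w0 * (t - k0) + th0) t w0.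
    by apply: isd_eq (isdD (isdZ w0 (isdB (isd_id t) (isd_cst k0 t))) (isd_cst th0 t)) _; ring.
  have D1 := isdZ (e * (r0 / w0) - rho) (@isd_comp _ K (fun t => w0 * (t - k0) + th0) t _ _ (dK_ _) b).
  have D2 : isd (fun t => (e * (r0 / w0) - rho) * K (w0 * (t - k0) + th0)) t 0.
    case/andP: tcd => h1 h2.
    apply: isd_near (isd_cst (x0 + e * (r0 / w0) * K th0) t) _.
    near=> u; have ucd : c < u < d.
      apply/andP; split; near: u; [exact: lt_nbhsr|exact: lt_nbhsl].
    have := P1 u ucd w00; lra.
  have := isd_unique D1 D2 => /eqP; rewrite !mulf_eq0 (negbTE w00) orbF subr_eq0.
  move=> /orP[/eqP//|/eqP Z]; move: nz.
  rewrite (_ : w0 * t + (th0 - w0 * k0) = w0 * (t - k0) + th0); last by ring.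
  by rewrite Z eqxx.
have rw : r0 / w0 = r / w.
  have e0 : e != 0 by rewrite -normr_eq0 e1 oner_eq0.
  by apply: (mulfI e0); rewrite kap erw.
split.
  have := congr1 (fun z => z * (w0 * w)) rw.
  rewrite (_ : r0 / w0 * (w0 * w) = w * r0); last by field.
  by rewrite (_ : r / w * (w0 * w) = w0 * r); [|field].
pose t := (c + d) / 2; have tcd : c < t < d by apply/andP; rewrite /t; split; lra.
have := P1 t tcd w00; rewrite mulrA kap x0E => E.
have rho0 : rho != 0 by rewrite rhoE mulf_neq0 ?gt_eqF// invr_gt0.
by apply: (mulfI rho0); lra.
Unshelve. all: by end_near. Qed.

(** A closed curve enclosing the area of the circle of radius r / |w| and no longer than that circle
    is an equality case of [schmidt_circle], so its half width is r / |w|, and then of Schmidt's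
    inequality. *)
Lemma closed_equality (A B r w e : R) G L : calibrated q A B G L ->
  (G A).1 = (G B).1 -> 0 < r -> w != 0 -> `|e| = 1 ->
  e * ((G B).2 - (G A).2) = 2 * H * (r / `|w|) ^+ 2 ->
  L B - L A <= r * (4 * H / `|w|) ->
  exists x0, (forall t, A <= t <= B -> `|(G t).1.1 - x0| <= r / `|w|) /\
    forall c d, A <= c -> c < d -> d <= B -> exists s c' d',
      [/\ `|s| = 1, c <= c', c' < d', d' <= d &
         iso_equality q G L e s (r / `|w|) x0 c' d'].
Proof.
move=> cal GAB r0 w0 e1 zE LE.
have [rho [x0 [rho0 strip hle heq]]] := schmidt_inequality q1 cal e1 GAB.
have sg1 : Num.sg w * Num.sg w = 1 by rewrite -expr2 sqr_sg w0.
have h' : Num.sg w * (Num.sg w * (2 * H * (r / `|w|) ^+ 2)) + 2 * H * rho ^+ 2 <= rho * (L B - L A).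
  by rewrite mulrA sg1 mul1r -zE.
have [rho1 h] := schmidt_circle r0 w0 rho0 h'.
have nw : 0 < `|w| by rewrite normr_gt0.
have sq0 : 2 * H * (r / `|w| - rho) ^+ 2 / rho <= 0 by lra.
have rhoE : rho = r / `|w|.
  apply/eqP; rewrite eq_sym -subr_eq0 -sqrf_eq0 eq_le sqr_ge0 andbT.
  have h2H : 0 < 2 * H by apply: mulr_gt0; [by []|exact: H0].
  have ri : 0 < rho^-1 by rewrite invr_gt0.
  by move: sq0; rewrite (pmulr_lle0 _ ri) (pmulr_rle0 _ h2H).
have sq1 : 0 <= 2 * H * (r / `|w| - rho) ^+ 2 / rho.
  by rewrite divr_ge0 ?(ltW rho1)// mulr_ge0 ?sqr_ge0// mulr_ge0// ltW.
have LE' : L B - L A = r * (4 * H / `|w|) by lra.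
exists x0; rewrite -rhoE; split => //; apply: heq.
rewrite zE LE' rhoE; field; rewrite gt_eqF//.
Qed.

(** One horizontal coordinate of a shortest closed curve that begins with an arc [c0] and ends with
    an arc [c1]: both arcs satisfy the equation of one circle. [K] and the sign [e'] are left
    abstract to cover both the abscissa and, after [hswap], the ordinate; [n0] is the component of
    the direction of [c0] when that arc is straight. *)
Lemma half_core (A a b B : R) G L (c0 c1 : R -> heis R) (K dK : R -> R)
    (e e' r r0 w w0 th th0 k0 s0 n0 : R) :
  calibrated q A B G L -> A < a -> a <= b -> b < B ->
  (G A).1 = (G B).1 -> 0 < r -> 0 < r0 -> w != 0 -> `|e| = 1 -> `|e'| = 1 -> e * w = `|w| ->
  e' * ((G B).2 - (G A).2) = 2 * H * (r / `|w|) ^+ 2 ->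
  L B - L A <= r * (4 * H / `|w|) ->
  (forall t, A <= t <= a -> G t = c0 t) -> (forall t, b <= t <= B -> G t = c1 t) ->
  (forall u v, A <= u -> u <= v -> v <= a -> L v - L u = r0 * (v - u)) ->
  (forall u v, b <= u -> u <= v -> v <= B -> L v - L u = r * (v - u)) ->
  (forall t, exists tau, hvelocity c0 t (r0 * spow q (C tau)) (r0 * spow q (S tau)) /\
     S tau = K (w0 * (t - k0) + th0)) ->
  (forall t, exists tau, hvelocity c1 t (r * spow q (C tau)) (r * spow q (S tau)) /\
     S tau = K (w * (t - s0) + th)) ->
  (w0 != 0 -> forall t, e' * (c0 t).1.1 = e * (r0 / w0 * (K (w0 * (t - k0) + th0) - K th0))) ->
  (w0 = 0 -> forall t, (c0 t).1.1 = r0 * (t - k0) * n0) ->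
  (forall t, e' * (c1 t).1.1 = e * (r / w * (K (w * (t - s0) + th) - K th))) ->
  (forall t : R, isd K t (dK t)) ->
  (forall v th c d, v != 0 -> c < d -> exists2 t, c < t < d & dK (v * t + th) != 0) ->
  (w0 != 0 -> w0 * r = w * r0 /\ K th0 = K th) /\ (w0 = 0 -> n0 = 0).
Proof.
move=> cal Aa ab bB GAB r_gt0 r0_gt0 w_neq0 e1 e1' ew zE LE Gc0 Gc1 L0 L1 v0 v1 x0E x0E' x1E dK_ nf.
have [x0 [strip eqs]] := closed_equality cal GAB r_gt0 w_neq0 e1' zE LE.
have nw : 0 < `|w| by rewrite normr_gt0.
have m0 : 0 < r / `|w| by exact: divr_gt0.
have e'0 : e' != 0 by rewrite -normr_eq0 e1' oner_eq0.
have [s [c [d [s1 Ac cd da E1]]]] := eqs A a (lexx A) Aa (le_trans ab (ltW bB)).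
have [s' [c' [d' [s1' bc' cd' dB' E2]]]] := eqs b B (le_trans (ltW Aa) ab) bB (lexx B).
have P1 t : c < t < d -> e' * ((c0 t).1.1 - x0) = r / `|w| * K (w0 * (t - k0) + th0).
  move=> tcd; have [tau [hv <-]] := v0 t.
  have tA : A <= t <= B by case/andP: tcd => h1 h2; apply/andP; split; clear -q1 q0 H0 Ac da Aa ab bB h1 h2; lra.
  have ta : A <= t <= a by case/andP: tcd => h1 h2; apply/andP; split; clear -q1 q0 H0 Ac da Aa ab bB h1 h2; lra.
  apply: (iso_equality_piece e1' s1 m0 r0_gt0 E1 _ _ tcd hv).
  - by move=> u /andP[h1 h2]; apply: Gc0; apply/andP; split; clear -q1 q0 H0 Ac da h1 h2; lra.
  - by move=> u v h1 h2 h3; apply: L0 => //; clear -q1 q0 H0 Ac da h1 h2 h3; lra.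
  - by rewrite -Gc0//; exact: strip.
have P2 t : c' < t < d' -> e' * ((c1 t).1.1 - x0) = r / `|w| * K (w * (t - s0) + th).
  move=> tcd; have [tau [hv <-]] := v1 t.
  have tA : A <= t <= B by case/andP: tcd => h1 h2; apply/andP; split; clear -q1 q0 H0 bc' dB' Aa ab bB h1 h2; lra.
  have ta : b <= t <= B by case/andP: tcd => h1 h2; apply/andP; split; clear -q1 q0 H0 bc' dB' Aa ab bB h1 h2; lra.
  apply: (iso_equality_piece e1' s1' m0 r_gt0 E2 _ _ tcd hv).
  - by move=> u /andP[h1 h2]; apply: Gc1; apply/andP; split; clear -q1 q0 H0 bc' dB' h1 h2; lra.
  - by move=> u v h1 h2 h3; apply: L1 => //; clear -q1 q0 H0 bc' dB' h1 h2 h3; lra.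
  - by rewrite -Gc1//; exact: strip.
split.
  apply: (@circle_matching K dK r0 w0 th0 r w th e (e' * x0) (r / `|w|) c d c' d' k0 s0) => //.
    by move=> t tcd w00; rewrite -x0E// -mulrBr P1.
  by move=> t tcd; rewrite -x1E -mulrBr P2.
(* On a straight arc the equation keeps the coordinate constant; two distinct times then give n0 =
   0. *)
move=> w00; have Q t : c < t < d -> e' * (r0 * (t - k0) * n0 - x0) = r / `|w| * K th0.
  by move=> tcd; rewrite -(x0E' w00) P1// w00 mul0r add0r.
pose t1 := (2 * c + d) / 3; pose t2 := (c + 2 * d) / 3.
have ht1 : c < t1 < d by apply/andP; rewrite /t1; split; clear -q1 q0 H0 cd; lra.
have ht2 : c < t2 < d by apply/andP; rewrite /t2; split; clear -q1 q0 H0 cd; lra.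
have := Q t1 ht1.
rewrite -(Q t2 ht2) => /(mulfI e'0) E.
have : (r0 * (t2 - t1)) * n0 = 0 by clear -q1 q0 H0 E; lra.
move=> /eqP; rewrite !mulf_eq0 (gt_eqF r0_gt0) /= => /orP[/eqP|/eqP//].
by rewrite /t1 /t2; clear -q1 q0 H0 cd; lra.
Qed.

(** The initial arc is put in front of g on [a - 1, a] and the circle of the target is completed
    behind it. The closed curve so obtained has the minimal length, and its equality case is read on
    the initial arc and on the completion, which is not empty since |w| < 4 H. *)
Theorem minimiser_through_point (a b r0 th0 w0 r th w : R) g l : calibrated q a b g l ->
  g a = ex r0 th0 w0 1 -> g b = ex r th w 1 -> 0 < r0 -> 0 < r -> `|w| < 4 * H ->
  r0 + (l b - l a) <= r -> [/\ C th0 = C th, S th0 = S th & w0 * r = w * r0].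
Proof.
move=> cal ga gb r0_gt0 r_gt0 w4 lr; case: (cal) => ab _ _ _.
pose k0 := a - 1; pose c0 t := ex r0 th0 w0 (t - k0).
have k0a : k0 <= a by rewrite /k0; lra.
have cal0 : calibrated q k0 a c0 (fun t => r0 * (t - k0)).
  exact: (exp_calibrated p1 pq th0 w0 k0 k0a (ltW r0_gt0)).
have c0a : c0 a = g a by rewrite ga /c0 /k0; congr (exp_curve q r0 th0 w0); lra.
have c0k : c0 k0 = ((0, 0), 0) by rewrite /c0 subrr exp_curve0.
have hv0 t := exp_curve_hvelocity p1 pq r0 th0 w0 k0 t.
pose G1 := glue a c0 g; pose l1 := glue a (fun t => r0 * (t - k0)) (fun t => l t - l a + r0 * (a - k0)).
have cal1 : calibrated q k0 b G1 l1 := glue_calibrated cal0 cal c0a.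
have G1k : G1 k0 = ((0, 0), 0) by rewrite /G1 /glue k0a.
have G1b : G1 b = ex r th w 1.
  rewrite /G1 /glue; case: ifPn => // ba; have E : b = a by lra.
  by rewrite -gb E.
have l1k : l1 k0 = 0 by rewrite /l1 /glue k0a subrr mulr0.
have l1b : l1 b = l b - l a + r0.
  rewrite /l1 /glue; case: ifPn => ba; last by rewrite /k0; ring.
  have -> : b = a by lra.
  by rewrite /k0; ring.
have l1B u v : k0 <= u -> u <= v -> v <= a -> l1 v - l1 u = r0 * (v - u).
  by move=> h1 h2 h3; rewrite /l1 /glue h3 (le_trans h2 h3); ring.
(* For a straight target the linear calibration is attained along the whole curve, so the velocity
   of the initial arc is everywhere dual to the angle th. *)
have [w_eq0|w_neq0] := eqVneq w 0.
  have k0b := le_trans k0a ab.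
  have tot : C th * (G1 b).1.1 + S th * (G1 b).1.2 -
      (C th * (G1 k0).1.1 + S th * (G1 k0).1.2) = r.
    rewrite G1b G1k w_eq0 exp_curve_line /= !mulr0 addr0 subr0 mulr1.
    rewrite (_ : C th * (r * spow q (C th)) + S th * (r * spow q (S th)) =
      r * (C th * spow q (C th) + S th * spow q (S th))); last by ring.
    by rewrite (qtrig_dual p1 pq) mulr1.
  have eqs u v : k0 <= u -> u <= v -> v <= b ->
      C th * (G1 v).1.1 + S th * (G1 v).1.2 - (C th * (G1 u).1.1 + S th * (G1 u).1.2) = l1 v - l1 u.
    move=> h1 h2 h3.
    have i1 := linear_increment th cal1 (lexx k0) h1 (le_trans h2 h3).
    have i2 := linear_increment th cal1 h1 h2 h3.
    have i3 := linear_increment th cal1 (le_trans h1 h2) h3 (lexx b).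
    have : l1 b - l1 k0 <= r by rewrite l1b l1k; lra.
    lra.
  have P t : k0 < t < a -> C th = C (w0 * (t - k0) + th0) /\ S th = S (w0 * (t - k0) + th0).
    move=> /andP[h1 h2]; have [d1 d2 _] := (hvelocityP _ _ _ _).1 (hv0 t).
    have D1 := isdD (isdZ (C th) d1) (isdZ (S th) d2).
    have D2 : isd (fun s => C th * (c0 s).1.1 + S th * (c0 s).1.2) t r0.
      apply: (@isd_near _ (fun u => r0 * (u - k0) + (C th * (G1 k0).1.1 + S th * (G1 k0).1.2))).
        by apply: isd_eq (isdD (isdZ r0 (isdB (isd_id t) (isd_cst k0 t))) (isd_cst _ t)) _; ring.
      near=> u.
      have cu : k0 <= u by apply: ltW; near: u; exact: lt_nbhsr.
      have ud : u <= a by apply: ltW; near: u; exact: lt_nbhsl.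
      have := eqs k0 u (lexx _) cu (le_trans ud ab); rewrite l1B//.
      have -> : G1 u = c0 u by rewrite /G1 /glue ud.
      by lra.
    have E := isd_unique D1 D2.
    have [] := @hoelder_dual_eq R p q p1 pq 1 (C th) (S th) (w0 * (t - k0) + th0) ltr01.
    - by rewrite (lnorm_qpoint p1 pq).
    - by apply: (mulfI (lt0r_neq0 r0_gt0)); lra.
    by rewrite !mul1r.
  have k0lta : k0 < a by rewrite /k0; lra.
  (* A nonzero [w0] would make the angle run, while the sine stays constant on the initial arc. *)
  have w00 : w0 = 0.
    apply/eqP; apply: contrapT => /negP w00.
    have [t tcd nz] := qcos_not_flat (th0 - w0 * k0) w00 k0lta.
    have b' : isd (fun t : R => w0 * (t - k0) + th0) t w0.
      by apply: isd_eq (isdD (isdZ w0 (isdB (isd_id t) (isd_cst k0 t))) (isd_cst th0 t)) _; ring.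
    have D1 := @isd_comp _ S (fun t => w0 * (t - k0) + th0) t _ _ (isd_qsin p1 pq _) b'.
    have D2 : isd (fun t => S (w0 * (t - k0) + th0)) t 0.
      case/andP: tcd => h1 h2.
      apply: isd_near (isd_cst (S th) t) _.
      near=> u; have [] := P u; last by [].
      apply/andP; split; near: u; [exact: lt_nbhsr|exact: lt_nbhsl].
    have := isd_unique D1 D2 => /eqP; rewrite mulf_eq0 (negbTE w00) orbF spow_eq0 => /eqP Z.
    move: nz; rewrite (_ : w0 * t + (th0 - w0 * k0) = w0 * (t - k0) + th0); last by ring.
    by rewrite Z eqxx.
  have [|cE sE] := P (a - 1 / 2); first by rewrite /k0; apply/andP; split; lra.
  by rewrite cE sE w_eq0 w00 !mul0r add0r.
have w4' := ltW w4.
pose T := 4 * H / `|w|; have nw : 0 < `|w| by rewrite normr_gt0.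
have T1 : 1 < T by rewrite /T ltr_pdivlMr ?mul1r.
pose B := b + (T - 1); have bB : b < B by rewrite /B; lra.
pose c1 := completion r th w b.
pose G := glue b G1 c1; pose L := glue b l1 (fun t => r * (t - b) - r * (b - b) + l1 b).
have calG : calibrated q k0 B G L := completion_calibrated cal1 G1b r_gt0 w_neq0 w4'.
have GB : G B = ((0, 0), Num.sg w * (2 * H * (r / `|w|) ^+ 2)).
  rewrite /G /glue leNgt bB /= /c1 /completion (_ : B - (b - 1) = T); last by rewrite /B; ring.
  exact: (exp_curve_periodic p1 pq).
have k0b : k0 <= b by exact: le_trans ab.
have Gk : G k0 = ((0, 0), 0) by rewrite /G /glue k0b.
have Gc0 t : k0 <= t <= a -> G t = c0 t.
  by move=> /andP[_ ta]; rewrite /G /glue (le_trans ta ab) /G1 /glue ta.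
have Gc1 t : b <= t <= B -> G t = c1 t.
  move=> /andP[bt _]; rewrite /G /glue; case: ifPn => // tb.
  have -> : t = b by lra.
  rewrite G1b /c1 /completion; congr (exp_curve q r th w); lra.
have L0 u v : k0 <= u -> u <= v -> v <= a -> L v - L u = r0 * (v - u).
  move=> h1 h2 h3; rewrite /L /glue (le_trans h3 ab) (le_trans h2 (le_trans h3 ab)).
  exact: l1B.
have Lb t : b <= t -> L t = r * (t - b) + l1 b.
  move=> bt; rewrite /L /glue; case: ifPn => tb; last by ring.
  have -> : t = b by lra.
  by ring.
have L1 u v : b <= u -> u <= v -> v <= B -> L v - L u = r * (v - u).
  by move=> h1 h2 h3; rewrite !Lb//; [ring|exact: le_trans h2].
have LB : L B - L k0 <= r * (4 * H / `|w|).
  rewrite Lb ?(ltW bB)// /L /glue k0b l1k l1b -/T /B; lra.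
have hv1 t := exp_curve_hvelocity p1 pq r th w (b - 1) t.
have k0lta : k0 < a by rewrite /k0; lra.
have GAB : (G k0).1 = (G B).1 by rewrite Gk GB.
have e1 : `|Num.sg w| = 1 by rewrite normr_sg w_neq0.
have sg1 : Num.sg w * Num.sg w = 1 by rewrite -expr2 sqr_sg w_neq0.
have ew : Num.sg w * w = `|w| by rewrite {2}[w]numEsg mulrA sg1 mul1r.
have zE : Num.sg w * ((G B).2 - (G k0).2) = 2 * H * (r / `|w|) ^+ 2.
  by rewrite GB Gk /= subr0 mulrA sg1 mul1r.
have [] := @half_core k0 a b B G L c0 c1 S (fun t => spow q (C t)) (Num.sg w) (Num.sg w)
  r r0 w w0 th th0 k0 (b - 1) (spow q (C th0)) calG k0lta ab bB GAB r_gt0 r0_gt0 w_neq0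
  e1 e1 ew zE LB Gc0 Gc1 L0 L1.
- by move=> t; exists (w0 * (t - k0) + th0); split => //; exact: hv0.
- by move=> t; exists (w * (t - (b - 1)) + th); split => //; exact: hv1.
- by move=> w00 t; rewrite /c0 exp_curve_circle.
- by move=> w00 t; rewrite /c0 w00 exp_curve_line.
- by move=> t; rewrite /c1 /completion exp_curve_circle.
- exact: (isd_qsin p1 pq).
- move=> v th' c d v0 cd; have [t tcd nz] := qcos_not_flat th' v0 cd.
  by exists t; rewrite // spow_eq0.
move=> A1 A2.
(* The ordinate: the exchange of coordinates reverses the orientation, whence the sign
   [- Num.sg w]. *)
have GAB' : ((@hswap R \o G) k0).1 = ((@hswap R \o G) B).1 by rewrite /= /hswap /= Gk GB.
have e1' : `|- Num.sg w| = 1 by rewrite normrN.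
have zE' : - Num.sg w * (((@hswap R \o G) B).2 - ((@hswap R \o G) k0).2) = 2 * H * (r / `|w|) ^+ 2.
  by rewrite -zE /=; ring.
have [] := @half_core k0 a b B (@hswap R \o G) L (@hswap R \o c0) (@hswap R \o c1)
  C (fun t => - spow q (S t)) (Num.sg w) (- Num.sg w)
  r r0 w w0 th th0 k0 (b - 1) (spow q (S th0)) (calibrated_swap calG) k0lta ab bB GAB' r_gt0 r0_gt0 w_neq0
  e1 e1' ew zE' LB _ _ L0 L1.
- by move=> t tA /=; rewrite Gc0.
- by move=> t tA /=; rewrite Gc1.
- move=> t; have [t' [h1 h2]] := qpoint_swap (w0 * (t - k0) + th0); exists t'.
  by rewrite h1 h2; split => //; apply: swap_hvelocity; exact: hv0.
- move=> t; have [t' [h1 h2]] := qpoint_swap (w * (t - (b - 1)) + th); exists t'.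
  by rewrite h1 h2; split => //; apply: swap_hvelocity; exact: hv1.
- by move=> w00 t; rewrite /c0 /= exp_curve_circle//=; ring.
- by move=> w00 t; rewrite /c0 /= w00 exp_curve_line.
- by move=> t; rewrite /c1 /completion /= exp_curve_circle//=; ring.
- exact: (isd_qcos p1 pq).
- move=> v th' c d v0 cd; have [t tcd nz] := qsin_not_flat th' v0 cd.
  by exists t; rewrite // oppr_eq0 spow_eq0.
(* A straight initial arc would have both components of its direction equal to 0. *)
move=> B1 B2; have [w00|w00] := eqVneq w0 0.
  have := A2 w00; have := B2 w00 => /eqP; rewrite spow_eq0 => /eqP s0 /eqP.
  rewrite spow_eq0 => /eqP c00; have := qtrig_sphere p1 pq th0.
  rewrite s0 c00 normr0 powR0 ?gt_eqF// addr0.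
  by move/eqP; rewrite eq_sym oner_eq0.
have [h1 h2] := A1 w00; have [h3 h4] := B1 w00; by split.
Unshelve. all: by end_near. Qed.

End minimality.

(** * Signed powers of conjugate exponents *)

Section conjugate_powers.
Context (R : realType) (p q : R) (p1 : 1 < p) (pq : p^-1 + q^-1 = 1).

Lemma spowK : cancel (spow p) (spow q).
Proof.
have qp : q^-1 + p^-1 = 1 by rewrite addrC.
have q1 := conjugate_gt1 p1 pq.
have E := conjugate_mul q1 qp.
have E' := conjugate_mul p1 pq.
move=> x; have [->|x0] := eqVneq x 0; first by rewrite !spow0.
rewrite [spow q _]spowE norm_spow// [spow p _]spowE sgrM sgr_id -powRrM.
have -> : (p - 1) * (q - 1) = 1.
  by have -> : (p - 1) * (q - 1) = p * (q - 1) - q + 1; [ring|rewrite E'; ring].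
rewrite powRr1//; have -> : Num.sg (`|x| `^ (p - 1)) = 1.
  by apply/gtr0_sg; rewrite powR_gt0// normr_gt0.
by rewrite mul1r mulrC -numEsg.
Qed.

(** Polar coordinates whose directions are dual vectors, obtained from those of the q-sphere through
    the inverse bijections [spow p] and [spow q]. *)
Lemma dual_polar (x y : R) : (x, y) != 0 -> exists l t,
  [/\ 0 < l, 0 <= t < 4 * qprim q 1, x = l * spow q (qcos q t) &
      y = l * spow q (qsin q t)].
Proof.
move=> xy0; have [|r [t [r0 tH E1 E2]]] := @lnorm_polar R p q p1 pq (spow p x) (spow p y).
  apply: contra xy0 => /eqP[/eqP]; rewrite spow_eq0 => /eqP-> /eqP.
  by rewrite spow_eq0 => /eqP->.
exists (spow q r), t; split => //; first by rewrite spow_gt0.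
- by rewrite -spowM -E1 spowK.
- by rewrite -spowM -E2 spowK.
Qed.

End conjugate_powers.

Lemma continuous_pair (T U V : topologicalType) (f : T -> U) (g : T -> V) :
  continuous f -> continuous g -> continuous (fun x => (f x, g x)).
Proof.
by move=> cf cg x; exact: (cvg_pair (cf x) (cg x)).
Qed.

Section segment_inverse.
Context (R : realType).

Lemma segment_inverse (h : R -> R) (c : R) : 0 <= c -> continuous h ->
  (forall x y : R, 0 <= x -> x < y -> y <= c -> h x < h y) ->
  exists g : R -> R, {within `[h 0, h c], continuous g} /\
    forall s : R, h 0 <= s <= h c -> 0 <= g s <= c /\ h (g s) = s.
Proof.
move=> c0 ch mono.
have inj x y : 0 <= x <= c -> 0 <= y <= c -> h x = h y -> x = y.
  move=> /andP[x0 xc] /andP[y0 yc] E; have [xy|yx|//] := ltgtP x y.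
    by have := mono x y x0 xy yc; rewrite E ltxx.
  by have := mono y x y0 yx xc; rewrite E ltxx.
have /choice[g gP] : forall s : R, exists t : R, h 0 <= s <= h c -> 0 <= t <= c /\ h t = s.
  move=> s; have [hs|] := boolP (h 0 <= s <= h c); last by exists 0.
  by have [t tc ht] := IVT_continuous c0 ch hs; exists t.
exists g; split; last exact: gP.
have hh x : 0 <= x <= c -> h 0 <= h x <= h c.
  have mle u v : 0 <= u -> u <= v -> v <= c -> h u <= h v.
    by move=> u0; rewrite le_eqVlt => /predU1P[->//|uv] vc; exact/ltW/mono.
  by move=> /andP[x0 xc]; rewrite !mle.
apply: segment_can_le_continuous => //.
- exact: continuous_subspaceT.
- move=> x; rewrite in_itv/= => xc; have [gc E] := gP _ (hh x xc).
  exact: inj gc xc E.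
Qed.

End segment_inverse.

(** * Reaching every point off the vertical axis *)

Section surjectivity.
Context (R : realType) (p q : R) (p1 : 1 < p) (pq : p^-1 + q^-1 = 1).
Let q1 : 1 < q := conjugate_gt1 p1 pq.
Local Notation H := (qprim q 1).
Let H0 : 0 < H. Proof. exact: qprim1_gt0. Qed.
Local Notation C := (qcos q).
Local Notation S := (qsin q).
Local Notation ex := (exp_curve q).

Lemma qtrig_intperiodic t (n : int) :
  C (t + n%:~R * (4 * H)) = C t /\ S (t + n%:~R * (4 * H)) = S t.
Proof. by rewrite /qcos /qsin (qpoint_periodic p1 pq). Qed.

Lemma exp_curve_intperiodic r th (n : int) w t :
  ex r (th + n%:~R * (4 * H)) w t = ex r th w t.
Proof.
have [cE sE] := qtrig_intperiodic th n.
have [->|w0] := eqVneq w 0; first by rewrite !exp_curve_line cE sE.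
rewrite !exp_curve_circle// cE sE addrA.
by have [-> ->] := qtrig_intperiodic (w * t + th) n.
Qed.

(** The same arc run backwards and translated to e: it starts at the final angle th + w, moved by
    half a turn to reverse the velocity, and ends at the group inverse. *)
Lemma exp_curve_opp r th w : ex r (th + w + 2 * H) (- w) 1 =
  ((- (ex r th w 1).1.1, - (ex r th w 1).1.2), - (ex r th w 1).2).
Proof.
have [->|w0] := eqVneq w 0.
  have [cE sE] := qtrigD2 p1 pq th.
  by rewrite oppr0 addr0 !exp_curve_line/= cE sE !spowN !mulrN oppr0.
rewrite !exp_curve_circle ?oppr_eq0//= !mulr1.
have -> : - w + (th + w + 2 * H) = th + 2 * H by ring.
have [-> ->] := qtrigD2 p1 pq th; have [-> ->] := qtrigD2 p1 pq (th + w).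
rewrite [w + th]addrC invrN sqrrN; congr ((_, _), _); ring.
Qed.

(** For short arcs the area is of smaller order than (u + v)^2, while each cross product is at least
    half of its angle. This is the sign at the lower end of the intermediate value argument. *)
Lemma chord_small (ts l z : R) : 0 < l -> 0 < z -> exists2 d, 0 < d &
  forall u v, 0 < u -> u <= d -> 0 < v -> v <= d -> qsegment q (ts - v) (u + v) <=
    2 * z * ((qcross q ts (ts + u) + qcross q (ts - v) ts) / l) ^+ 2.
Proof.
(* The bound 1 serves the lower estimates of the cross products; z / (8 l^2) is more than enough for
   the final comparison, as the sum of the cross products is at least (u + v) / 2. *)
move=> l0 z0; set e := Num.min 1 (z / (8 * l ^+ 2)).
have e0 : 0 < e by rewrite lt_min ltr01 divr_gt0// mulr_gt0// exprn_gt0.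
have [d d0 small] := @qsegment_small R p q p1 pq ts e e0.
pose d' := Num.min d 1 / 4.
have d'0 : 0 < d' by rewrite divr_gt0 ?lt_min ?d0 ?ltr01.
have d'd : 4 * d' <= d by rewrite /d' mulrC divfK// ge_min lexx.
have d'1 : 4 * d' <= 1 by rewrite /d' mulrC divfK// ge_min lexx orbT.
exists d' => // u v u0 ud v0 vd.
have ud1 : u < d by lra.
have vd1 : v < d by lra.
have uv0 : 0 < u + v by lra.
have uvd1 : u + v < d by lra.
have half w : 0 < w -> w <= d' -> e * w ^+ 2 <= w / 2.
  move=> w0 wd; apply: (@le_trans _ _ (w * w)).
    by rewrite -expr2 ler_piMl ?sqr_ge0// ge_min lexx.
  by rewrite ler_pM2l//; lra.
have q1u : u / 2 <= qcross q ts (ts + u).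
  have := small ts u; rewrite subrr normr0 [`|u|]gtr0_norm// => /(_ d0 ud1).
  by rewrite ler_norml => /andP[_]; rewrite /qsegment; have := half u u0 ud; lra.
have vE : ts - v - ts = - v by ring.
have q1v : v / 2 <= qcross q (ts - v) ts.
  have := small (ts - v) v; rewrite vE normrN [`|v|]gtr0_norm// => /(_ vd1 vd1).
  by rewrite ler_norml => /andP[_]; rewrite /qsegment subrK; have := half v v0 vd; lra.
have := small (ts - v) (u + v); rewrite vE normrN [`|v|]gtr0_norm// [`|u + v|]gtr0_norm//.
move=> /(_ vd1 uvd1); rewrite ler_norml => /andP[_ h]; apply: (le_trans h).
apply: (@le_trans _ _ (z / (8 * l ^+ 2) * (u + v) ^+ 2)).
  by rewrite ler_wpM2r ?sqr_ge0// ge_min lexx orbT.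
set Q := _ + qcross q _ _.
have hQ : (u + v) / 2 <= Q by rewrite /Q; lra.
have hQ2 : ((u + v) / 2) ^+ 2 <= Q ^+ 2.
  by rewrite ler_sqr ?nnegrE//; lra.
rewrite (_ : 2 * z * (Q / l) ^+ 2 = z / l ^+ 2 * (2 * Q ^+ 2)); last by field; rewrite gt_eqF.
rewrite (_ : z / (8 * l ^+ 2) * (u + v) ^+ 2 = z / l ^+ 2 * ((u + v) ^+ 2 / 8)); last by field; rewrite gt_eqF.
rewrite ler_pM2l ?divr_gt0 ?exprn_gt0//; move: hQ2 (sqr_ge0 (u + v)).
by rewrite exprMn; lra.
Qed.

(* The chord from b to a of the unit sphere is orthogonal to (x, y) when the
   functional attaining its maximum at ts takes the same value at both ends; this
   leaves one parameter, and the area is adjusted by the intermediate value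
   theorem. *)
Lemma chord_solution (ts l x y z : R) : 0 < l -> x = l * spow q (C ts) ->
  y = l * spow q (S ts) -> 0 < z -> exists a b : R,
  [/\ ts < a < ts + 2 * H, ts - 2 * H < b < ts,
      spow q (C ts) * C a + spow q (S ts) * S a = spow q (C ts) * C b + spow q (S ts) * S b &
      qsegment q b (a - b) =
        2 * z * ((qcross q ts a + qcross q b ts) / l) ^+ 2].
Proof.
move=> l0 xE yE z0.
pose f t := spow q (C ts) * C t + spow q (S ts) * S t.
pose df t := spow q (S ts) * spow q (C t) - spow q (C ts) * spow q (S t).
have df_ (t : R) : isd f t (df t) := isd_qdot p1 pq _ _ t.
have cf : continuous f by exact: (qdot_continuous p1 pq).
(* Minus the functional, followed from its maximum [ts] in both directions: over half a turn it
   increases from -1 to 1, so that each level s gives the ends [ts + g1 s] and [ts - g2 s] of one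
   chord. *)
pose h1 t := - f (ts + t); pose h2 t := - f (ts - t).
have dh1 (t : R) : isd h1 t (- df (ts + t)).
  have b : isd (fun t : R => ts + t) t 1 by apply: isd_eq (isdD (isd_cst ts t) (isd_id t)) _; ring.
  by apply: isd_eq (isdN (@isd_comp _ f _ t _ _ (df_ _) b)) _; ring.
have dh2 (t : R) : isd h2 t (df (ts - t)).
  have b : isd (fun t : R => ts - t) t (-1) by apply: isd_eq (isdB (isd_cst ts t) (isd_id t)) _; ring.
  by apply: isd_eq (isdN (@isd_comp _ f _ t _ _ (df_ _) b)) _; ring.
have ch1 : continuous h1 by move=> t; exact: isd_continuous (dh1 t).
have ch2 : continuous h2 by move=> t; exact: isd_continuous (dh2 t).
have c0 : 0 <= 2 * H by rewrite mulr_ge0// ltW.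
have m1 u v : 0 <= u -> u < v -> v <= 2 * H -> h1 u < h1 v.
  move=> u0 uv vH; apply: (isd_lt uv ch1) => t /andP[t1 t2]; split; first exact: dh1.
  rewrite /df opprB; apply: (spow_qcross_gt0 p1 pq); lra.
have m2 u v : 0 <= u -> u < v -> v <= 2 * H -> h2 u < h2 v.
  move=> u0 uv vH; apply: (isd_lt uv ch2) => t /andP[t1 t2]; split; first exact: dh2.
  rewrite /df (mulrC (spow q (S ts))) (mulrC (spow q (C ts))).
  apply: (spow_qcross_gt0 p1 pq); lra.
have fts : f ts = 1 by rewrite /f -(qtrig_dual p1 pq ts); ring.
have [cE sE] := qtrigD2 p1 pq ts; have [cE' sE'] := qtrigD2 p1 pq (ts - 2 * H).
rewrite subrK in cE' sE'; move: cE' sE' => /esym/(canRL (@opprK _)) cE' /esym/(canRL (@opprK _)) sE'.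
have h10 : h1 0 = -1 by rewrite /h1 addr0 fts.
have h20 : h2 0 = -1 by rewrite /h2 subr0 fts.
have h1H : h1 (2 * H) = 1 by rewrite /h1 /f cE sE -fts /f; ring.
have h2H : h2 (2 * H) = 1 by transitivity (f ts) => //; rewrite /h2 /f cE' sE'; ring.
have [g1 []] := segment_inverse c0 ch1 m1; rewrite h10 h1H => cg1 g1P.
have [g2 []] := segment_inverse c0 ch2 m2; rewrite h20 h2H => cg2 g2P.
(* Once its direction is right, the chord is a quarter turn of k (x, y); dividing the arc by k then
   produces the height z exactly when [F] vanishes. *)
pose k (u : R * R) := (qcross q ts (ts + u.1) + qcross q (ts - u.2) ts) / l.
pose F (u : R * R) := qsegment q (ts - u.2) (u.1 + u.2) - 2 * z * k u ^+ 2.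
have cC (g : R * R -> R) : continuous g -> continuous (fun u => C (g u)).
  by move=> cg u; apply: (@continuous_comp _ _ _ g C); [exact: cg|exact: (qcos_continuous p1 pq)].
have cS (g : R * R -> R) : continuous g -> continuous (fun u => S (g u)).
  by move=> cg u; apply: (@continuous_comp _ _ _ g S); [exact: cg|exact: (qsin_continuous p1 pq)].
have cfst : continuous (fun u : R * R => u.1) by move=> u; exact: cvg_fst.
have csnd : continuous (fun u : R * R => u.2) by move=> u; exact: cvg_snd.
have cX (g g' : R * R -> R) : continuous g -> continuous g' ->
    continuous (fun u => qcross q (g u) (g' u)).
  move=> cg cg' u; apply: (@continuousB _ _ _ (fun u => C (g u) * S (g' u)) (fun u => S (g u) * C (g' u))).
    by apply: (@continuousM _ _ (fun u => C (g u)) (fun u => S (g' u))); [exact: cC|exact: cS].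
  by apply: (@continuousM _ _ (fun u => S (g u)) (fun u => C (g' u))); [exact: cS|exact: cC].
have c1 : continuous (fun u : R * R => ts + u.1).
  by move=> u; apply: (@continuousD _ _ _ (fun=> ts) (fun u => u.1)); [exact: cst_continuous|exact: cfst].
have c2 : continuous (fun u : R * R => ts - u.2).
  by move=> u; apply: (@continuousB _ _ _ (fun=> ts) (fun u => u.2)); [exact: cst_continuous|exact: csnd].
have c3 : continuous (fun u : R * R => u.1 + u.2).
  by move=> u; apply: (@continuousD _ _ _ (fun u => u.1) (fun u => u.2)); [exact: cfst|exact: csnd].
have c4 : continuous (fun u : R * R => ts - u.2 + (u.1 + u.2)).
  by move=> u; apply: (@continuousD _ _ _ (fun u => ts - u.2) (fun u => u.1 + u.2)); [exact: c2|exact: c3].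
have cts : continuous (fun u : R * R => ts) by move=> u; exact: cst_continuous.
have ck : continuous k.
  move=> u; apply: (@continuousM _ _ (fun u => qcross q ts (ts + u.1) + qcross q (ts - u.2) ts) (fun=> l^-1)).
    apply: (@continuousD _ _ _ (fun u => qcross q ts (ts + u.1)) (fun u => qcross q (ts - u.2) ts)).
      exact: (cX _ _ cts c1).
    exact: (cX _ _ c2 cts).
  exact: cst_continuous.
have cF : continuous F.
  move=> u; apply: (@continuousB _ _ _ (fun u => qsegment q (ts - u.2) (u.1 + u.2)) (fun u => 2 * z * k u ^+ 2)).
    apply: (@continuousB _ _ _ (fun u => u.1 + u.2) (fun u => qcross q (ts - u.2) (ts - u.2 + (u.1 + u.2)))).
      exact: c3.
    exact: (cX _ _ c2 c4).
  apply: (@continuousM _ _ (fun=> 2 * z) (fun u => k u ^+ 2)); first exact: cst_continuous.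
  by apply: (@continuousM _ _ k k); exact: ck.
have [d d0 small] := @chord_small ts l z l0 z0.
pose d' := Num.min d (2 * H).
have d'0 : 0 < d' by rewrite lt_min d0 mulr_gt0.
have d'd : d' <= d by rewrite /d' ge_min lexx.
have d'H : d' <= 2 * H by rewrite /d' ge_min lexx orbT.
(* A level so low that both ends of the chord stay within [d'] of [ts]. *)
pose s0 := Num.min (h1 d') (h2 d').
have s0m : -1 < s0 by rewrite lt_min -{1}h10 -h20 m1// m2.
have s01 : s0 <= 1.
  rewrite /s0 ge_min -{1}h1H; apply/orP; left.
  have [->//|ne] := eqVneq d' (2 * H).
  by apply/ltW/m1 => //; [exact: ltW|rewrite lt_neqAle ne].
have s0I : -1 <= s0 <= 1 by rewrite (ltW s0m).
have [/andP[u0 uH] uE] := g1P s0 s0I; have [/andP[v0 vH] vE] := g2P s0 s0I.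
have u0' : 0 < g1 s0.
  by rewrite lt_neqAle u0 andbT; apply/eqP => E; move: s0m; rewrite -uE -E h10 ltxx.
have v0' : 0 < g2 s0.
  by rewrite lt_neqAle v0 andbT; apply/eqP => E; move: s0m; rewrite -vE -E h20 ltxx.
have ud' : g1 s0 <= d'.
  rewrite leNgt; apply/negP => du; have := m1 _ _ (ltW d'0) du uH.
  by rewrite uE ltNge ge_min lexx.
have vd' : g2 s0 <= d'.
  rewrite leNgt; apply/negP => du; have := m2 _ _ (ltW d'0) du vH.
  by rewrite vE ltNge ge_min lexx orbT.
have F0 : F (g1 s0, g2 s0) <= 0.
  by rewrite subr_le0; apply: small => //; exact: le_trans d'd.
have I1 : -1 <= (1 : R) <= 1 by rewrite lexx andbT (@le_trans _ _ 0) ?lerN10.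
have [/andP[a0 aH] aE] := g1P 1 I1.
have [/andP[b0 bH] bE] := g2P 1 I1.
have a1 : g1 1 = 2 * H.
  apply/eqP; rewrite eq_le aH leNgt; apply/negP => L.
  by have := m1 _ _ a0 L (lexx _); rewrite aE h1H ltxx.
have b1 : g2 1 = 2 * H.
  apply/eqP; rewrite eq_le bH leNgt; apply/negP => L.
  by have := m2 _ _ b0 L (lexx _); rewrite bE h2H ltxx.
(* At level 1 both ends are opposite to [ts]: the arc is a full turn and its chord is 0. *)
have F1 : F (g1 1, g2 1) = 4 * H.
  rewrite a1 b1 /F /k /qsegment /qcross /= cE sE.
  rewrite (_ : ts - 2 * H + (2 * H + 2 * H) = ts + 2 * H); last by ring.
  rewrite cE sE cE' sE'; ring.
have cFg : {within `[s0, 1], continuous (fun s => F (g1 s, g2 s))}.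
  have sub : `[s0, 1]%classic `<=` `[-1, 1]%classic.
    by move=> s /=; rewrite !in_itv/= => /andP[h ->]; rewrite (le_trans (ltW s0m) h).
  have cg1' := continuous_subspaceW sub cg1; have cg2' := continuous_subspaceW sub cg2.
  move=> s; apply: (@continuous_comp (subspace _) _ _ (fun s => (g1 s, g2 s)) F s); last exact: cF.
  exact: (@continuous_pair (subspace `[s0, 1]%classic) R R g1 g2 cg1' cg2').
have [|s] := @IVT R (fun s => F (g1 s, g2 s)) s0 1 0 s01 cFg.
  by rewrite F1 ge_min le_max F0 /= mulr_ge0 ?orbT// ltW.
rewrite in_itv/= => /andP[ss s1] Fs.
have sm : -1 < s := lt_le_trans s0m ss.
have s1' : s < 1.
  rewrite lt_neqAle s1 andbT; apply/eqP => E; move: Fs; rewrite E F1 => /eqP.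
  by rewrite mulf_eq0 !gt_eqF.
have sI : -1 <= s <= 1 by rewrite (ltW sm).
have [/andP[u1 uH1] uE1] := g1P s sI; have [/andP[v1 vH1] vE1] := g2P s sI.
have u1' : 0 < g1 s.
  by rewrite lt_neqAle u1 andbT; apply/eqP => E; move: sm; rewrite -uE1 -E h10 ltxx.
have v1' : 0 < g2 s.
  by rewrite lt_neqAle v1 andbT; apply/eqP => E; move: sm; rewrite -vE1 -E h20 ltxx.
have uH1' : g1 s < 2 * H.
  by rewrite lt_neqAle uH1 andbT; apply/eqP => E; move: s1'; rewrite -uE1 E h1H ltxx.
have vH1' : g2 s < 2 * H.
  by rewrite lt_neqAle vH1 andbT; apply/eqP => E; move: s1'; rewrite -vE1 E h2H ltxx.
exists (ts + g1 s), (ts - g2 s); split.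
- by rewrite ltrDl u1' ltrD2l uH1'.
- by rewrite gtrBl v1' andbT ltrD2l ltrN2 vH1'.
- by apply: oppr_inj; rewrite -/(f _) -/(f _) -/(h1 _) -/(h2 _) uE1 vE1.
move: Fs; rewrite /F /k /= (_ : ts + g1 s - (ts - g2 s) = g1 s + g2 s); last by ring.
by move/eqP; rewrite subr_eq0 => /eqP.
Qed.

Lemma exp_curve_surj_gt0 (x y z : R) : (x, y) != 0 -> 0 < z -> exists r th w,
  [/\ 0 < r, `|w| < 4 * H & ex r th w 1 = ((x, y), z)].
Proof.
move=> xy0 z0; have [l [ts [l0 _ xE yE]]] := dual_polar p1 pq xy0.
have [a [b [/andP[a1 a2] /andP[b1 b2] E1 E2]]] := chord_solution l0 xE yE z0.
set k := (qcross q ts a + qcross q b ts) / l in E2.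
have k0 : 0 < k.
  rewrite divr_gt0// addr_gt0// (qcross_gt0 p1 pq)//; lra.
have dual := qtrig_dual p1 pq ts.
have Ek : k * l = qcross q ts a + qcross q b ts by rewrite /k divfK// gt_eqF.
have E1' : spow q (C ts) * (C a - C b) = - (spow q (S ts) * (S a - S b)) by lra.
have Ek' : C ts * (S a - S b) - S ts * (C a - C b) = k * l.
  by rewrite Ek /qcross; ring.
(* The relations [E1'] and [Ek'] form a linear system for the chord, whose determinant is the
   pairing [dual], equal to 1. *)
have eS : S a - S b = k * x.
  rewrite -[LHS]mul1r -{1}dual xE.
  transitivity (spow q (C ts) * (C ts * (S a - S b) - S ts * (C a - C b))
    + S ts * (spow q (S ts) * (S a - S b) + spow q (C ts) * (C a - C b))); first ring.
  by rewrite Ek' E1' subrr; ring.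
have eC : C a - C b = - (k * y).
  rewrite -[LHS]mul1r -{1}dual yE.
  transitivity (- (spow q (S ts) * (C ts * (S a - S b) - S ts * (C a - C b)))
    + C ts * (spow q (C ts) * (C a - C b) + spow q (S ts) * (S a - S b))); first ring.
  by rewrite Ek' E1' addNr; ring.
have w0 : 0 < a - b by lra.
(* The arc of the sphere from angle b to angle a, scaled so that r / w = 1 / k. *)
exists ((a - b) / k), b, (a - b); split.
- exact: divr_gt0.
- by rewrite gtr0_norm//; lra.
rewrite exp_curve_circle ?gt_eqF// mulr1 subrK eS eC.
rewrite (_ : _ + _ - _ = qsegment q b (a - b)); last first.
  by rewrite /qsegment /qcross subrKC; ring.
rewrite E2; congr ((_, _), _); field; rewrite !gt_eqF//.
Qed.

Theorem exp_curve_surj (x y z : R) : (x, y) != 0 -> exists r th w,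
  [/\ 0 < r, 0 <= th < 4 * H, `|w| < 4 * H & ex r th w 1 = ((x, y), z)].
Proof.
move=> xy0; suff [r [th [w [r0 w4 E]]]] : exists r th w,
    [/\ 0 < r, `|w| < 4 * H & ex r th w 1 = ((x, y), z)].
  have [th' [n [h thE]]] := qmod_decomposition q1 th.
  by exists r, th', w; rewrite -E thE exp_curve_intperiodic.
have [zn|zp|->] := ltgtP z 0.
- have [||r [th [w [r0 w4 E]]]] := @exp_curve_surj_gt0 (- x) (- y) (- z).
  + by apply: contra xy0 => /eqP[/eqP]; rewrite oppr_eq0 => /eqP-> /eqP; rewrite oppr_eq0 => /eqP->.
  + by rewrite oppr_gt0.
  exists r, (th + w + 2 * H), (- w); rewrite normrN exp_curve_opp E /= !opprK.
  by split.
- exact: exp_curve_surj_gt0.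
- have [l [ts [l0 _ -> ->]]] := dual_polar p1 pq xy0.
  exists l, ts, 0; rewrite normr0 exp_curve_line mulr1; split => //.
  by rewrite mulr_gt0.
Qed.

Lemma exp_curve_vertical (th z : R) : z != 0 -> exists2 r, 0 < r &
  ex r th (Num.sg z * (4 * H)) 1 = ((0, 0), z).
Proof.
move=> z0; have H4 : 0 < 4 * H by rewrite mulr_gt0.
have zH : 0 <= `|z| / (2 * H) by rewrite divr_ge0// mulr_ge0// ltW.
have zH' : 0 < `|z| / (2 * H) by rewrite divr_gt0 ?normr_gt0// mulr_gt0.
(* The solution r of 2 H (r / (4 H))^2 = |z|. *)
exists (4 * H * Num.sqrt (`|z| / (2 * H))); first by rewrite mulr_gt0// sqrtr_gt0.
have w0 : Num.sg z * (4 * H) != 0 by rewrite mulf_neq0 ?sgr_eq0// gt_eqF.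
have wn : `|Num.sg z * (4 * H)| = 4 * H by rewrite normrM normr_sg z0 mul1r gtr0_norm.
have := @exp_curve_periodic R p q p1 pq (4 * H * Num.sqrt (`|z| / (2 * H))) th _ w0.
rewrite wn divff ?gt_eqF// => ->; congr (_, _).
rewrite sgrM sgr_id (gtr0_sg H4) mulr1.
rewrite (_ : _ / (4 * H) = Num.sqrt (`|z| / (2 * H))); last by field; rewrite gt_eqF.
rewrite sqr_sqrtr// [2 * H * _]mulrC divfK -?numEsg// mulf_neq0// gt_eqF//.
Qed.

End surjectivity.

(** * Difference quotients continued to increment 0 *)

Section slopes.
Context (R : realType).

(** The continuation by the derivative removes the division by w from the formula of exp and makes
    it jointly continuous across w = 0. *)
Definition slope (f df : R -> R) (u : R * R) : R :=
  if u.2 == 0 then df u.1 else (f (u.2 + u.1) - f u.1) / u.2.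

Lemma slope_between (f df : R -> R) (u : R * R) : (forall x : R, isd f x (df x)) ->
  exists2 c, `|c - u.1| <= `|u.2| & slope f df u = df c.
Proof.
move=> f_; rewrite /slope; case: eqP => [_|/eqP w0].
  by exists u.1; rewrite // subrr normr0.
have [c cb E] := MVT_between u.1 (u.2 + u.1) f_.
by exists c; [rewrite addrK in cb|rewrite E addrK mulfK].
Qed.

Lemma continuous_if_neq0 (g a b : R * R -> R) (u : R * R) : u.2 != 0 ->
  g =1 (fun u => if u.2 == 0 then a u else b u) ->
  {for u, continuous b} -> {for u, continuous g}.
Proof.
move=> u0 gE cb; have gu : g u = b u by rewrite gE (negbTE u0).
rewrite /prop_for /continuous_at gu; apply: cvg_trans cb.
have cs : (snd : R * R -> R) @ u --> u.2 by exact: cvg_snd.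
apply: near_eq_cvg; near=> v; rewrite gE ifN//.
by near: v; exact: (cvgr_neq0 _ cs u0).
Unshelve. all: by end_near. Qed.

Lemma slope_continuous (f df : R -> R) : (forall x : R, isd f x (df x)) ->
  continuous df -> continuous (slope f df).
Proof.
move=> f_ cdf [a w]; have [->|w0] := eqVneq w 0; last first.
  apply: (@continuous_if_neq0 _ (fun u => df u.1) (fun u => (f (u.2 + u.1) - f u.1) / u.2)) => //.
  have cfst : {for (a, w), continuous (fun u : R * R => u.1)} by exact: cvg_fst.
  have csnd : {for (a, w), continuous (fun u : R * R => u.2)} by exact: cvg_snd.
  have cf (x : R) := isd_continuous (f_ x).
  apply: (@continuousM _ _ (fun u => f (u.2 + u.1) - f u.1) (fun u => u.2^-1)).
    apply: (@continuousB _ _ _ (fun u => f (u.2 + u.1)) (fun u => f u.1)).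
      apply: (@continuous_comp _ _ _ (fun u : R * R => u.2 + u.1) f); last exact: cf.
      exact: (@continuousD _ _ _ (fun u => u.2) (fun u => u.1)).
    by apply: (@continuous_comp _ _ _ (fun u : R * R => u.1) f); last exact: cf.
  exact: (@continuousV _ _ (fun u : R * R => u.2)).
apply/cvgrPdist_lt => e e0.
have /cvgrPdist_lt/(_ _ e0)/nbhs_ballP[d /= d0 Hd] := cdf a.
have d20 : 0 < d / 2 by rewrite divr_gt0.
exists (ball a (d / 2), ball (0 : R) (d / 2)) => /=.
  by split; exact: nbhsx_ballx.
move=> -[a' w'] [/= ba bw].
rewrite {1}/slope /= eqxx; have [c /= cb ->] := slope_between (a', w') f_.
apply: Hd; rewrite /ball /=; move: ba bw; rewrite /ball /= sub0r normrN => ba bw.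
rewrite (_ : a - c = (a - a') - (c - a')); last by ring.
by rewrite (le_lt_trans (ler_normB _ _))//; lra.
Qed.

End slopes.

(** * Fibres of continuous maps on compact sets *)

Section compact_maps.

(** The image of the compact part of [K] outside [V] is closed and misses y. Taken for [cylinder]
    this yields the continuity of [heis_exp], taken for [cylinder_exp] the bound [exp_proper] and
    the continuity of [heis_log]. *)
Lemma compact_preimage_near (X Y : topologicalType) (e : X -> Y) (K V : set X) (y : Y) :
  hausdorff_space Y -> continuous e -> compact K -> open V ->
  (forall k, K k -> e k = y -> V k) ->
  \forall y' \near y, forall k, K k -> e k = y' -> V k.
Proof.
move=> hY ce cK oV yV.
have cKV : compact (K `&` ~` V) by apply: compact_closedI => //; exact: open_closedC.
have cI : closed (e @` (K `&` ~` V)).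
  apply: compact_closed => //; apply: continuous_compact cKV.
  exact: continuous_subspaceT.
have : nbhs y (~` (e @` (K `&` ~` V))).
  apply: open_nbhs_nbhs; split; first exact: closed_openC.
  by move=> [k [Kk nVk] ky]; apply: nVk; exact: yV.
apply: filterS => y' ny' k Kk ky'; apply: contrapT => nV.
by apply: ny'; exists k.
Qed.

End compact_maps.

(** * Cylindrical coordinates and continuity of exp *)

Section cylindrical_coordinates.
Context (R : realType) (p q : R) (p1 : 1 < p) (pq : p^-1 + q^-1 = 1).
Let q1 : 1 < q := conjugate_gt1 p1 pq.
Let q0 : 0 < q. Proof. by rewrite (lt_trans _ q1). Qed.
Local Notation H := (qprim q 1).
Let H0 : 0 < H. Proof. exact: qprim1_gt0. Qed.
Local Notation C := (qcos q).
Local Notation S := (qsin q).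
Local Notation ex := (exp_curve q).

Definition cylinder (k : R * R * R) : heis R :=
  ((k.1.1 * C k.1.2, k.1.1 * S k.1.2), k.2).

Definition cylinder_exp (k : R * R * R) : heis R := ex k.1.1 k.1.2 k.2 1.

(** The counterpart of [slope] for the height; the value 0 at w = 0 is the limit, by
    [qsegment_small]. *)
Definition qzeta (u : R * R) : R :=
  if u.2 == 0 then 0 else qsegment q u.1 u.2 / u.2 ^+ 2.

Lemma exp_curve1E r th w : ex r th w 1 =
  ((r * slope S (fun t => spow q (C t)) (th, w),
    - (r * slope C (fun t => - spow q (S t)) (th, w))),
   r ^+ 2 * (qzeta (th, w) / 2)).
Proof.
rewrite /slope /qzeta /=; case: eqP => [->|/eqP w0].
  by rewrite exp_curve_line mulr1 mulrN opprK mul0r mulr0.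
rewrite exp_curve_circle// mulr1 /qsegment /qcross [th + w]addrC.
by congr ((_, _), _); field.
Qed.

Lemma exp_curve1Z r th w : ex r th w 1 =
  ((r * (ex 1 th w 1).1.1, r * (ex 1 th w 1).1.2), r ^+ 2 * (ex 1 th w 1).2).
Proof. by rewrite !exp_curve1E /= expr1n !mul1r mulrN. Qed.

Lemma qzeta_continuous : continuous qzeta.
Proof.
move=> [a w]; have [->|w0] := eqVneq w 0; last first.
  apply: (@continuous_if_neq0 _ _ (fun=> 0) (fun u => qsegment q u.1 u.2 / u.2 ^+ 2)) => //.
  have cfst : {for (a, w), continuous (fun u : R * R => u.1)} by exact: cvg_fst.
  have csnd : {for (a, w), continuous (fun u : R * R => u.2)} by exact: cvg_snd.
  have csum : {for (a, w), continuous (fun u : R * R => u.1 + u.2)}.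
    exact: (@continuousD _ _ _ (fun u => u.1) (fun u => u.2)).
  have cC (g : R * R -> R) : {for (a, w), continuous g} -> {for (a, w), continuous (fun u => C (g u))}.
    by move=> cg; apply: (@continuous_comp _ _ _ g C); [exact: cg|exact: (qcos_continuous p1 pq)].
  have cS (g : R * R -> R) : {for (a, w), continuous g} -> {for (a, w), continuous (fun u => S (g u))}.
    by move=> cg; apply: (@continuous_comp _ _ _ g S); [exact: cg|exact: (qsin_continuous p1 pq)].
  apply: (@continuousM _ _ (fun u => qsegment q u.1 u.2) (fun u => (u.2 ^+ 2)^-1)).
    apply: (@continuousB _ _ _ (fun u => u.2) (fun u => qcross q u.1 (u.1 + u.2))) => //.
    apply: (@continuousB _ _ _ (fun u => C u.1 * S (u.1 + u.2)) (fun u => S u.1 * C (u.1 + u.2))).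
      by apply: (@continuousM _ _ (fun u => C u.1) (fun u => S (u.1 + u.2))); [exact: cC|exact: cS].
    by apply: (@continuousM _ _ (fun u => S u.1) (fun u => C (u.1 + u.2))); [exact: cS|exact: cC].
  apply: (@continuousV _ _ (fun u : R * R => u.2 ^+ 2)); first by rewrite expf_neq0.
  exact: (@continuousM _ _ (fun u => u.2) (fun u => u.2)).
apply/cvgrPdist_lt => e e0; have e20 : 0 < e / 2 by rewrite divr_gt0.
have [d d0 Hd] := qsegment_small p1 pq a e20.
exists (ball a d, ball (0 : R) d) => /=.
  by split; exact: nbhsx_ballx.
move=> -[a' w'] [/= ba bw].
rewrite {1}/qzeta /= eqxx sub0r normrN /qzeta /=; case: eqP => [_|/eqP w0].
  by rewrite normr0.
move: ba bw; rewrite /ball /= sub0r normrN distrC => ba bw.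
have w2 : 0 < w' ^+ 2 by rewrite exprn_even_gt0.
rewrite normrM normfV (gtr0_norm w2) ltr_pdivrMr//.
apply: le_lt_trans (Hd _ _ ba bw) _; rewrite ltr_pM2r//; lra.
Qed.

Lemma cylinder_exp_continuous : continuous cylinder_exp.
Proof.
have cr : continuous (fun k : R * R * R => k.1.1).
  by move=> k; apply: (@continuous_comp _ _ _ (fun k : R * R * R => k.1) (fun u : R * R => u.1)); exact: cvg_fst.
have cu : continuous (fun k : R * R * R => (k.1.2, k.2)).
  apply: continuous_pair => [k|k]; last exact: cvg_snd.
  by apply: (@continuous_comp _ _ _ (fun k : R * R * R => k.1) (fun u : R * R => u.2)); [exact: cvg_fst|exact: cvg_snd].
have cN : continuous (fun t => - spow q (S t)).
  by move=> t; apply: (@continuousN _ _ _ (fun t => spow q (S t))); exact: (spow_qsin_continuous p1 pq).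
have cX : continuous (fun k : R * R * R => k.1.1 * slope S (fun t => spow q (C t)) (k.1.2, k.2)).
  move=> k; apply: (@continuousM _ _ (fun k => k.1.1) (fun k : R * R * R => slope S (fun t => spow q (C t)) (k.1.2, k.2))).
    exact: cr.
  apply: (@continuous_comp _ _ _ (fun k : R * R * R => (k.1.2, k.2))); first exact: cu.
  apply: slope_continuous; [exact: (isd_qsin p1 pq)|exact: (spow_qcos_continuous p1 pq)].
have cY : continuous (fun k : R * R * R => - (k.1.1 * slope C (fun t => - spow q (S t)) (k.1.2, k.2))).
  move=> k; apply: (@continuousN _ _ _ (fun k : R * R * R => k.1.1 * slope C (fun t => - spow q (S t)) (k.1.2, k.2))).
  apply: (@continuousM _ _ (fun k => k.1.1) (fun k : R * R * R => slope C (fun t => - spow q (S t)) (k.1.2, k.2))).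
    exact: cr.
  apply: (@continuous_comp _ _ _ (fun k : R * R * R => (k.1.2, k.2))); first exact: cu.
  apply: slope_continuous; [exact: (isd_qcos p1 pq)|exact: cN].
have cZ : continuous (fun k : R * R * R => k.1.1 ^+ 2 * (qzeta (k.1.2, k.2) / 2)).
  move=> k; apply: (@continuousM _ _ (fun k : R * R * R => k.1.1 ^+ 2) (fun k : R * R * R => qzeta (k.1.2, k.2) / 2)).
    by apply: (@continuousM _ _ (fun k => k.1.1) (fun k => k.1.1)); exact: cr.
  apply: (@continuousM _ _ (fun k : R * R * R => qzeta (k.1.2, k.2)) (fun=> 2^-1)); last exact: cst_continuous.
  by apply: (@continuous_comp _ _ _ (fun k : R * R * R => (k.1.2, k.2))); [exact: cu|exact: qzeta_continuous].
have -> : cylinder_exp = (fun k => ((k.1.1 * slope S (fun t => spow q (C t)) (k.1.2, k.2),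
    - (k.1.1 * slope C (fun t => - spow q (S t)) (k.1.2, k.2))),
   k.1.1 ^+ 2 * (qzeta (k.1.2, k.2) / 2))).
  by apply/funext => k; exact: exp_curve1E.
exact: (continuous_pair (continuous_pair cX cY) cZ).
Qed.

Lemma cylinder_continuous : continuous cylinder.
Proof.
have cr : continuous (fun k : R * R * R => k.1.1).
  by move=> k; apply: (@continuous_comp _ _ _ (fun k : R * R * R => k.1) (fun u : R * R => u.1)); exact: cvg_fst.
have ct : continuous (fun k : R * R * R => k.1.2).
  by move=> k; apply: (@continuous_comp _ _ _ (fun k : R * R * R => k.1) (fun u : R * R => u.2)); [exact: cvg_fst|exact: cvg_snd].
apply: continuous_pair => [|k]; last exact: cvg_snd.
apply: continuous_pair => k.
  apply: (@continuousM _ _ (fun k => k.1.1) (fun k : R * R * R => C k.1.2)); first exact: cr.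
  by apply: (@continuous_comp _ _ _ (fun k : R * R * R => k.1.2) C); [exact: ct|exact: (qcos_continuous p1 pq)].
apply: (@continuousM _ _ (fun k => k.1.1) (fun k : R * R * R => S k.1.2)); first exact: cr.
by apply: (@continuous_comp _ _ _ (fun k : R * R * R => k.1.2) S); [exact: ct|exact: (qsin_continuous p1 pq)].
Qed.

Lemma exp_curve_congr r th th' w t : C th = C th' -> S th = S th' ->
  ex r th w t = ex r th' w t.
Proof.
have [a [n [/andP[a0 a4] ->]]] := qmod_decomposition q1 th.
have [b [m [/andP[b0 b4] ->]]] := qmod_decomposition q1 th'.
have [-> ->] := qtrig_intperiodic p1 pq a n; have [-> ->] := qtrig_intperiodic p1 pq b m.
rewrite !(exp_curve_intperiodic p1 pq) => cE sE; congr (ex r _ w t).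
by apply: (qpoint_inj p1 pq cE sE); rewrite ltr_norml; apply/andP; split; lra.
Qed.

Lemma is_cylindricalE l r th w : is_cylindrical q l r th w <->
  [/\ 0 <= r, 0 <= th < 4 * H & l = cylinder ((r, th), w)].
Proof.
have qpi2 : 2 * qpi q = 4 * H by rewrite (qpiE q1); ring.
rewrite /is_cylindrical qpi2 /covpair /Xfield /Yfield /Zfield /= !mul0r !oppr0 !mulr0 !mulr1 !addr0 !add0r.
case: l => -[a b] c /=; split => [[r0 t0 -> -> ->]//|[r0 t0 [-> -> ->]]//].
Qed.

Lemma cylinder_surj l : exists r th, [/\ 0 <= r, 0 <= th < 4 * H, l = cylinder ((r, th), l.2)
  & l.1 != (0, 0) -> 0 < r].
Proof.
case: l => -[a b] c /=; have [[-> ->]|ab0] := eqVneq (a, b) (0, 0).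
  by exists 0, 0; rewrite /cylinder /= !mul0r lexx mulr_gt0//; split.
have [r [t [r0 t4 -> ->]]] := lnorm_polar p1 pq ab0.
by exists r, t; split => //; exact: ltW.
Qed.

Lemma cylinder_inj r th w r' th' w' : 0 <= r -> 0 <= r' ->
  cylinder ((r, th), w) = cylinder ((r', th'), w') ->
  [/\ r = r', w = w' & r != 0 -> C th = C th' /\ S th = S th'].
Proof.
move=> r0 r0' [/= E1 E2 ->].
have rE : r = r'.
  have := lnormZ (C th, S th) q0 r0; rewrite /= E1 E2 (lnorm_qpoint p1 pq).
  have := lnormZ (C th', S th') q0 r0'; rewrite /= (lnorm_qpoint p1 pq) => ->.
  by rewrite !mulr1.
split=> // rn0; rewrite -rE in E1 E2.
by split; [exact: (mulfI rn0)|exact: (mulfI rn0)].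
Qed.

(** The coordinates picked by [get] do not matter: they agree up to an angle with the same cosine
    and sine, unless r = 0, where the curve is constant. *)
Lemma heis_exp_cylinder r th w : 0 <= r ->
  heis_exp q (cylinder ((r, th), w)) = ex r th w 1.
Proof.
move=> r0; rewrite /heis_exp; set P := (X in get X).
have : P (get P).
  have [th' [n [h E]]] := qmod_decomposition q1 th.
  apply: getPex; exists ((r, th'), w); apply/is_cylindricalE; split => //=.
  by rewrite /cylinder /= E; have [-> ->] := qtrig_intperiodic p1 pq th' n.
case: (get P) => -[r' th'] w' /is_cylindricalE[/= r0' _ E].
have [<- <- cs] := cylinder_inj r0 r0' E.
have [->|rn] := eqVneq r 0; first by rewrite !exp_curve_r0.
by have [cE sE] := cs rn; apply: exp_curve_congr.
Qed.

Definition cylinder_box (M : R) : set (R * R * R) :=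
  [set k | [/\ 0 <= k.1.1 <= M, 0 <= k.1.2 <= 4 * H & `|k.2| <= M]].

Lemma cylinder_box_compact M : compact (cylinder_box M).
Proof.
rewrite (_ : cylinder_box M = (`[0, M] `*` `[0, 4 * H]) `*` `[(- M), M])%classic; last first.
  apply/seteqP; split => -[[r t] w]; rewrite /cylinder_box /= !in_itv/= ler_norml.
    by move=> [h1 h2 h3].
  by move=> [[h1 h2] h3].
apply: compact_setX; last exact: segment_compact.
by apply: compact_setX; exact: segment_compact.
Qed.

(** Continuity descends from [cylinder_exp] through the coordinates, although the angle jumps and is
    lost at r = 0: covectors near l have coordinates in one compact box, and all coordinates of l in
    that box have the same image. *)
Lemma heis_exp_continuous : continuous (heis_exp q).
Proof.
move=> l W /=; rewrite nbhsE => -[W' [oW' W'l] sub].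
(* The radius of a covector is at most the sum of its two horizontal entries, each at most |l| + 1
   for a covector within 1 of l. *)
pose M := 2 * (`|l| + 1).
have oV : open (cylinder_exp @^-1` W').
  by apply: open_comp => // k _; exact: cylinder_exp_continuous.
have hY : hausdorff_space (heis R) by exact: norm_hausdorff.
have := @compact_preimage_near _ _ cylinder (cylinder_box M) _ l hY cylinder_continuous
  (@cylinder_box_compact M) oV.
have kV k : cylinder_box M k -> cylinder k = l -> (cylinder_exp @^-1` W') k.
  by case: k => -[r t] w [/= /andP[r0 _] _ _] E; rewrite /preimage /= /cylinder_exp -heis_exp_cylinder// E.
have nd : \forall l' \near l, `|l - l'| < 1 by apply/nbhs_normP; exists 1 => //=.
move=> /(_ kV) nl; move: nd nl; apply: filterS2 => l' h nl.
apply: sub; have [r [th [r0 /andP[t0 t4] E _]]] := cylinder_surj l'.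
have lM : `|l'| <= `|l| + 1.
  rewrite -{1}(subKr l l') (le_trans (ler_normB _ _))// lerD2l; exact: ltW.
have l0 : 0 <= `|l| by exact: normr_ge0.
have := lM; rewrite heis_norm_le => /and3P[h1 h2 h3].
have hk : cylinder_box M ((r, th), l'.2).
  split => /=; last by rewrite /M; lra.
    rewrite r0 /=; apply: (@le_trans _ _ (`|l'.1.1| + `|l'.1.2|)); last by rewrite /M; lra.
    have [d1 d2] := dual_le1 p1 pq th.
    rewrite -[leLHS]mulr1 -(qtrig_dual p1 pq th) mulrDr !mulrA E /= lerD//.
      by rewrite (le_trans (ler_norm _))// normrM ler_piMr.
    by rewrite (le_trans (ler_norm _))// normrM ler_piMr.
  by rewrite t0 ltW.
have : (cylinder_exp @^-1` W') ((r, th), l'.2).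
  by apply: nl.
by rewrite /preimage /= /cylinder_exp -heis_exp_cylinder// -E.
Qed.

End cylindrical_coordinates.

(** * The inverse of exp and its continuity *)

Section logarithm.
Context (R : realType) (p q : R) (p1 : 1 < p) (pq : p^-1 + q^-1 = 1).
Let q1 : 1 < q := conjugate_gt1 p1 pq.
Local Notation H := (qprim q 1).
Let H0 : 0 < H. Proof. exact: qprim1_gt0. Qed.
Local Notation C := (qcos q).
Local Notation S := (qsin q).
Local Notation ex := (exp_curve q).

Lemma exp_off_axis r th w : 0 < r -> `|w| < 4 * H -> (ex r th w 1).1 != (0, 0).
Proof.
move=> r0 w4; have [->|w0] := eqVneq w 0.
  rewrite exp_curve_line mulr1 /=; apply/eqP => -[/eqP].
  rewrite mulf_eq0 (gt_eqF r0) /= => /eqP c0 /eqP; rewrite mulf_eq0 (gt_eqF r0) /= => /eqP s0.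
  by have := qtrig_dual p1 pq th; rewrite c0 s0 !mulr0 addr0 => /eqP; rewrite eq_sym oner_eq0.
rewrite exp_curve_circle// mulr1 /=; apply/eqP => -[/eqP].
have rw0 : r / w != 0 by rewrite mulf_neq0 ?invr_eq0// gt_eqF.
rewrite mulf_eq0 (negbTE rw0) subr_eq0 => /eqP sE /eqP.
rewrite oppr_eq0 mulf_eq0 (negbTE rw0) subr_eq0 => /eqP cE.
have := qpoint_inj p1 pq cE sE; rewrite addrK => /(_ w4) E.
by move/eqP: w0; apply; lra.
Qed.

Lemma exp_curve_full r th w : `|w| = 4 * H ->
  ex r th w 1 = ((0, 0), Num.sg w * (2 * H * (r / `|w|) ^+ 2)).
Proof.
move=> w4; have w0 : w != 0 by rewrite -normr_eq0 w4 mulf_neq0// gt_eqF.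
by rewrite -(exp_curve_periodic p1 pq r th w0) w4 divff// -w4 normr_eq0.
Qed.

Lemma exp_neq0 r th w : 0 < r -> `|w| <= 4 * H -> ex r th w 1 != ((0, 0), 0).
Proof.
move=> r0; rewrite le_eqVlt => /predU1P[w4|w4]; last first.
  by apply: contra (exp_off_axis th r0 w4) => /eqP->.
rewrite exp_curve_full//; apply/eqP => -[/eqP]; apply/negP.
have w0 : w != 0 by rewrite -normr_eq0 w4 mulf_neq0// gt_eqF.
rewrite !mulf_neq0 ?sgr_eq0// ?gt_eqF// ?invr_gt0 ?normr_gt0//.
Qed.

(** Minimality of both arcs gives r = r'; then [minimiser_through_point], with the second arc as
    initial arc and a continuation of zero duration, identifies the remaining data. The closed bound
    on w' is used at the boundary of the injectivity domain. *)
Lemma exp_inj r th w r' th' w' : 0 < r -> 0 < r' -> `|w| < 4 * H -> `|w'| <= 4 * H ->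
  ex r th w 1 = ex r' th' w' 1 -> [/\ r = r', C th = C th', S th = S th' & w = w'].
Proof.
move=> r0 r0' w4 w4' E.
have le01 : (0 : R) <= 1 := ler01.
have cal := exp_calibrated p1 pq th w 0 le01 (ltW r0).
have cal' := exp_calibrated p1 pq th' w' 0 le01 (ltW r0').
have rr' : r <= r'.
  have := minimal_length p1 pq cal' (r := r) (th := th) (w := w).
  by rewrite !subr0 mulr1 mulr0 subr0 exp_curve0 E => /(_ erefl erefl r0 (ltW w4)).
have r'r : r' <= r.
  have := minimal_length p1 pq cal (r := r') (th := th') (w := w').
  by rewrite !subr0 mulr1 mulr0 subr0 exp_curve0 E => /(_ erefl erefl r0' w4').
have rE : r = r' by apply/eqP; rewrite eq_le rr'.
have cal1 := exp_calibrated p1 pq th' w' 0 (lexx 1) (ltW r0').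
have := minimiser_through_point p1 pq cal1 (r0 := r') (th0 := th') (w0 := w') (r := r) (th := th) (w := w).
rewrite !subr0 !subrr addr0 => /(_ erefl (esym E) r0' r0 w4 r'r) [cE sE wE].
split => //; move: wE; rewrite -rE => /(mulIf (lt0r_neq0 r0)) ->//.
Qed.

(** For r = 1 the image stays away from e by compactness; the horizontal coordinates scale by r and
    the height by r^2, which is at least r. *)
Lemma exp_proper : exists2 m, 0 < m & forall r th w, 1 <= r -> `|w| <= 4 * H ->
  r * m <= `|ex r th w 1|.
Proof.
have hY : hausdorff_space (heis R) by exact: norm_hausdorff.
pose K : set (R * R * R) := (`[1, 1] `*` `[0, 4 * H]) `*` `[(- (4 * H)), 4 * H].
have cK : compact K.
  apply: compact_setX; last exact: segment_compact.
  by apply: compact_setX; exact: segment_compact.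
have := @compact_preimage_near _ _ (@cylinder_exp R q) K set0 ((0, 0), 0) hY
  (cylinder_exp_continuous p1 pq) cK open0.
have K0 k : K k -> cylinder_exp q k = ((0, 0), 0) -> set0 k.
  move: k => -[[r th] w] [[/= r1 _] w4] /eqP; apply/negP.
  move: r1 w4; rewrite !in_itv/= -ler_norml => /andP[r1 _] w4.
  by apply: exp_neq0 => //; exact: lt_le_trans r1.
move=> /(_ K0) /nbhs_normP[m /= m0 near0]; exists m => // r th w r1 w4.
have r0 : 0 < r by exact: lt_le_trans r1.
have [th' [n [/andP[t0 t4] ->]]] := qmod_decomposition q1 th.
rewrite (exp_curve_intperiodic p1 pq).
have mE : m <= `|ex 1 th' w 1|.
  rewrite leNgt; apply/negP => lm.
  have : ball_ Num.norm (((0, 0), 0) : heis R) m (ex 1 th' w 1) by rewrite /= sub0r normrN.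
  move=> /near0/(_ ((1, th'), w)); apply => //.
  by split; [split|]; rewrite /= in_itv/= ?lexx ?t0 ?(ltW t4)// -ler_norml.
rewrite exp_curve1Z; move: mE; set h := ex 1 th' w 1.
rewrite !heis_norm /= !normrM (ger0_norm (ltW r0)).
rewrite !le_max -!orbA => /or3P[] h1.
- by rewrite ler_pM2l// h1.
- by apply/orP; right; apply/orP; left; rewrite ler_pM2l.
- apply/orP; right; apply/orP; right; rewrite -mulrA ler_pM2l//.
  by rewrite -[m]mul1r ler_pM// ltW.
Qed.

Lemma cut_domainE l : cut_domain q l <-> exists r th w,
  [/\ 0 < r, 0 <= th < 4 * H, `|w| < 4 * H & l = cylinder q ((r, th), w)].
Proof.
have qpi2 : 2 * qpi q = 4 * H by rewrite (qpiE q1); ring.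
split=> -[r [th [w]]]; rewrite ?qpi2.
  by move=> [/(is_cylindricalE p1 pq)[_ t4 ->] r0 w4]; exists r, th, w.
move=> [r0 t4 w4 ->]; exists r, th, w; rewrite qpi2; split => //.
by apply/(is_cylindricalE p1 pq); split => //; exact: ltW.
Qed.

Definition heis_log (h : heis R) : heis R :=
  get [set l | cut_domain q l /\ heis_exp q l = h].

Lemma heis_logP h : h.1 != (0, 0) ->
  cut_domain q (heis_log h) /\ heis_exp q (heis_log h) = h.
Proof.
move=> h0; apply: (@getPex _ [set l | cut_domain q l /\ heis_exp q l = h]).
case: h h0 => -[x y] z /= xy0.
have [r [th [w [r0 t4 w4 E]]]] := exp_curve_surj p1 pq z xy0.
exists (cylinder q ((r, th), w)); split.
  by apply/cut_domainE; exists r, th, w.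
by rewrite (heis_exp_cylinder p1 pq)// ltW.
Qed.

Lemma heis_expK r th w : 0 < r -> `|w| < 4 * H ->
  heis_log (ex r th w 1) = cylinder q ((r, th), w).
Proof.
move=> r0 w4; have [/cut_domainE[r' [th' [w' [r0' t4' w4' ->]]]]] := heis_logP (exp_off_axis th r0 w4).
rewrite (heis_exp_cylinder p1 pq) ?(ltW r0')// => E.
by have [-> cE sE ->] := exp_inj r0' r0 w4' (ltW w4) E; rewrite /cylinder /= cE sE.
Qed.

Lemma heis_exp_image : heis_exp q @` cut_domain q = [set h | h.1 != (0, 0)].
Proof.
apply/seteqP; split => [h [l /cut_domainE[r [th [w [r0 t4 w4 ->]]]] <-]|h h0] /=.
  by rewrite (heis_exp_cylinder p1 pq) ?(ltW r0)//; exact: exp_off_axis.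
by have [D E] := heis_logP h0; exists (heis_log h).
Qed.

Lemma heis_log_continuous h : h.1 != (0, 0) -> {for h, continuous heis_log}.
Proof.
move=> h0 W /=; rewrite nbhsE => -[W' [oW' W'l] sub].
have [m m0 mE] := exp_proper.
(* For points within 1 of h, [exp_proper] bounds the radius of a preimage by (|h| + 1) / m unless it
   is at most 1. *)
pose M := (`|h| + 1) / m + 1 + 4 * H.
have hM0 : 0 <= (`|h| + 1) / m by rewrite divr_ge0 ?addr_ge0// ltW.
have M4 : 4 * H <= M by rewrite /M; lra.
(* Compactness requires the closed bound on w; points with |w| = 4 H land on the vertical axis and
   are no preimages of h. *)
pose K := cylinder_box q M `&` [set k | `|k.2| <= 4 * H].
have hY : hausdorff_space (heis R) by exact: norm_hausdorff.
have cK : compact K.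
  apply: compact_closedI; first exact: cylinder_box_compact.
  have -> : [set k : R * R * R | `|k.2| <= 4 * H] = snd @^-1` [set w : R | `|w| <= 4 * H] by [].
  apply: closed_comp => [k _|]; first exact: cvg_snd.
  rewrite (_ : [set w : R | _] = `[(- (4 * H)), 4 * H]%classic).
    by apply: compact_closed; [exact: norm_hausdorff|exact: segment_compact].
  by apply/seteqP; split => w /=; rewrite in_itv/= ler_norml.
have oV : open (cylinder q @^-1` W').
  by apply: open_comp => // k _; exact: (cylinder_continuous p1 pq).
have := @compact_preimage_near _ _ (@cylinder_exp R q) K _ h hY
  (cylinder_exp_continuous p1 pq) cK oV.
have kV k : K k -> cylinder_exp q k = h -> (cylinder q @^-1` W') k.
  case: k => -[r t] w [[/= /andP[r0 _] _ _] w4] E.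
  have r0' : 0 < r.
    rewrite lt_neqAle r0 andbT; apply/eqP => rE; move: h0.
    by rewrite -E /cylinder_exp -rE /= exp_curve_r0 eqxx.
  have w4' : `|w| < 4 * H.
    rewrite lt_neqAle w4 andbT; apply/eqP => wE; move: h0.
    by rewrite -E /cylinder_exp /= exp_curve_full//= eqxx.
  by move: W'l; rewrite -E /cylinder_exp /= heis_expK.
move=> /(_ kV) nl.
have nd : \forall h' \near h, `|h - h'| < 1 by apply/nbhs_normP; exists 1 => //=.
have no : \forall h' \near h, h'.1 != (0, 0).
  have c1 : (fst : heis R -> R * R) @ h --> h.1 by exact: cvg_fst.
  exact: (cvgr_neq0 _ c1 h0).
suff : \forall h' \near h, W (heis_log h') by [].
move: nd no nl; apply: filterS3 => h' hd h0' nl; apply: sub.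
case: h' hd h0' nl => -[x y] z hd xy0 nl.
have [r [th [w [r0 /andP[t0 t4] w4 E]]]] := exp_curve_surj p1 pq z xy0.
rewrite /= -E heis_expK//; apply: nl => //.
split; last exact: ltW.
split=> /=; [rewrite (ltW r0) /=|by rewrite t0 ltW|by rewrite (le_trans (ltW w4))].
have [r1|r1] := leP r 1; first by rewrite /M; lra.
have := mE r th w (ltW r1) (ltW w4); rewrite E -ler_pdivlMr// => rm.
apply: (le_trans rm); apply: (@le_trans _ _ ((`|h| + 1) / m)); last by rewrite /M; lra.
rewrite ler_pM2r ?invr_gt0// -{1}(subKr h ((x, y), z)) (le_trans (ler_normB _ _))//.
by rewrite lerD2l ltW.
Qed.

Lemma heis_exp_homeomorphism : homeomorphism_on (cut_domain q) (heis_exp q).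
Proof.
split; first exact: continuous_subspaceT (heis_exp_continuous p1 pq).
exists heis_log; split.
  move=> l; rewrite inE => /cut_domainE[r [th [w [r0 t4 w4 ->]]]].
  by rewrite (heis_exp_cylinder p1 pq) ?(ltW r0)// heis_expK.
rewrite heis_exp_image; apply: continuous_in_subspaceT => h; rewrite inE /=.
exact: heis_log_continuous.
Qed.

Lemma heis_exp_complement :
  ~` (heis_exp q @` cut_domain q) = [set h : heis R | h.1.1 = 0 /\ h.1.2 = 0].
Proof.
rewrite heis_exp_image; apply/seteqP; split => -[[x y] z] /=.
  by move=> /negP; rewrite negbK => /eqP[-> ->].
by move=> [-> ->]; apply/negP; rewrite negbK eqxx.
Qed.

Lemma vertical_lineE (a b : R) : [set h : heis R | h.1.1 = a /\ h.1.2 = b] =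
  (([set a] `*` [set b]) `*` setT)%classic.
Proof.
apply/seteqP; split => -[[x y] z] /=; first by move=> [-> ->].
by move=> [[-> ->]].
Qed.

Lemma vertical_line_measurable (a b : R) :
  measurable [set h : heis R | h.1.1 = a /\ h.1.2 = b].
Proof.
rewrite vertical_lineE.
by apply: measurableX => //; apply: measurableX; exact: measurable_set1.
Qed.

Lemma vertical_line_negligible (a b : R) :
  (@leb3 R).-negligible [set h : heis R | h.1.1 = a /\ h.1.2 = b].
Proof.
exists [set h : heis R | h.1.1 = a /\ h.1.2 = b]; split => //.
  exact: vertical_line_measurable.
rewrite vertical_lineE.
have m2 : measurable (([set a] `*` [set b])%classic : set (R * R)).
  by apply: measurableX; exact: measurable_set1.
have E2 : leb2 (([set a] `*` [set b])%classic : set (R * R)) = 0%E.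
  transitivity (@lebesgue_measure R [set a] * @lebesgue_measure R [set b])%E.
    by apply: product_measure1E; exact: measurable_set1.
  by rewrite !lebesgue_measure_set1 mul0e.
rewrite -(mul0e (@lebesgue_measure R setT)) -E2.
exact: product_measure1E.
Qed.

End logarithm.

(** * Minimisers, cut time and injectivity domain *)

Section minimisers.
Context (R : realType) (p q : R) (p1 : 1 < p) (pq : p^-1 + q^-1 = 1).
Let q1 : 1 < q := conjugate_gt1 p1 pq.
Local Notation H := (qprim q 1).
Let H0 : 0 < H. Proof. exact: qprim1_gt0. Qed.
Local Notation C := (qcos q).
Local Notation S := (qsin q).
Local Notation ex := (exp_curve q).
Local Notation mu := (@lebesgue_measure R).

Lemma horizontal_calibrated_sub (a b s t : R) g u1 u2 : horizontal a b g u1 u2 ->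
  (hlength p a b u1 u2 < +oo)%E -> a <= s -> s <= t -> t <= b ->
  exists2 l, calibrated q s t g l &
    l t - l s = arclength p a u1 u2 t - arclength p a u1 u2 s.
Proof.
move=> [ab acg m1 m2 ae1] fin a_s st tb.
have sub : `[s, t]%classic `<=` `[a, b]%classic.
  by move=> x; rewrite /= !in_itv/= => /andP[h1 h2]; rewrite (le_trans a_s h1) (le_trans h2 tb).
have m1' : measurable_fun `[s, t] u1 by exact: measurable_funS m1.
have m2' : measurable_fun `[s, t] u2 by exact: measurable_funS m2.
have hst : horizontal s t g u1 u2.
  split; [exact: st|exact: abs_continuousS acg|exact: m1'|exact: m2'|].
  apply: filterS ae1; first exact: (ae_filter_ringOfSetsType mu).
  by move=> x Hx xst; apply: Hx; exact: sub.
have E := arclengthB m1 m2 fin a_s st tb.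
have fin' : (hlength p s t u1 u2 < +oo)%E by rewrite /hlength -E ltry.
exists (arclength p s u1 u2); first exact: (horizontal_calibrated p1 pq hst fin').
have := arclengthB m1' m2' fin' (lexx s) st (lexx t).
by rewrite -E => -[].
Qed.

Lemma hlength_arclength (a b : R) g u1 u2 : horizontal a b g u1 u2 ->
  (hlength p a b u1 u2 < +oo)%E ->
  hlength p a b u1 u2 = (arclength p a u1 u2 b - arclength p a u1 u2 a)%:E.
Proof. by move=> [ab _ m1 m2 _] fin; rewrite (arclengthB m1 m2 fin (lexx a) ab (lexx b)). Qed.

Lemma hlength_ge0 (a b : R) u1 u2 : (0 <= hlength p a b u1 u2)%E.
Proof. by apply: integral_ge0 => t _; rewrite lee_fin powR_ge0. Qed.

Lemma exp_length_le (a b r th w : R) g u1 u2 : horizontal a b g u1 u2 ->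
  g a = ((0, 0), 0) -> g b = ex r th w 1 -> 0 <= r -> `|w| <= 4 * H ->
  (r%:E <= hlength p a b u1 u2)%E.
Proof.
move=> hor ga gb; rewrite le_eqVlt => /predU1P[<- _|r0 w4]; first exact: hlength_ge0.
have [fin|] := ltP (hlength p a b u1 u2) +oo%E; last by rewrite leye_eq => /eqP ->; rewrite leey.
rewrite (hlength_arclength hor fin) lee_fin.
exact: (minimal_length p1 pq (horizontal_calibrated p1 pq hor fin) ga gb r0 w4).
Qed.

Lemma hdist_exp r th w : 0 <= r -> `|w| <= 4 * H ->
  hdist p ((0, 0), 0) (ex r th w 1) = r%:E.
Proof.
move=> r0 w4; apply/eqP; rewrite eq_le; apply/andP; split.
  apply: ereal_inf_lbound.
  have [hor _] := exp_horizontal p1 pq th w 0 ler01 r0.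
  exists 0, 1, (fun t => ex r th w (t - 0)); do 2 eexists; split; [exact: hor| | |].
  - by rewrite subrr exp_curve0.
  - by rewrite subr0.
  - by rewrite (exp_hlength p1 pq th w 0 ler01 r0) subr0 mulr1.
apply: le_ereal_inf_tmp => _ [a [b [g [u1 [u2 [hor ga gb ->]]]]]].
exact: exp_length_le hor ga gb r0 w4.
Qed.

(** Controls are almost everywhere the derivatives of the horizontal coordinates, so the length does
    not depend on their choice. *)
Lemma exp_controls (a b r th w c : R) u1 u2 : 0 <= r ->
  horizontal a b (fun t => ex r th w (t - c)) u1 u2 ->
  hlength p a b u1 u2 = (r * (b - a))%:E.
Proof.
move=> r0 [ab _ m1 m2 ae1]; have [hor _] := exp_horizontal p1 pq th w c ab r0.
rewrite -(exp_hlength p1 pq th w c ab r0); case: hor => _ _ m1' m2' _.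
apply: ae_eq_integral => //.
- by apply/measurable_EFinP; exact: measurable_lnorm.
- by apply/measurable_EFinP; exact: measurable_lnorm.
apply: filterS ae1; first exact: (ae_filter_ringOfSetsType mu).
move=> t Ht tab; have := Ht tab; move/(hvelocityP _ _ _ _).1 => [d1 d2 _].
have [e1 e2 _] := (hvelocityP _ _ _ _).1 (exp_curve_hvelocity p1 pq r th w c t).
by rewrite (isd_unique d1 e1) (isd_unique d2 e2).
Qed.

Lemma exp_cover (h : heis R) : h != ((0, 0), 0) ->
  exists r th w, [/\ 0 < r, `|w| <= 4 * H & h = ex r th w 1].
Proof.
case: h => -[x y] z h0; have [[xE yE]|xy0] := eqVneq (x, y) (0, 0); last first.
  by have [r [th [w [r0 _ w4 E]]]] := exp_curve_surj p1 pq z xy0; exists r, th, w; rewrite E ltW.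
have z0 : z != 0 by apply: contra h0 => /eqP ->; rewrite xE yE.
have [r r0 E] := exp_curve_vertical p1 pq 0 z0.
exists r, 0, (Num.sg z * (4 * H)); rewrite E xE yE; split => //.
by rewrite normrM normr_sg z0 mul1r gtr0_norm// mulr_gt0.
Qed.

Lemma exp_curve_shift r th w c : ex r th w (c - (c - 1)) = ex r th w 1.
Proof. by congr (ex r th w); ring. Qed.

Lemma calibrated_cat (a b c : R) g1 l1 g2 l2 : calibrated q a b g1 l1 ->
  calibrated q b c g2 l2 -> g1 b = g2 b -> exists g l,
    [/\ calibrated q a c g l, g a = g1 a, g c = g2 c &
        l c - l a = l1 b - l1 a + (l2 c - l2 b)].
Proof.
move=> cal1 cal2 E; have [ab _ _ _] := cal1; have [bc _ _ _] := cal2.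
do 2 eexists; split; first exact: (glue_calibrated cal1 cal2 E).
- by rewrite /glue ab.
- rewrite /glue; case: ifPn => // cb; have -> : c = b by apply/eqP; rewrite eq_le cb.
  exact: E.
- rewrite /glue ab; case: ifPn => cb; last by ring.
  by have -> : c = b; [apply/eqP; rewrite eq_le cb|ring].
Qed.

(** Otherwise the arc would be shortest up to each time s. For a time s with 4 H < |w s| < 8 H it
    ends off the axis, where an arc with |w2| < 4 H arrives too, and [minimiser_through_point] would
    give w s = w2. *)
Lemma exp_beyond r th w r' th' w' : 0 < r -> 4 * H < `|w| ->
  0 < r' -> `|w'| <= 4 * H -> ex r th w 1 = ex r' th' w' 1 -> r' < r.
Proof.
move=> r_gt0 w4 r'_gt0 w4' E; rewrite ltNge; apply/negP => rr'.
have w0 : 0 < `|w| by apply: lt_trans w4; rewrite mulr_gt0.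
(* Midway between one and two full turns, or the whole arc if it ends before that. *)
pose s := Num.min 1 (6 * H / `|w|).
have s1 : s <= 1 by rewrite ge_min lexx.
have s0 : 0 < s by rewrite lt_min ltr01 divr_gt0// mulr_gt0.
have ws4 : 4 * H < `|w * s|.
  rewrite normrM (gtr0_norm s0) /s; case: (leP 1 (6 * H / `|w|)) => _; first by rewrite mulr1.
  by rewrite [_ * (_ / _)]mulrC divfK ?gt_eqF// ltr_pM2r//; lra.
have ws8 : `|w * s| < 8 * H.
  rewrite normrM (gtr0_norm s0); apply: (@le_lt_trans _ _ (6 * H)); last by rewrite ltr_pM2r//; lra.
  by rewrite mulrC -ler_pdivlMr// ge_min lexx orbT.
have wE : w * s = Num.sg w * `|w * s|.
  by rewrite {1}[w * s]numEsg sgrM (gtr0_sg s0) mulr1.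
have wn0 : w != 0 by rewrite -normr_gt0.
have off : (ex (r * s) th (w * s) 1).1 != (0, 0).
  have wsn0 : w * s != 0 by rewrite mulf_neq0// gt_eqF.
  rewrite exp_curve_circle// mulr1 /=; apply/eqP => -[/eqP].
  have rw0 : r * s / (w * s) != 0 by rewrite mulf_neq0 ?invr_eq0// gt_eqF// mulr_gt0.
  rewrite mulf_eq0 (negbTE rw0) subr_eq0 => /eqP sE /eqP.
  rewrite oppr_eq0 mulf_eq0 (negbTE rw0) subr_eq0 => /eqP cE.
  pose d := Num.sg w * (`|w * s| - 4 * H).
  have [n nE] : exists n : int, w * s + th = d + th + n%:~R * (4 * H).
    exists (if 0 < w then 1 else -1).
    rewrite /d {1}wE; case: ltgtP wn0 => // w0' _.
      by rewrite gtr0_sg// !mul1r; ring.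
    by rewrite ltr0_sg//; ring.
  have [cn sn] := qtrig_intperiodic p1 pq (d + th) n.
  rewrite nE cn in cE; rewrite nE sn in sE.
  have := qpoint_inj p1 pq cE sE; rewrite addrK /d normrM normr_sg wn0 mul1r.
  rewrite gtr0_norm ?subr_gt0//.
  move=> /(_ ltac:(lra)) dth; have : Num.sg w * (`|w * s| - 4 * H) = 0 by lra.
  by move/eqP; rewrite mulf_eq0 sgr_eq0 (negbTE wn0) /= subr_eq0 gt_eqF.
have [r2 [th2 [w2 [r2_gt0 _ w24 E2]]]] := exp_curve_surj p1 pq (ex (r * s) th (w * s) 1).2 off.
rewrite -surjective_pairing -surjective_pairing in E2.
have calS := exp_calibrated p1 pq th w 0 (ltW s0) (ltW r_gt0).
have Gs : ex r th w (s - 0) = ex r2 th2 w2 1 by rewrite subr0 exp_curve_scale -E2.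
have r2s : r2 <= r * s.
  have := minimal_length p1 pq calS (r := r2) (th := th2) (w := w2).
  by rewrite subrr exp_curve0 mulr0 !subr0 => /(_ erefl); apply; rewrite ?ltW// -Gs subr0.
have le1 : s - 1 <= s by lra.
have cal2 := exp_calibrated p1 pq th2 w2 (s - 1) le1 (ltW r2_gt0).
have cal3 := exp_calibrated p1 pq th w 0 s1 (ltW r_gt0).
(* The arc up to s is replaced by the one with parameter [w2]; as the whole cannot become shorter
   than r', which is at least r, the replacement is no gain. *)
have match2 : ex r2 th2 w2 (s - (s - 1)) = ex r th w (s - 0) by rewrite exp_curve_shift.
have [G [l [calG G0 G1 lE]]] := calibrated_cat cal2 cal3 match2.
rewrite subrr exp_curve0 in G0; rewrite subr0 E in G1.
have total := minimal_length p1 pq calG G0 G1 r'_gt0 w4'.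
rewrite lE in total.
have r2E : r * s <= r2 by lra.
(* The first half of the arc plays the initial arc, the second half the continuation. *)
pose s' := s / 2; have s'0 : 0 < s' by rewrite divr_gt0.
have s's : s' <= s by rewrite /s'; lra.
have calM := exp_calibrated p1 pq th w 0 s's (ltW r_gt0).
have M1 : ex r th w (s' - 0) = ex (r * s') th (w * s') 1 by rewrite subr0 exp_curve_scale.
have rs'0 : 0 < r * s' by rewrite mulr_gt0.
have tot : r * s' + (r * (s - s') - r * (s' - s')) <= r2 by lra.
have [_ _ wE2] := minimiser_through_point p1 pq calM M1 Gs rs'0 r2_gt0 w24 tot.
have r2E' : r2 = r * s by lra.
have : w * s = w2.
  apply: (mulfI (lt0r_neq0 rs'0)); move: wE2; rewrite r2E'; lra.
by move=> E3; move: w24; rewrite -E3 ltNge (ltW ws4).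
Qed.

Lemma exp_length_minimising r th w T : 0 < r -> 0 < T ->
  length_minimising p 0 T (ex r th w) <-> `|w| * T <= 4 * H.
Proof.
move=> r0 T0; have rT0 : 0 < r * T by rewrite mulr_gt0.
have nE : `|w * T| = `|w| * T by rewrite normrM (gtr0_norm T0).
have gE : ex r th w = (fun t => ex r th w (t - 0)).
  by apply/funext => t; rewrite subr0.
split; last first.
  move=> wT; have [hor _] := exp_horizontal p1 pq th w 0 (ltW T0) (ltW r0).
  do 2 eexists; split; first by rewrite gE; exact: hor.
  rewrite (exp_hlength p1 pq th w 0 (ltW T0) (ltW r0)) exp_curve0 exp_curve_scale subr0.
  by rewrite hdist_exp ?nE// ltW.
move=> [u1 [u2 [hor]]]; rewrite {1}gE in hor.
rewrite (exp_controls (ltW r0) hor) exp_curve0 exp_curve_scale subr0 => D.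
rewrite leNgt; apply/negP => wT; rewrite -nE in wT.
(* [exp_cover] leaves out e, but a return to e has distance 0 and positive length. *)
have [E|En0] := eqVneq (ex (r * T) th (w * T) 1) ((0, 0), 0).
  have Z : hdist p ((0, 0), 0) ((0, 0), 0) = (0 : R)%:E.
    by rewrite -[in X in hdist p _ X](exp_curve_r0 q 0 0 1) hdist_exp// normr0 mulr_ge0// ltW.
  by move: D; rewrite E Z => -[rE]; move: rT0; rewrite rE ltxx.
have [r' [th' [w' [r0' w4' E']]]] := exp_cover En0.
have := exp_beyond rT0 wT r0' w4' E'.
move: D; rewrite E' hdist_exp ?(ltW r0')// => -[->].
by rewrite ltxx.
Qed.

Lemma cut_timeE r th w : 0 < r ->
  cut_time p q r th w = if w == 0 then +oo%E else (2 * qpi q / `|w|)%:E.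
Proof.
move=> r0; have qpi2 : 2 * qpi q = 4 * H by rewrite (qpiE q1); ring.
rewrite /cut_time qpi2; case: eqP => [->|/eqP w0].
  apply/eqyP => A A0; apply: ereal_sup_ubound; exists A => //; split => //.
  by apply/exp_length_minimising => //; rewrite normr0 mul0r mulr_ge0// ltW.
have nw : 0 < `|w| by rewrite normr_gt0.
have T0 : 0 < 4 * H / `|w| by rewrite divr_gt0// mulr_gt0.
apply/eqP; rewrite eq_le; apply/andP; split.
  apply: ge_ereal_sup => _ [T [T0' +] <-].
  by move/(exp_length_minimising _ _ r0 T0'); rewrite lee_fin ler_pdivlMr// mulrC.
apply: ereal_sup_ubound; exists (4 * H / `|w|) => //; split => //.
by apply/exp_length_minimising => //; rewrite mulrC divfK// gt_eqF.
Qed.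

(** Locates an intermediate point of a minimiser by length alone: some exponential arc reaches this
    point, with the second piece it is again a minimiser, and [minimiser_through_point] makes it an
    initial part of the target arc. Both uniqueness statements rest on this. *)
Lemma calibrated_through_point (a c b r th w : R) g1 l1 g2 l2 :
  calibrated q a c g1 l1 -> calibrated q c b g2 l2 -> g1 a = ((0, 0), 0) ->
  g1 c = g2 c -> g2 b = ex r th w 1 -> 0 < r -> `|w| < 4 * H ->
  l1 c - l1 a + (l2 b - l2 c) <= r -> g2 c = ex r th w ((l1 c - l1 a) / r).
Proof.
move=> cal1 cal2 g1a mE g2b r_gt0 w4 tot.
have [ac _ _ _] := cal1; have [cb _ _ _] := cal2.
have l1ge := calibrated_nondecreasing cal1 q1 (lexx a) ac (lexx c).
have [mO|m0] := eqVneq (g2 c) ((0, 0), 0).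
  have := minimal_length p1 pq cal2 mO g2b r_gt0 (ltW w4) => h.
  have -> : l1 c - l1 a = 0 by lra.
  by rewrite mul0r exp_curve0.
have [r0 [th0 [w0 [r0_gt0 w04 E]]]] := exp_cover m0.
have h1 : r0 <= l1 c - l1 a.
  by apply: (minimal_length p1 pq cal1 g1a _ r0_gt0 w04); rewrite mE E.
have tot' : r0 + (l2 b - l2 c) <= r by lra.
have [cE sE wE] := minimiser_through_point p1 pq cal2 E g2b r0_gt0 r_gt0 w4 tot'.
have le1 : c - 1 <= c by lra.
have cal0 := exp_calibrated p1 pq th0 w0 (c - 1) le1 (ltW r0_gt0).
have match0 : ex r0 th0 w0 (c - (c - 1)) = g2 c by rewrite exp_curve_shift E.
have [G [l [calG G0 G1 lE]]] := calibrated_cat cal0 cal2 match0.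
rewrite subrr exp_curve0 in G0; rewrite g2b in G1.
have tot2 := minimal_length p1 pq calG G0 G1 r_gt0 (ltW w4).
rewrite lE in tot2.
have r0E : l1 c - l1 a = r0 by lra.
rewrite r0E E [RHS]exp_curve_scale.
have -> : r * (r0 / r) = r0 by field; rewrite gt_eqF.
have -> : w * (r0 / r) = w0.
  by apply: (mulIf (lt0r_neq0 r_gt0)); rewrite wE; field; rewrite gt_eqF.
exact: (exp_curve_congr p1 pq r0 w0 1 cE sE).
Qed.

Lemma exp_unique_minimiser r th w : 0 < r -> `|w| < 4 * H ->
  unique_length_minimiser p (ex r th w).
Proof.
move=> r0 w4; split.
  by apply/exp_length_minimising => //; rewrite mulr1 ltW.
move=> a b h [u1 [u2 [hor D]]] ha hb.
rewrite ha hb exp_curve0 hdist_exp ?(ltW r0) ?(ltW w4)// in D.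
have fin : (hlength p a b u1 u2 < +oo)%E by rewrite D ltry.
have [ab _ m1 m2 _] := hor.
have lE := hlength_arclength hor fin; rewrite D in lE; case: lE => lE.
pose l := arclength p a u1 u2; rewrite -/l in lE.
have cal := horizontal_calibrated p1 pq hor fin.
have ha0 : h a = ((0, 0), 0) by rewrite ha exp_curve0.
(* Arc length divided by its total value r. *)
exists (fun t => (l t - l a) / r); split.
- have ik : mu.-integrable `[a, b] (EFin \o (fun x => lnorm p (u1 x, u2 x))).
    apply/integrableP; split; first by apply/measurable_EFinP; exact: measurable_lnorm.
    rewrite (_ : (\int[mu]_(x in `[a, b]) `|(EFin \o _) x|)%E = hlength p a b u1 u2) ?fin//.
    by apply: eq_integral => x _ /=; rewrite ger0_norm// powR_ge0.
  have cl := parameterized_integral_continuous ab ik.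
  move=> t; apply: (@continuousM _ (subspace `[a, b]%classic) (fun t => l t - l a) (fun=> r^-1)).
    apply: (@continuousB _ _ (subspace `[a, b]%classic) l (fun=> l a)); first exact: cl.
    exact: cst_continuous.
  exact: cst_continuous.
- move=> s t; rewrite !in_itv/= => /andP[s1 s2] /andP[t1 t2] st.
  rewrite ler_pM2r ?invr_gt0// lerD2r.
  exact: (calibrated_nondecreasing cal q1 s1 st t2).
- by rewrite subrr mul0r.
- by rewrite -lE divff// gt_eqF.
move=> t; rewrite in_itv/= => /andP[at' tb].
have [la cala laE] := horizontal_calibrated_sub hor fin (lexx a) at' tb.
have [lb calb lbE] := horizontal_calibrated_sub hor fin at' tb (lexx b).
have := calibrated_through_point cala calb ha0 erefl hb r0 w4.
rewrite laE lbE -/l; apply; rewrite lE; lra.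
Qed.

Lemma injectivity_domainE : injectivity_domain p q = cut_domain q.
Proof.
have qpi2 : 2 * qpi q = 4 * H by rewrite (qpiE q1); ring.
apply/seteqP; split => l [r [th [w]]]; rewrite ?qpi2; last first.
  by move=> [cyl r0 w4]; exists r, th, w; split => //; exact: exp_unique_minimiser.
move=> [cyl r0 [mini uniq]]; exists r, th, w; rewrite qpi2; split => //.
have w4 : `|w| <= 4 * H.
  by move/(exp_length_minimising _ _ r0 ltr01): mini; rewrite mulr1.
rewrite lt_neqAle w4 andbT; apply/eqP => wE.
(* For |w| = 4 H the endpoint does not depend on the angle. Half a turn gives a second minimiser,
   whose point at time 1/2 does not lie on the first one. *)
have mini' : length_minimising p 0 1 (ex r (th + 2 * H) w).
  by apply/exp_length_minimising => //; rewrite mulr1.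
have [phi [_ mono phi0 phi1 hE]] : reparametrisation (ex r th w) 0 1 (ex r (th + 2 * H) w).
  apply: uniq => //; first by rewrite !exp_curve0.
  by rewrite (exp_curve_full p1 pq r (th + 2 * H) wE) (exp_curve_full p1 pq r th wE).
have i0 : (0 : R) \in `[0, 1] by rewrite in_itv/= lexx ler01.
have i1 : (1 : R) \in `[0, 1] by rewrite in_itv/= lexx ler01.
have ih : (1 / 2 : R) \in `[0, 1] by rewrite in_itv/=; apply/andP; split; lra.
have h0 : phi 0 <= phi (1 / 2) by apply: mono => //; lra.
rewrite phi0 in h0.
have h1 : phi (1 / 2) <= phi 1 by apply: mono => //; lra.
rewrite phi1 in h1.
have := hE _ ih; rewrite exp_curve_scale [RHS]exp_curve_scale => E.
have r20 : 0 < r * (1 / 2) by rewrite mulr_gt0//; lra.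
have w2 : `|w * (1 / 2)| < 4 * H.
  have half : (0 : R) < 1 / 2 by lra.
  have half1 : (1 : R) / 2 < 1 by lra.
  by rewrite normrM wE (gtr0_norm half) gtr_pMr// mulr_gt0.
have ph0 : 0 < phi (1 / 2).
  rewrite lt_neqAle h0 andbT; apply/eqP => Z; move: E; rewrite -Z mulr0 exp_curve_r0 => /eqP.
  by apply/negP; apply: (exp_neq0 p1 pq _ r20 (ltW w2)).
have [||_ cE sE _] := exp_inj p1 pq r20 _ w2 _ E.
- by rewrite mulr_gt0.
- by rewrite normrM wE (gtr0_norm ph0) ler_piMr// mulr_ge0// ltW.
have [cE' sE'] := qtrigD2 p1 pq th; rewrite cE' in cE; rewrite sE' in sE.
have c0 : C th = 0 by lra.
have s0 : S th = 0 by lra.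
have := qtrig_dual p1 pq th; rewrite c0 s0 !mul0r addr0 => /eqP.
by rewrite eq_sym oner_eq0.
Qed.

End minimisers.

(** * Measurability of continuous maps for the product sigma-algebra *)

Section measurability.
Context (R : realType).

(** An open set is the union of the boxes with rational centre and radius 1 / (n + 1) that it
    contains, and there are countably many of them. *)
Lemma open_measurable_heisX (O : set (heis R * R)) :
  (forall z, O z -> nbhs z O) -> measurable O.
Proof.
move=> oO; pose e (n : nat) : R := n.+1%:R^-1.
have e0 n : 0 < e n by rewrite invr_gt0.
pose B (k : rat * rat * rat * rat * nat) : set (heis R * R) :=
  let: (a, b, c, d, n) := k in
  ((ball (ratr a : R) (e n) `*` ball (ratr b : R) (e n)) `*` ball (ratr c : R) (e n))
    `*` ball (ratr d : R) (e n).
have mB k : measurable (B k).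
  case: k => -[[[a b] c] d] n; apply: measurableX; last exact: measurable_ball.
  apply: measurableX; last exact: measurable_ball.
  by apply: measurableX; exact: measurable_ball.
have -> : O = \bigcup_k (if asbool (B k `<=` O) then B k else set0).
  apply/seteqP; split => [z Oz|z [k _]]; last by case: asboolP => // sub; exact: sub.
  have /nbhs_ballP[d /= d0 sub] := oO z Oz.
  have [n dn] : exists n, 2 * e n < d.
    have d2 : 0 < d / 2 by rewrite divr_gt0.
    have [n _ /(_ n (leqnn n)) nd] := near_infty_natSinv_lt (PosNum d2).
    by exists n; move: nd => /=; rewrite -/(e n); lra.
  have rat_near (x : R) : exists r : rat, `|ratr r - x| < e n.
    have xe : x - e n < x + e n by have := e0 n; lra.
    have [r] := rat_in_itvoo xe; rewrite in_itv/= => /andP[h1 h2]; exists r.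
    by rewrite ltr_norml; apply/andP; split; lra.
  case: z Oz sub => -[[x y] z] t Oz sub.
  have [a xa] := rat_near x; have [b yb] := rat_near y.
  have [c zc] := rat_near z; have [s ts] := rat_near t.
  have near2 (u v w : R) : `|u - v| < e n -> `|u - w| < e n -> `|v - w| < d.
    move=> h1 h2; rewrite (_ : v - w = (u - w) - (u - v)); last by ring.
    by rewrite (le_lt_trans (ler_normB _ _))//; lra.
  exists (a, b, c, s, n) => //; case: asboolP => [_|]; first by [].
  case=> -[[[x' y'] z'] t'] [[[/= h1 h2] h3] h4]; apply: sub.
  by split; [split; [split|]|]; rewrite /ball /=; [exact: near2 xa h1|exact: near2 yb h2
    |exact: near2 zc h3|exact: near2 ts h4].
apply: countable_bigcupT_measurable => // k; case: asboolP => // _; exact: mB.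
Qed.

Lemma measurable_fun_heisX (D U : set (heis R * R)) (f : heis R * R -> heis R) :
  measurable D -> D `<=` U -> (forall z, U z -> nbhs z U) ->
  (forall z, U z -> {for z, continuous f}) -> measurable_fun D f.
Proof.
move=> mD DU oU cf.
have real (g : heis R * R -> R) : (forall z, U z -> {for z, continuous g}) ->
    measurable_fun setT (g \_ D).
  move=> cg; apply/(measurable_restrictT g mD).
  apply: (measurability _ (RGenOInfty.measurableE R)) => _ [_ [a ->] <-].
  have -> : D `&` g @^-1` `]a, +oo[ = (U `&` g @^-1` `]a, +oo[) `&` D.
    by apply/seteqP; split => z [] => [Dz gz|[_ gz] Dz]; split => //; split => //; exact: DU.
  apply: measurableI => //; apply: open_measurable_heisX => z [Uz].
  rewrite /= in_itv/= andbT => ag; apply: filterI; first exact: oU.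
  have := cg z Uz => /(_ `]a, +oo[%classic); apply.
  apply: open_nbhs_nbhs; split; first exact: interval_open.
  by rewrite /= in_itv/= ag.
have c1 z : U z -> {for z, continuous (fun z => (f z).1.1)}.
  move=> Uz; apply: (@continuous_comp _ _ _ f (fun h => h.1.1)); first exact: cf.
  by apply: (@continuous_comp _ _ _ fst fst); exact: cvg_fst.
have c2 z : U z -> {for z, continuous (fun z => (f z).1.2)}.
  move=> Uz; apply: (@continuous_comp _ _ _ f (fun h => h.1.2)); first exact: cf.
  by apply: (@continuous_comp _ _ _ fst snd); [exact: cvg_fst|exact: cvg_snd].
have c3 z : U z -> {for z, continuous (fun z => (f z).2)}.
  move=> Uz; apply: (@continuous_comp _ _ _ f snd); first exact: cf.
  exact: cvg_snd.
pose F z := (((fun z => (f z).1.1) \_ D) z, ((fun z => (f z).1.2) \_ D) z,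
  ((fun z => (f z).2) \_ D) z).
have mF : measurable_fun D F.
  apply: measurable_funTS; apply: measurable_fun_pair; last exact: real c3.
  by apply: measurable_fun_pair; [exact: real c1|exact: real c2].
apply: eq_measurable_fun mF => z Dz; rewrite /F /patch Dz.
by rewrite -!surjective_pairing.
Qed.

End measurability.

(** * Left translations *)

Section left_translations.
Context (R : realType).
Implicit Types x y z : heis R.

Definition hinv x : heis R := ((- x.1.1, - x.1.2), - x.2).

Lemma heis_eq x y : x.1.1 = y.1.1 -> x.1.2 = y.1.2 -> x.2 = y.2 -> x = y.
Proof. by case: x => -[? ?] ?; case: y => -[? ?] ? /= -> -> ->. Qed.

Lemma hmulA x y z : hmul x (hmul y z) = hmul (hmul x y) z.
Proof. by apply: heis_eq => /=; ring. Qed.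

Lemma hmulx0 x : hmul x ((0, 0), 0) = x.
Proof. by apply: heis_eq => /=; ring. Qed.

Lemma hmul0x x : hmul ((0, 0), 0) x = x.
Proof. by apply: heis_eq => /=; ring. Qed.

Lemma hmulVx x : hmul (hinv x) x = ((0, 0), 0).
Proof. by apply: heis_eq => /=; ring. Qed.

Lemma hmulxV x : hmul x (hinv x) = ((0, 0), 0).
Proof. by apply: heis_eq => /=; ring. Qed.

Lemma hmulK x y : hmul (hinv x) (hmul x y) = y.
Proof. by rewrite hmulA hmulVx hmul0x. Qed.

Lemma hmulKV x y : hmul x (hmul (hinv x) y) = y.
Proof. by rewrite hmulA hmulxV hmul0x. Qed.

Lemma hinv_hmulV x y : hinv (hmul (hinv x) y) = hmul (hinv y) x.
Proof. by apply: heis_eq => /=; ring. Qed.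

Lemma hmul_continuous x : continuous (hmul x).
Proof.
have c11 : continuous (fun h : heis R => h.1.1).
  by move=> h; apply: (@continuous_comp _ _ _ fst fst); exact: cvg_fst.
have c12 : continuous (fun h : heis R => h.1.2).
  by move=> h; apply: (@continuous_comp _ _ _ fst snd); [exact: cvg_fst|exact: cvg_snd].
have cD (f g : heis R -> R) : continuous f -> continuous g -> continuous (fun h => f h + g h).
  by move=> cf cg h; apply: (@continuousD _ _ _ f g); [exact: cf|exact: cg].
have cM (f g : heis R -> R) : continuous f -> continuous g -> continuous (fun h => f h * g h).
  by move=> cf cg h; apply: (@continuousM _ _ f g); [exact: cf|exact: cg].
have cc (c : R) : continuous (fun _ : heis R => c) by move=> h; exact: cst_continuous.
apply: continuous_pair.
  by apply: continuous_pair; apply: cD.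
apply: (cD (fun h => x.2 + h.2) (fun h => (x.1.1 * h.1.2 - h.1.1 * x.1.2) / 2)).
  by apply: cD => // h; exact: cvg_snd.
apply: (cM (fun h => x.1.1 * h.1.2 - h.1.1 * x.1.2) (fun=> 2^-1)) => //.
apply: (cD (fun h => x.1.1 * h.1.2) (fun h => - (h.1.1 * x.1.2))); first exact: cM.
by move=> h; apply: (@continuousN _ _ _ (fun h : heis R => h.1.1 * x.1.2)); apply: (cM (fun h => h.1.1) (fun=> x.1.2)).
Qed.

Lemma horizontal_hmul x (a b : R) g u1 u2 : horizontal a b g u1 u2 ->
  horizontal a b (hmul x \o g) u1 u2.
Proof.
move=> [ab acg m1 m2 ae1]; split => //.
  exact: abs_continuous_comp (hmul_lipschitz x) acg.
apply: filterS ae1; first exact: (ae_filter_ringOfSetsType lebesgue_measure).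
by move=> t Ht tab; apply: hvelocity_hmul; exact: Ht.
Qed.

Lemma hdist_hmul (p : R) x y z : hdist p (hmul x y) (hmul x z) = hdist p y z.
Proof.
have le x' y' z' : (hdist p (hmul x' y') (hmul x' z') <= hdist p y' z')%E.
  apply: le_ereal_inf_tmp => _ [a [b [g [u1 [u2 [hor ga gb ->]]]]]].
  apply: ereal_inf_lbound; exists a, b, (hmul x' \o g), u1, u2.
  by split; [exact: horizontal_hmul|rewrite /= ga|rewrite /= gb|].
apply/eqP; rewrite eq_le le /=.
by have := le (hinv x) (hmul x y) (hmul x z); rewrite !hmulK.
Qed.

End left_translations.

(** * Geodesics of the distance and the cut locus *)

Section geodesics.
Context (R : realType) (p q : R) (p1 : 1 < p) (pq : p^-1 + q^-1 = 1).
Let q1 : 1 < q := conjugate_gt1 p1 pq.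
Local Notation H := (qprim q 1).
Let H0 : 0 < H. Proof. exact: qprim1_gt0. Qed.
Local Notation ex := (exp_curve q).
Implicit Types x y : heis R.

Lemma hdistE x y : hdist p x y = hdist p ((0, 0), 0) (hmul (hinv x) y).
Proof. by rewrite -(hdist_hmul p (hinv x) x y) hmulVx. Qed.

Lemma exp_realised x y : exists r th w,
  [/\ 0 <= r, `|w| <= 4 * H, hmul (hinv x) y = ex r th w 1 & hdist p x y = r%:E].
Proof.
rewrite hdistE; have [->|h0] := eqVneq (hmul (hinv x) y) ((0, 0), 0).
  exists 0, 0, 0; rewrite normr0 exp_curve_r0 lexx mulr_ge0 ?ltW//; split => //.
  rewrite -[in X in hdist p _ X](exp_curve_r0 q 0 0 1) (hdist_exp p1 pq)//.
  by rewrite normr0 mulr_ge0// ltW.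
have [r [th [w [r0 w4 E]]]] := exp_cover p1 pq h0.
by exists r, th, w; rewrite E (hdist_exp p1 pq)// ltW.
Qed.

(** The distance is realised by an exponential arc, and [exp_curve_opp] gives the arc run
    backwards. *)
Lemma hdist_sym x y : hdist p x y = hdist p y x.
Proof.
have [r [th [w [r0 w4 E ->]]]] := exp_realised x y.
have := exp_curve_opp p1 pq r th w; rewrite -E -/(hinv _) hinv_hmulV => E'.
by rewrite hdistE -E' (hdist_exp p1 pq)// normrN.
Qed.

(** A minimiser timed on [c, c + 1], ready for gluing, of which only the calibrated form is kept. *)
Lemma segment_calibrated x y c : exists r g l, [/\ hdist p x y = r%:E,
  calibrated q c (c + 1) g l, g c = x, g (c + 1) = y & l (c + 1) - l c = r].
Proof.
have [r [th [w [r0 w4 E D]]]] := exp_realised x y.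
have c1 : c <= c + 1 by lra.
have cal := calibrated_hmul x (exp_calibrated p1 pq th w c c1 r0).
do 3 eexists; split; [exact: D|exact: cal| | |].
- by rewrite /= subrr exp_curve0 hmulx0.
- by rewrite /= (_ : c + 1 - c = 1) -?E ?hmulKV//; ring.
- by rewrite /=; ring.
Qed.

(** For the lower bound, a minimiser between the points at s and t is inserted into the arc; the
    result still joins e to the end of the arc, and [minimal_length] applies. *)
Lemma exp_curve_geodesic r th w s t : 0 < r -> `|w| <= 4 * H -> 0 <= s -> s <= t -> t <= 1 ->
  hdist p (ex r th w s) (ex r th w t) = (r * (t - s))%:E.
Proof.
move=> r0 w4 s0 st t1; apply/eqP; rewrite eq_le; apply/andP; split.
  apply: ereal_inf_lbound; have [hor _] := exp_horizontal p1 pq th w 0 st (ltW r0).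
  exists s, t, (fun t => ex r th w (t - 0)); do 2 eexists; split; [exact: hor| | |].
  - by rewrite subr0.
  - by rewrite subr0.
  - by rewrite (exp_hlength p1 pq th w 0 st (ltW r0)).
have [r' [g [l [-> cal gs gt lE]]]] := segment_calibrated (ex r th w s) (ex r th w t) s.
rewrite lee_fin; have cal1 := exp_calibrated p1 pq th w 0 s0 (ltW r0).
have m1 : ex r th w (s - 0) = g s by rewrite subr0 gs.
have [G1 [l1 [calG1 G10 G11 l1E]]] := calibrated_cat cal1 cal m1.
(* The inserted piece takes unit time, from s to s + 1, so the last part of the arc is delayed by s
   + 1 - t. *)
pose c := s + 1 - t; have cb : s + 1 <= c + 1 by rewrite /c; lra.
have cal3 := exp_calibrated p1 pq th w c cb (ltW r0).
have m2 : G1 (s + 1) = ex r th w (s + 1 - c).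
  by rewrite G11 gt /c; congr (ex r th w); ring.
have [G2 [l2 [calG2 G20 G21 l2E]]] := calibrated_cat calG1 cal3 m2.
have G2o : G2 0 = ((0, 0), 0) by rewrite G20 G10 subrr exp_curve0.
have G2e : G2 (c + 1) = ex r th w 1 by rewrite G21; congr (ex r th w); ring.
have := minimal_length p1 pq calG2 G2o G2e r0 w4.
by rewrite l2E l1E lE /c => h; rewrite -(lerD2r (r * s + r * (1 - t))); lra.
Qed.

Theorem heis_negligible_cut_locus : negligible_cut_locus (hdist p) (@leb3 R).
Proof.
move=> x; pose cut := [set y : heis R | y.1.1 = x.1.1 /\ y.1.2 = x.1.2].
pose Phi (z : heis R * R) := hmul x (heis_exp q (z.2 *: heis_log q (hmul (hinv x) z.1))).
have off y : ~ cut y -> (hmul (hinv x) y).1 != (0, 0).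
  move=> ny; apply/eqP => -[/= h1 h2]; apply: ny; split; lra.
have PhiE y : ~ cut y -> exists r th w, [/\ 0 < r, `|w| < 4 * H,
    hmul (hinv x) y = ex r th w 1 &
    forall t, 0 <= t -> Phi (y, t) = hmul x (ex r th w t)].
  move=> ny; have [/(cut_domainE p1 pq)[r [th [w [r0 t4 w4 lE]]]] E] := heis_logP p1 pq (off y ny).
  exists r, th, w; split => //.
    by rewrite -E lE (heis_exp_cylinder p1 pq)// ltW.
  move=> t t0; rewrite /Phi /= lE; congr (hmul x _).
  rewrite (_ : t *: _ = cylinder q ((r * t, th), w * t)).
    by rewrite (heis_exp_cylinder p1 pq) -?exp_curve_scale// mulr_ge0// ltW.
  by apply: heis_eq => /=; rewrite /GRing.scale /=; ring.
exists cut, Phi; split.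
- exact: vertical_line_measurable.
- exact: vertical_line_negligible.
- have mC : measurable (~` cut) by apply: measurableC; exact: vertical_line_measurable.
  apply: (@measurable_fun_heisX _ _ [set z | (hmul (hinv x) z.1).1 != (0, 0)]).
  + by apply: measurableX.
  + by move=> [y t] [/= /off].
  + move=> z /= z0.
    have c : {for z, continuous (fun z : heis R * R => (hmul (hinv x) z.1).1)}.
      apply: (@continuous_comp _ _ _ (fun z : heis R * R => hmul (hinv x) z.1) fst); last exact: cvg_fst.
      apply: (@continuous_comp _ _ _ (fun z : heis R * R => z.1) (hmul (hinv x))); first exact: cvg_fst.
      exact: hmul_continuous.
    exact: (cvgr_neq0 _ c z0).
  + move=> z /= z0.
    apply: (@continuous_comp _ _ _ (fun z : heis R * R => heis_exp q (z.2 *: heis_log q (hmul (hinv x) z.1))) (hmul x)); last exact: hmul_continuous.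
    apply: (@continuous_comp _ _ _ (fun z : heis R * R => z.2 *: heis_log q (hmul (hinv x) z.1)) (heis_exp q)); last exact: (heis_exp_continuous p1 pq).
    apply: (@cvgZ _ _ _ (nbhs z) _ (fun z : heis R * R => z.2) (fun z : heis R * R => heis_log q (hmul (hinv x) z.1))); first exact: cvg_snd.
    apply: (@continuous_comp _ _ _ (fun z : heis R * R => hmul (hinv x) z.1) (heis_log q)); last exact: (heis_log_continuous p1 pq).
    apply: (@continuous_comp _ _ _ (fun z : heis R * R => z.1) (hmul (hinv x))); first exact: cvg_fst.
    exact: hmul_continuous.
move=> y ny; have [r [th [w [r0 w4 E PE]]]] := PhiE y ny.
have D : hdist p x y = r%:E.
  by rewrite hdistE E (hdist_exp p1 pq)// ltW.
have yE : y = hmul x (ex r th w 1) by rewrite -E hmulKV.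
split.
  split; [by rewrite PE// exp_curve0 hmulx0|by rewrite PE|].
  have le s t : 0 <= s -> s <= t -> t <= 1 -> hdist p (Phi (y, s)) (Phi (y, t)) = (r * (t - s))%:E.
    move=> s0 st t1; rewrite !PE//; last exact: le_trans st.
    by rewrite hdist_hmul exp_curve_geodesic// ltW.
  move=> s t; rewrite !in_itv/= => /andP[s0 s1] /andP[t0 t1].
  rewrite D -EFinM; have [st|ts] := leP s t.
    by rewrite le// ger0_norm ?subr_ge0// mulrC.
  by rewrite hdist_sym le// ?(ltW ts)// distrC ger0_norm ?subr_ge0 ?(ltW ts)// mulrC.
(* Only distances along g are known. After translation, minimisers from e to the point at t and from
   there to the end have total length r, so [calibrated_through_point] locates the point. *)
move=> g [g0 g1 gd] t; rewrite in_itv/= => /andP[t0 t1]; rewrite PE//.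
have i0 : (0 : R) \in `[0, 1] by rewrite in_itv/= lexx ler01.
have i1 : (1 : R) \in `[0, 1] by rewrite in_itv/= lexx ler01.
have it : t \in `[0, 1] by rewrite in_itv/= t0.
have := gd 0 t i0 it; have := gd t 1 it i1; rewrite g0 g1 D subr0 -!EFinM.
rewrite (ger0_norm t0) ger0_norm ?subr_ge0// => D2 D1.
rewrite -(hdist_hmul p (hinv x)) hmulVx in D1.
rewrite -(hdist_hmul p (hinv x)) E in D2.
have [r1 [g1' [l1 [rE1 cal1 a1 b1 l1E]]]] := segment_calibrated ((0, 0), 0) (hmul (hinv x) (g t)) 0.
have [r2 [g2' [l2 [rE2 cal2 a2 b2 l2E]]]] := segment_calibrated (hmul (hinv x) (g t)) (ex r th w 1) (0 + 1).
rewrite rE1 in D1; rewrite rE2 in D2; case: D1 => D1; case: D2 => D2.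
have m12 : g1' (0 + 1) = g2' (0 + 1) by rewrite b1 a2.
have := calibrated_through_point p1 pq cal1 cal2 a1 m12 b2 r0 w4.
rewrite l1E l2E D1 D2 a2 mulfK ?gt_eqF// => m.
by rewrite -m ?hmulKV//; lra.
Qed.

End geodesics.

Theorem proposition25 (R : realType) (p q : R) (hp : 1 < p)
    (hpq : p^-1 + q^-1 = 1) :
  (forall r theta w : R, 0 < r -> 0 <= theta < 2 * qpi q ->
     cut_time p q r theta w =
       if w == 0 then +oo%E else (2 * qpi q / `|w|)%:E) /\
  injectivity_domain p q = cut_domain q /\
  homeomorphism_on (cut_domain q) (heis_exp q) /\
  ~` (heis_exp q @` cut_domain q) = [set h : heis R | h.1.1 = 0 /\ h.1.2 = 0] /\
  (@leb3 R).-negligible (~` (heis_exp q @` cut_domain q)) /\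
  negligible_cut_locus (hdist p) (@leb3 R).
Proof.
split; first by move=> r theta w r0 _; exact: (cut_timeE hp hpq).
split; first exact: (injectivity_domainE hp hpq).
split; first exact: (heis_exp_homeomorphism hp hpq).
rewrite (heis_exp_complement hp hpq); split; first by [].
split; first exact: vertical_line_negligible.
exact: (heis_negligible_cut_locus hp hpq).
Qed.
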